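(* Consider the continuous multiserver-job (MSJ) system (a single resource, $d=1$) with Poisson arrivals of rate $\lambda>0$, i.i.d. $\mathrm{Exp}(1)$ durations, and i.i.d. resource requirements distributed as $V\in(0,1]$ with a weakly decreasing density function $f_V$ on $(0,1]$. Then the 2-Bucket families 2B $K$-EMW and 2B $K$-EnMSR are throughput-optimal (whenever the system is stable under some Markovian policy, it is stable under 2B $K$-EMW for some $K$, and under some 2B $K$-EnMSR policy for some $K$). In particular, for any $\lambda<\frac{1}{\mathbb E V}$ there exists some $K$ such that the system is stable under 2B $K$-EMW and under (some policy of) 2B $K$-EnMSR. In addition, it is enough to let $K=2^L$, where $L=\left\lfloor-\log_2\left(\frac1\lambda-\mathbb E V\right)\right\rfloor+1$ (provided this $L$ is nonnegative, so that $K$ is a positive integer).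
   Context: **Model (continuous MSJ system).** One server has one resource of capacity $1$. Jobs arrive by a Poisson process of rate $\lambda$. Each job has a resource requirement in $(0,1]$, sampled i.i.d. from the law of $V$ (with density $f_V$), and an independent duration $\sim\mathrm{Exp}(1)$ not observed by the scheduler. A job leaves once it has received service for a total time equal to its duration. The state is the finite list of requirements of the jobs present, in arrival order. A Markovian policy maps each state to a subset of the jobs present with total requirement at most $1$; these jobs are served simultaneously, each at rate $1$ (with preempt-resume). The system is *stable* under a policy if the empty state (no job present; jointly with the auxiliary modulating state when the policy has one) is positive recurrent. **$K$-discretization.** For a positive integer $K$, a job with requirement in $I_k=\left(\frac{k-1}{K},\frac kK\right]$ is a type-$k$ job, $1\le k\le K$; $q_k(t)$ is the number of type-$k$ jobs present. Service options are $M=(M^{(1)},\dots,M^{(K)})\in C_K=\{M\in\mathbb N^K:\sum_{k=1}^K kM^{(k)}\le K\}$, $\mathbb N=\{0,1,2,\dots\}$. Using $M$ in a state with type counts $q$ means serving $\min(M^{(k)},q_k)$ jobs of each type $k$. **2-Bucket efficient set.** For $K=2^L$ with $L\ge0$ an integer, $E^{2B}_K=\{M_1,\dots,M_K\}\subseteq C_K$, where: - if $k=2^\ell$ is a power of two (including $k=1$), $M_k$ serves $2^{L-\ell}$ type-$k$ jobs and nothing else; - if $k$ is not a power of two, with $\ell=\lceil\log_2 k\rceil$, $M_k$ serves $2^{L-\ell}$ type-$k$ jobs and $2^{L-\ell}$ type-$(2^\ell-k)$ jobs and nothing else. **2B $K$-EMW.** At each time $t$ uses a service option in $\arg\max_{M\in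 E^{2B}_K}\sum_{k}q_k(t)M^{(k)}$ (ties broken by a fixed rule). **2B $K$-EnMSR.** A $K$-nMSR policy is specified by an irreducible finite-state continuous-time Markov chain $m(t)$ (the modulating process), evolving autonomously of the queue lengths, each of whose states $m$ carries a service option $M_m\in C_K$. At most $K$ of the states are ''working states''; the remaining states are auxiliary ''switching states'' used to pass between working states. When the modulating process is in state $m$, there are $M_m^{(k)}$ open slots for type-$k$ jobs and $\min(M_m^{(k)},q_k(t))$ type-$k$ jobs are in service. Slots with no available job are regarded as holding a dummy job with $\mathrm{Exp}(1)$ duration (replaced by a real job of that type when one arrives). The policy is nonpreemptive: a job, once in service, stays in service until completion; accordingly the number of open type-$k$ slots may decrease only at the completion of a (real or dummy) type-$k$ job in service, by one slot per completion. 2B $K$-EnMSR policies are the $K$-nMSR policies whose working states carry service options in $E^{2B}_K$. *)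

(* Defs.v *)
From HB Require Import structures.
From mathcomp Require Import all_boot all_order all_algebra.
From mathcomp Require Import all_classical all_reals all_analysis.

Set Implicit Arguments.
Unset Strict Implicit.
Unset Printing Implicit Defensive.

Import Order.TTheory GRing.Theory Num.Theory.
Import numFieldNormedType.Exports.

Local Open Scope classical_set_scope.
Local Open Scope ring_scope.

(* A state is the list of the requirements of the jobs present, in arrival
   order, together with the state of the modulating process; n = 0 is used for
   the policies that have none. *)
Definition state (R : realType) (n : nat) : Type := (seq R * 'I_n.+1)%type.

Section state_measurable.
Context {R : realType} {n : nat}.

HB.instance Definition _ := Choice.on (state R n).
HB.instance Definition _ := isPointed.Build (state R n) ([::], ord0).

(* The sigma-algebra of the disjoint union of the spaces R^l, over all lengths
   l and all modulating states m. *)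
Definition state_measurable (A : set (state R n)) : Prop :=
  forall (l : nat) (m : 'I_n.+1), measurable [set s : l.-tuple R | A (tval s, m)].

Let state_measurable0 : state_measurable set0.
Proof. by move=> l m; exact: measurable0. Qed.

Let state_measurableC A : state_measurable A -> state_measurable (~` A).
Proof. by move=> mA l m; exact: measurableC (mA l m). Qed.

Let state_measurable_bigcup (F : (set (state R n))^nat) :
  (forall i, state_measurable (F i)) -> state_measurable (\bigcup_i F i).
Proof.
move=> mF l m; rewrite [X in measurable X](_ : _ =
  \bigcup_i [set s : l.-tuple R | F i (tval s, m)]) //.
by apply: bigcupT_measurable => i; exact: mF.
Qed.

HB.instance Definition _ := @isMeasurable.Build default_measure_display
  (state R n) state_measurable state_measurable0 state_measurableC
  state_measurable_bigcup.

End state_measurable.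

Section jump_process.
Context {R : realType} {N : nat}.

(* [rate x B] is the total rate of the transitions from x into B.  Rates may
   include transitions from x to itself; these are pseudo-jumps. *)
Variables (rate : state R N -> set (state R N) -> R) (x0 : state R N).

(* Y is the sequence of visited states, H the sequence of holding times: given
   the past, the n-th holding time is exponential with parameter
   [rate (Y n) setT] and, independently, the next state has law
   [rate (Y n) _ / rate (Y n) setT].  The conditioning is tested on the
   rectangles generating the sigma-algebra of Y_0, ..., Y_n, H_0, ..., H_{n-1}. *)
Definition is_jump_process (d : measure_display) (Omega : measurableType d)
    (P : probability Omega R) (Y : nat -> Omega -> state R N)
    (H : nat -> Omega -> R) : Prop :=
  [/\ forall n, measurable_fun [set: Omega] (Y n),
      forall n, measurable_fun [set: Omega] (H n),
      forall w, Y 0%N w = x0 &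
      forall (n : nat) (A : nat -> set (state R N)) (C : nat -> set R)
             (B : set (state R N)) (t : R),
        (forall i, measurable (A i)) -> (forall i, measurable (C i)) ->
        measurable B -> 0 <= t ->
        let past := [set w | (forall i, (i <= n)%N -> A i (Y i w)) /\
                             (forall i, (i < n)%N -> C i (H i w))] in
        P (past `&` [set w | t < H n w /\ B (Y n.+1 w)]) =
        (\int[P]_(w in past)
           (expR (- (rate (Y n w) setT * t)) *
            (rate (Y n w) B / rate (Y n w) setT))%:E)%E].

(* The first jump epoch at which the process is in x0 after having left it;
   it is +oo when there is none. *)
Definition return_time (Omega : Type) (Y : nat -> Omega -> state R N)
    (H : nat -> Omega -> R) (w : Omega) : \bar R :=
  ereal_inf [set (\sum_(i < n) H i w)%:E | n in
    [set n | Y n w = x0 /\ exists2 j, (j < n)%N & Y j w <> x0]].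

(* The law of (Y, H) is determined by [is_jump_process]. *)
Definition positive_recurrent : Prop :=
  exists (d : measure_display) (Omega : measurableType d)
         (P : probability Omega R) (Y : nat -> Omega -> state R N)
         (H : nat -> Omega -> R),
    is_jump_process P Y H /\ (\int[P]_w return_time Y H w < +oo)%E.

End jump_process.

Definition valid_jobs (R : realType) (s : seq R) : bool :=
  all (fun v => 0 < v <= 1) s.

Definition remove_job (R : realType) (i : nat) (s : seq R) : seq R :=
  take i s ++ drop i.+1 s.

(* [pi s i] means that the job in position i of s (numbered from 0) is served;
   the values at i >= size s are irrelevant.  The measurability condition is
   what makes the controlled process a Markov process. *)
Definition markovian_policy (R : realType) (pi : seq R -> pred nat) : Prop :=
  (forall n i, measurable [set s : n.-tuple R | pi (tval s) i]) /\
  (forall s, valid_jobs s -> \sum_(i < size s | pi s i) s`_i <= 1).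

Section msj.
Context {R : realType}.
Variables (lam : R) (law : probability (measurableTypeR R) R).

(* Since durations are Exp(1), each job in service leaves at rate 1. *)
Definition policy_rate (pi : seq R -> pred nat) (x : state R 0)
    (B : set (state R 0)) : R :=
  lam * fine (law [set v | B (rcons x.1 v, ord0)]) +
  \sum_(i < size x.1 | pi x.1 i) \1_B (remove_job i x.1, ord0).

Definition stable (pi : seq R -> pred nat) : Prop :=
  positive_recurrent (policy_rate pi) ([::], ord0).

End msj.

Section discretization.
Context {R : realType}.
Variable K : nat.

(* Types are numbered from 1 to K; a service option is a function whose values
   outside 1..K are irrelevant. *)
Definition is_type (k : nat) (v : R) : bool :=
  (k.-1%:R / K%:R < v) && (v <= k%:R / K%:R).

Definition type_count (s : seq R) (k : nat) : nat := count (is_type k) s.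

Definition service_option (M : nat -> nat) : Prop :=
  (\sum_(1 <= k < K.+1) k * M k <= K)%N.

End discretization.

(* The option M_k, for K = 2^L and 1 <= k <= K; up_log 2 k is the ceiling of
   log_2 k. *)
Definition two_bucket (L k j : nat) : nat :=
  let l := up_log 2 k in
  if k == (2 ^ l)%N then ((j == k) * 2 ^ (L - l))%N
  else (((j == k) || (j == 2 ^ l - k)%N) * 2 ^ (L - l))%N.

Definition weight (K : nat) (q M : nat -> nat) : nat :=
  (\sum_(1 <= k < K.+1) q k * M k)%N.

(* The tie-breaking rule is [sel], which maps the vector q of type counts to the
   index of a maximizing option.  Which jobs of a given type are served is left
   free. *)
Definition two_bucket_emw (R : realType) (L : nat) (pi : seq R -> pred nat) :
    Prop :=
  let K := (2 ^ L)%N in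
  markovian_policy pi /\
  exists sel : (nat -> nat) -> nat, forall s, valid_jobs s ->
    let q := type_count K s in
    [/\ (1 <= sel q <= K)%N,
        forall k, (1 <= k <= K)%N ->
          (weight K q (two_bucket L k) <= weight K q (two_bucket L (sel q)))%N &
        forall k, (1 <= k <= K)%N ->
          count (fun i => pi s i && is_type K k s`_i) (iota 0 (size s)) =
          minn (two_bucket L (sel q) k) (q k)].

Definition emw_stable (R : realType) (lam : R)
    (law : probability (measurableTypeR R) R) (L : nat) : Prop :=
  (exists pi : seq R -> pred nat, two_bucket_emw L pi) /\
  forall pi : seq R -> pred nat, two_bucket_emw L pi -> stable lam law pi.

(* A K-nMSR policy.  The modulating process has states 'I_n.+1.  From state m it
   jumps to m' spontaneously at rate [spont m m'] and, upon the completion of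
   any of its [slots m k] type-k slots (each completing at rate 1, whether it
   holds a real or a dummy job), with probability [compl k m m'].  Its transition
   rates, [modulating_rate], do not depend on the queue lengths. *)
Record nmsr (R : realType) (K n : nat) := Nmsr {
  slots : 'I_n.+1 -> nat -> nat ;
  working : pred 'I_n.+1 ;
  spont : 'I_n.+1 -> 'I_n.+1 -> R ;
  compl : nat -> 'I_n.+1 -> 'I_n.+1 -> R }.

Definition modulating_rate (R : realType) (K n : nat) (p : nmsr R K n)
    (m m' : 'I_n.+1) : R :=
  spont p m m' + \sum_(1 <= k < K.+1) (slots p m k)%:R * compl p k m m'.

Record is_nmsr (R : realType) (K n : nat) (p : nmsr R K n) : Prop := IsNmsr {
  nmsr_slots : forall m, service_option K (slots p m) ;
  nmsr_spont : forall m m', 0 <= spont p m m' ;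
  nmsr_compl : forall k m m', 0 <= compl p k m m' ;
  nmsr_compl1 : forall k m, \sum_m' compl p k m m' = 1 ;
  nmsr_irreducible : forall m m',
    connect (fun a b => 0 < modulating_rate p a b) m m' ;
  nmsr_working : (1 <= #|working p| <= K)%N ;
  (* switching states only serve to pass from one working state to another *)
  nmsr_switching : forall m, ~~ working p m ->
    exists a b, [/\ working p a, working p b & forall k, (1 <= k <= K)%N ->
      (slots p m k <= maxn (slots p a k) (slots p b k))%N] ;
  (* nonpreemption: a slot may only close at a completion of its type, and at
     most one slot closes per completion *)
  nmsr_spont_slots : forall m m' j, (1 <= j <= K)%N -> 0 < spont p m m' ->
    (slots p m j <= slots p m' j)%N ;
  nmsr_compl_slots : forall k m m' j, (1 <= k <= K)%N -> (1 <= j <= K)%N ->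
    (0 < slots p m k)%N -> 0 < compl p k m m' ->
    (slots p m j <= slots p m' j + (j == k))%N }.

Definition two_bucket_nmsr (R : realType) (L n : nat) (p : nmsr R (2 ^ L) n) :
    Prop :=
  is_nmsr p /\
  forall m, working p m -> exists2 k, (1 <= k <= 2 ^ L)%N &
    forall j, (1 <= j <= 2 ^ L)%N -> slots p m j = two_bucket L k j.

Section nmsr_process.
Context {R : realType}.
Variables (lam : R) (law : probability (measurableTypeR R) R).
Variables (K n : nat) (p : nmsr R K n).

(* The type-k slots hold the oldest type-k jobs; since a type-k slot is only
   closed when the job that it holds completes, no job in service is ever
   preempted. *)
Definition in_slot (m : 'I_n.+1) (s : seq R) (k i : nat) : bool :=
  is_type K k s`_i && (type_count K (take i s) k < slots p m k)%N.

(* The four terms are: arrivals, spontaneous jumps of the modulating process,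
   completions of real jobs, completions of dummy jobs (the truncated difference
   is the number of slots holding one). *)
Definition nmsr_rate (x : state R n) (B : set (state R n)) : R :=
  let s := x.1 in let m := x.2 in
  lam * fine (law [set v | B (rcons s v, m)]) +
  \sum_m' spont p m m' * \1_B (s, m') +
  \sum_(1 <= k < K.+1) \sum_(i < size s | in_slot m s k i)
     \sum_m' compl p k m m' * \1_B (remove_job i s, m') +
  \sum_(1 <= k < K.+1) (slots p m k - type_count K s k)%N%:R *
     \sum_m' compl p k m m' * \1_B (s, m').

Definition nmsr_stable : Prop :=
  forall m : 'I_n.+1, positive_recurrent nmsr_rate ([::], m).

End nmsr_process.

Definition enmsr_stable (R : realType) (lam : R)
    (law : probability (measurableTypeR R) R) (L : nat) : Prop :=
  exists (n : nat) (p : nmsr R (2 ^ L) n),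
    two_bucket_nmsr p /\ nmsr_stable lam law p.

(* Main.v *)
(* Since the density decreases, so do the loads a_k = lam P(V in I_k), and a
   decreasing vector with sum_k k a_k < K = 2^L is strictly dominated by a mixture
   sum_k th_k M_k of the 2-bucket options; this goes by induction on L, the types
   k > K / 2 being served together with the types K - k.  MaxWeight then has a
   negative drift for the sum of the squared queue lengths.  So has the nMSR policy
   that visits the options cyclically, with long stays proportional to th_k, once
   the queue lengths are corrected by a function of the modulating state; Foster's
   criterion applies to both.  Rounding the requirements up to multiples of 1 / K
   costs at most 1 / K, so that 2^-L < 1 / lam - E V suffices for the mixture to
   exist.  Conversely, the sum of the requirements present grows at mean rate at
   least lam E V - 1 under any policy, which excludes positive recurrence when
   lam E V >= 1. *)
Require Import Defs.
From HB Require Import structures.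
From mathcomp Require Import all_boot all_order all_algebra.
From mathcomp Require Import all_classical all_reals all_analysis measurable_realfun.
From mathcomp Require Import zify ring lra.

Set Implicit Arguments.
Unset Strict Implicit.
Unset Printing Implicit Defensive.

Import Order.TTheory GRing.Theory Num.Theory.
Import numFieldNormedType.Exports.

Local Open Scope classical_set_scope.
Local Open Scope ring_scope.

(** * Integration and fair coins *)

(** [positive_recurrent] asks for some process with the prescribed transition law. Stability
    therefore requires a construction: every process is sampled from one sequence of fair coins, and
    each policy is reduced to an operator assembled from simulable pieces. Necessity must instead
    treat an arbitrary process, of which only the one-step law is known.

    Requirements are real, so the lists of bounded length, where the quadratic drift may be
    positive, form an uncountable set, and irreducibility on a finite set cannot conclude. The
    Lyapunov function receives a bounded extra term instead, which decreases along a path to the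
    empty state at a rate bounded below.

    When lam E V = 1 the work may have zero drift. Its mean at late steps of an excursion need not
    vanish although the excursion ends almost surely, for want of uniform integrability. The work is
    therefore truncated, and the loss due to truncation is paid by the elapsed time, whose mean is
    finite if the return time is integrable. *)

Section integration_complements.
Local Open Scope ereal_scope.

Section pushforward_measure.
Context d d' (T1 : measurableType d) (T2 : measurableType d') (R : realType).
Variables (m : {measure set T1 -> \bar R}) (f : T1 -> T2).
Hypothesis mf : measurable_fun [set: T1] f.

Definition mpush : {measure set T2 -> \bar R} :=
  measure_function_pushforward__canonical__measure_function_Measure m mf.

Lemma mpushE A : mpush A = m (f @^-1` A). Proof. by []. Qed.

Lemma ge0_integral_mpush (g : T2 -> \bar R) : measurable_fun [set: T2] g ->
  (forall x, 0 <= g x) -> \int[mpush]_y g y = \int[m]_x g (f x).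
Proof. by move=> mg g0; rewrite [LHS]ge0_integral_pushforward. Qed.

End pushforward_measure.

Section monotone.
Context d (T : measurableType d) (R : realType) (mu : {measure set T -> \bar R}).

Import HBNNSimple.

(* No measurability is assumed: the integral of a nonnegative function is a
   supremum over the simple functions below it. *)
Lemma integral_le (D : set T) (f g : T -> \bar R) :
  (forall x, D x -> 0 <= f x) -> (forall x, D x -> f x <= g x) ->
  \int[mu]_(x in D) f x <= \int[mu]_(x in D) g x.
Proof.
move=> f0 fg.
have g0 x : D x -> 0 <= g x by move=> Dx; exact: le_trans (f0 _ Dx) (fg _ Dx).
rewrite !ge0_integralE//; apply: le_ereal_sup => _ [h hf <-].
exists h => // x; apply: le_trans (hf x) _.
by rewrite /patch; case: ifPn => // /set_mem; exact: fg.
Qed.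

(** The pi-lambda theorem: the generator contains the whole space, so the constant sequence [setT]
    serves as the exhausting sequence. *)
Lemma finite_measure_unique (G : set (set T)) (m1 m2 : {measure set T -> \bar R}) :
  @measurable _ T = <<s G >> -> setI_closed G -> G [set: T] ->
  (forall A, G A -> m1 A = m2 A) -> m1 [set: T] < +oo ->
  forall A, measurable A -> m1 A = m2 A.
Proof.
move=> mG GI GT m12 fin A mA; apply: (measure_unique G (fun=> setT)) => //.
by rewrite bigcup_const//; exists 0%N.
Qed.

End monotone.

End integration_complements.

(* The source of randomness: infinitely many fair coins. *)
Definition coin_cylinder (n : nat) (b : nat -> bool) : set (nat -> bool) :=
  [set w | forall i, (i < n)%N -> w i = b i].

(** The empty set is included to make the family stable under intersection: two incompatible
    cylinders are disjoint. *)
Definition coin_cylinders : set (set (nat -> bool)) :=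
  [set A | A = set0 \/ exists n b, A = coin_cylinder n b].

Notation coins := (g_sigma_algebraType coin_cylinders).

Section coins.

Lemma coin_cylindersI : setI_closed coin_cylinders.
Proof.
move=> A B [->|[n [b ->]]]; first by rewrite set0I; left.
move=> [->|[m [c ->]]]; first by rewrite setI0; left.
wlog nm : n b m c / (n <= m)%N => [H|].
  by case: (leqP n m) => [|/ltnW] nm; [|rewrite setIC]; exact: H.
have [bc|bc] := pselect (forall i, (i < n)%N -> c i = b i).
  right; exists m, c; apply/seteqP; split=> [w []//|w wc]; split=> // i ni.
  by rewrite wc ?bc// (leq_trans ni).
left; rewrite -subset0 => w [wb wc]; apply: bc => i ni.
by rewrite -wb// wc// (leq_trans ni).
Qed.

Lemma coin_cylinders_setT : coin_cylinders setT.
Proof. by right; exists 0%N, xpred0; apply/seteqP; split. Qed.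

Lemma measurable_coin_cylinder n b : measurable (coin_cylinder n b : set coins).
Proof. by apply: sub_sigma_algebra; right; exists n, b. Qed.

Lemma measurable_coin i c : measurable ([set w | w i = c] : set coins).
Proof.
elim/ltn_ind: i c => i IH c.
(* The event is a finite union of cylinders of length i + 1, one for each prefix [s] of length i,
   all ending with [c]. *)
pose g (s : i.-tuple bool) := fun j => if (j < i)%N then nth false s j else c.
rewrite (_ : [set w | w i = c] =
  \bigcup_(s in [set: i.-tuple bool]) coin_cylinder i.+1 (g s)).
  apply: fin_bigcup_measurable; first exact: finite_finset.
  by move=> s _; exact: measurable_coin_cylinder.
apply/seteqP; split=> [w /= wi|w [s _] /(_ i (leqnn _))]; last first.
  by rewrite /g ltnn.
exists [tuple w j | j < i] => // j; rewrite ltnS leq_eqVlt => /predU1P[->|ji].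
  by rewrite /g ltnn.
rewrite /g ji (nth_map (Ordinal ji)) ?size_enum_ord//.
by rewrite nth_enum_ord.
Qed.

Lemma measurable_to_coins d (T : measurableType d) (f : T -> coins) :
  (forall i, measurable [set x | f x i]) -> measurable_fun [set: T] f.
Proof.
move=> mf; apply: (@measurability _ _ _ coins _ _ coin_cylinders) => // _ [_ [->|[n [b ->]]] <-].
  by rewrite preimage_set0 setI0.
rewrite setTI (_ : _ @^-1` _ = \bigcap_(i in [set i | (i < n)%N]) [set x | f x i = b i]).
  apply: bigcap_measurableType => i _.
  case: (b i); first exact: mf.
  rewrite (_ : [set x | f x i = false] = ~` [set x | f x i]).
    exact: measurableC.
  by apply/seteqP; split=> x /=; [move=> -> | case: (f x i)].
by apply/seteqP; split.
Qed.

(** Reading even and odd positions separately yields two independent sequences of fair coins, hence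
    as much independent randomness as needed from a single one. *)
Definition coin_left (w : coins) : coins := fun i => w i.*2.
Definition coin_right (w : coins) : coins := fun i => w i.*2.+1.

Lemma measurable_coin_left : measurable_fun [set: coins] coin_left.
Proof. by apply: measurable_to_coins => i; exact: measurable_coin. Qed.

Lemma measurable_coin_right : measurable_fun [set: coins] coin_right.
Proof. by apply: measurable_to_coins => i; exact: measurable_coin. Qed.

(** The first n coins read in base 2, coin 0 being the most significant digit. *)
Fixpoint coin_val (n : nat) (b : nat -> bool) : nat :=
  if n is k.+1 then (coin_val k b).*2 + b k else 0.

Lemma coin_val_lt n b : (coin_val n b < 2 ^ n)%N.
Proof. by elim: n => //= n IH; rewrite expnS; case: (b n); lia. Qed.

Lemma coin_val_inj n b c : coin_val n b = coin_val n c ->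
  forall i, (i < n)%N -> b i = c i.
Proof.
elim: n => //= n IH e i.
have [e1 e2] : coin_val n b = coin_val n c /\ b n = c n.
  by move: e; case: (b n); case: (c n); lia.
by rewrite ltnS leq_eqVlt => /predU1P[->//|]; exact: IH.
Qed.

Lemma eq_coin_val n (b c : nat -> bool) : (forall i, (i < n)%N -> b i = c i) ->
  coin_val n b = coin_val n c.
Proof.
elim: n => //= n IH e; rewrite (IH _) ?e// => i ni.
by rewrite e// ltnS ltnW.
Qed.

End coins.

(** * Fair coins as the binary digits of a uniform number *)

Section coin_measure.
Context {R : realType}.

Definition binary_digits (t : measurableTypeR R) : coins :=
  fun i => odd (Num.trunc (2 ^+ i.+1 * t)).

Lemma coin_val_digits n (t : R) : 0 <= t < 1 ->
  coin_val n (binary_digits t) = Num.trunc (2 ^+ n * t).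
Proof.
move=> /andP[t0 t1]; elim: n => /= [|n ->].
  by rewrite expr0 mul1r; apply/esym/eqP; rewrite truncn_eq// t0 t1.
rewrite /binary_digits.
set m := Num.trunc (2 ^+ n.+1 * t).
(* Doubling a number appends one binary digit to its integer part, so halving [m] recovers the
   previous truncation. *)
suff -> : Num.trunc (2 ^+ n * t) = m./2 by rewrite addnC odd_double_half.
have x0 : 0 <= 2 ^+ n * t by rewrite mulr_ge0// exprn_ge0.
have /truncn_itv/andP[a b] : 0 <= 2 ^+ n.+1 * t by rewrite mulr_ge0// exprn_ge0.
rewrite -/m exprS -mulrA in a b.
apply/eqP; rewrite truncn_eq//; apply/andP; split.
  have : (m./2.*2 <= m)%N by lia.
  by rewrite -(ler_nat R) -muln2 natrM; lra.
have : (m.+1 <= m./2.+1.*2)%N by lia.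
by rewrite -(ler_nat R) -muln2 natrM; lra.
Qed.

Lemma binary_digits_cylinder n b :
  `[0, 1[%classic `&` (binary_digits @^-1` coin_cylinder n b) =
  `[(coin_val n b)%:R / 2 ^+ n, ((coin_val n b).+1)%:R / 2 ^+ n[%classic :> set R.
Proof.
have e0 : (0 < 2 ^+ n :> R) by rewrite exprn_gt0.
apply/seteqP; split=> t /=; rewrite !in_itv/= ler_pdivrMr// ltr_pdivlMr//.
  move=> [t01 /eq_coin_val]; rewrite coin_val_digits// => e.
  have /truncn_itv : 0 <= 2 ^+ n * t by rewrite mulr_ge0 ?exprn_ge0//; lra.
  by rewrite e mulrC.
move=> /andP[a c].
have t0 : 0 <= t.
  by rewrite -(pmulr_lge0 _ e0); apply: le_trans a; rewrite ler0n.
have t1 : t < 1.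
  rewrite -(ltr_pM2r e0) mul1r; apply: lt_le_trans c _.
  by rewrite -natrX ler_nat coin_val_lt.
rewrite t0 t1; split=> //; apply: coin_val_inj.
rewrite coin_val_digits ?t0//; apply/eqP; rewrite truncn_eq.
  by rewrite mulrC a c.
by rewrite mulr_ge0// ltW.
Qed.

Lemma measurable_binary_digits : measurable_fun [set: measurableTypeR R] binary_digits.
Proof.
apply: measurable_to_coins => i.
rewrite (_ : [set t | _] = \bigcup_(k in [set k | odd k])
   [set t : measurableTypeR R | Num.trunc (2 ^+ i.+1 * t) = k]); last first.
  apply/seteqP; split=> [t /= o|t [k /= o e]]; last by rewrite /binary_digits e.
  by exists (Num.trunc (2 ^+ i.+1 * t)).
apply: bigcup_measurable => k ok.
have e0 : (0 < 2 ^+ i.+1 :> R) by rewrite exprn_gt0.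
rewrite (_ : [set t | _] = `[k%:R / 2 ^+ i.+1, k.+1%:R / 2 ^+ i.+1[%classic).
  exact: measurable_itv.
apply/seteqP; split=> t /=; rewrite in_itv/= ler_pdivrMr// ltr_pdivlMr// (mulrC t).
  have [t0|t0 e] := leP 0 (2 ^+ i.+1 * t).
    by move=> <-; exact: truncn_itv.
  (* The truncation of a negative number is 0, which is even. *)
  by move: ok; rewrite /= -e; have := truncn_floor (2 ^+ i.+1 * t); rewrite leNgt t0 => ->.
move=> /andP[a c]; apply/eqP; rewrite truncn_eq ?a//.
by apply: le_trans a; rewrite ler0n.
Qed.

Let Iunit : set (measurableTypeR R) := `[0, 1[%classic.

Let mIunit : measurable Iunit. Proof. exact: measurable_itv. Qed.

(** Lebesgue measure on [0, 1[ pushed forward to sequences of digits: independent fair coins without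
    an infinite product of measures. *)
Definition coin : set coins -> \bar R :=
  mpush (mrestr lebesgue_measure mIunit) measurable_binary_digits.

HB.instance Definition _ := Measure.on coin.

Lemma coinE A : coin A = lebesgue_measure (`[0, 1[%classic `&` (binary_digits @^-1` A)).
Proof. by rewrite /coin mpushE/= /mrestr setIC. Qed.

Lemma coin_setT : coin setT = 1%E.
Proof.
rewrite coinE preimage_setT setIT lebesgue_measure_itv/= lte_fin ltr01.
by rewrite sube0.
Qed.

HB.instance Definition _ := Measure_isProbability.Build _ _ _ coin coin_setT.

Lemma coin_coin_cylinder n b : coin (coin_cylinder n b) = ((2 ^+ n)^-1)%:E.
Proof.
have e0 : (0 < 2 ^+ n :> R) by rewrite exprn_gt0.
rewrite coinE binary_digits_cylinder lebesgue_measure_itv/= lte_fin.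
rewrite ltr_pM2r ?invr_gt0// ltr_nat leqnn -EFinB -mulrBl -natrB//.
by rewrite subSnn mul1r.
Qed.

End coin_measure.

(** * Independence of the even and the odd coins *)

Section coin_split.
Context {R : realType}.
Local Open Scope ereal_scope.
Local Notation coin := (@coin R).

Lemma coin_cylinder_split d (T : measurableType d) (m : {measure set T -> \bar R})
    (f : T -> coins) (X : set T) n (b : nat -> bool) :
  measurable_fun [set: T] f -> measurable X ->
  m (f @^-1` coin_cylinder n b `&` X) =
  m (f @^-1` coin_cylinder n.+1 (fun i => (i == n) || b i) `&` X) +
  m (f @^-1` coin_cylinder n.+1 (fun i => (i != n) && b i) `&` X).
Proof.
move=> mf mX.
have mc k c : measurable (f @^-1` coin_cylinder k c).
  by rewrite -[X in measurable X]setTI; apply: mf => //; exact: measurable_coin_cylinder.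
rewrite -measureU; [|exact: measurableI|exact: measurableI|]; last first.
  rewrite -subset0 => w [[/= a _] [/= c _]].
  by have := a n (leqnn _); rewrite (c n)// eqxx.
congr (m _); rewrite -setIUl; congr (_ `&` _).
apply/seteqP; split=> w /=.
  move=> wb; case e : (f w n); [left|right] => i; rewrite ltnS leq_eqVlt;
    case: eqVneq => [->|ne /= ilt]; rewrite ?e ?(wb i)//.
move=> [] h i ni; rewrite h; rewrite ?(ltnW ni)//; first by rewrite ltn_eqF//.
  by rewrite ltnS ltnW.
by rewrite neq_ltn ni.
by rewrite ltnS ltnW.
Qed.

(** A cylinder is the disjoint union of its two extensions by one coin, so a product formula known
    at one length holds at every shorter length. This allows [coin_split_cylinder] to lengthen the
    shorter of two cylinders. *)
Lemma coin_cylinder_shorten d (T : measurableType d) (m : {measure set T -> \bar R})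
    (f : T -> coins) (X : set T) (x : \bar R) n k :
  measurable_fun [set: T] f -> measurable X -> 
  (forall b, m (f @^-1` coin_cylinder (n + k) b `&` X) = ((2 ^- (n + k))%:E * x)) ->
  forall b, m (f @^-1` coin_cylinder n b `&` X) = (2 ^- n)%:E * x.
Proof.
move=> mf mX; elim: k => [|k IH]; first by rewrite addn0.
move=> H; apply: IH => b; rewrite coin_cylinder_split// -addnS !H.
rewrite -ge0_muleDl ?lee_fin ?invr_ge0 ?exprn_ge0//.
congr (_ * _); rewrite -EFinD; congr (_%:E).
have := @exprn_gt0 R (n + k) 2 ltac:(by []).
by rewrite addnS exprS => ?; field; rewrite gt_eqF.
Qed.

(** Interleaving [b] and [c] turns the joint event into a single cylinder of length 2 n. *)
Lemma coin_split_same n b c :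
  coin (coin_left @^-1` coin_cylinder n b `&` (coin_right @^-1` coin_cylinder n c)) =
  (2 ^- n)%:E * (2 ^- n)%:E.
Proof.
rewrite -EFinM -invfM -exprD addnn.
rewrite (_ : _ `&` _ = coin_cylinder n.*2 (fun i => if odd i then c i./2 else b i./2)).
  exact: coin_coin_cylinder.
apply/seteqP; split=> w /=.
  move=> [wb wc] i ni; rewrite -[in LHS](odd_double_half i).
  have hi : (i./2 < n)%N by lia.
  by case: (odd i); [rewrite -wc|rewrite -wb].
move=> h; split=> i ni; rewrite /coin_left /coin_right h.
- by rewrite odd_double doubleK.
- by rewrite ltn_double.
- by rewrite /= odd_double /= uphalf_double.
- by rewrite ltn_Sdouble.
Qed.

Lemma coin_split_cylinder n m b c :
  coin (coin_left @^-1` coin_cylinder n b `&` (coin_right @^-1` coin_cylinder m c)) =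
  (2 ^- n)%:E * (2 ^- m)%:E.
Proof.
have ml k d : measurable (coin_left @^-1` coin_cylinder k d).
  by rewrite -[X in measurable X]setTI; apply: measurable_coin_left => //; exact: measurable_coin_cylinder.
have mr k d : measurable (coin_right @^-1` coin_cylinder k d).
  by rewrite -[X in measurable X]setTI; apply: measurable_coin_right => //; exact: measurable_coin_cylinder.
have [nm|/ltnW mn] := leqP n m.
  apply: (@coin_cylinder_shorten _ coins coin coin_left _ (2 ^- m)%:E n (m - n)) => //.
    exact: measurable_coin_left.
  by move=> b'; rewrite subnKC//; exact: coin_split_same.
rewrite setIC muleC.
apply: (@coin_cylinder_shorten _ coins coin coin_right _ (2 ^- n)%:E m (n - m)) => //.
  exact: measurable_coin_right.
by move=> b'; rewrite subnKC// setIC; exact: coin_split_same.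
Qed.

Lemma coin_split A B : measurable A -> measurable B ->
  coin (coin_left @^-1` A `&` (coin_right @^-1` B)) = coin A * coin B.
Proof.
have mr (D : set coins) : measurable D -> measurable (coin_right @^-1` D).
  by move=> mD; rewrite -[X in measurable X]setTI; exact: measurable_coin_right.
have ml (D : set coins) : measurable D -> measurable (coin_left @^-1` D).
  by move=> mD; rewrite -[X in measurable X]setTI; exact: measurable_coin_left.
(* The extension from cylinders to measurable sets is done one coordinate at a time; here the
   right-hand event [D] is frozen. *)
have split1 (A' : set coins) (D : set coins) (mD : measurable D) x (x0 : (0 <= x)%R) :
    (forall n b, coin (coin_left @^-1` coin_cylinder n b `&` D) =
       (2 ^- n)%:E * x%:E) -> measurable A' ->
    coin (coin_left @^-1` A' `&` D) = coin A' * x%:E.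
  move=> h mA'; rewrite muleC.
  apply: (@finite_measure_unique _ coins R coin_cylinders
    (mpush (mrestr coin mD) measurable_coin_left) (mscale (NngNum x0) coin)) => //.
  - exact: coin_cylindersI.
  - exact: coin_cylinders_setT.
  - move=> _ [->|[n [b ->]]]; first by rewrite !measure0.
    by rewrite mpushE/= /mrestr h /mscale/= coin_coin_cylinder muleC.
  - rewrite mpushE/= /mrestr preimage_setT setTI.
    by rewrite ltey_eq fin_num_measure.
move=> mA mB; rewrite -[coin B]fineK ?fin_num_measure//.
apply: split1 => //; [exact: mr|exact: fine_ge0|] => n b.
rewrite fineK ?fin_num_measure// setIC.
have n0 : (0 <= 2 ^- n :> R)%R by rewrite invr_ge0 exprn_ge0.
apply: (@finite_measure_unique _ coins R coin_cylinders
    (mpush (mrestr coin (ml _ (@measurable_coin_cylinder n b))) measurable_coin_right)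
    (mscale (NngNum n0) coin)) => //.
- exact: coin_cylindersI.
- exact: coin_cylinders_setT.
- move=> _ [->|[m [c ->]]]; first by rewrite !measure0.
  by rewrite mpushE/= /mrestr setIC [LHS]coin_split_cylinder /mscale/= coin_coin_cylinder.
- rewrite mpushE/= /mrestr preimage_setT setTI.
  by rewrite ltey_eq fin_num_measure//; exact: (ml _ (@measurable_coin_cylinder n b)).
Qed.

Lemma integral_coin_split (g : coins * coins -> \bar R) :
  measurable_fun [set: coins * coins] g -> (forall z, 0 <= g z) ->
  \int[coin]_w g (coin_left w, coin_right w) =
  \int[coin]_u \int[coin]_v g (u, v).
Proof.
move=> mg g0.
have mp : measurable_fun [set: coins] (fun w => (coin_left w, coin_right w)).
  by apply: measurable_fun_pair; [exact: measurable_coin_left|exact: measurable_coin_right].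
rewrite -(ge0_integral_mpush coin mp mg g0) -(fubini_tonelli1 _ mg g0).
apply: eq_measure_integral => A mA _; apply/esym.
apply: product_measure_unique => // B C mB mC.
by rewrite -coin_split// mpushE.
Qed.

End coin_split.

(** * Sampling of real laws by inversion *)

Section real_laws.
Context {R : realType}.
Local Notation TR := (measurableTypeR R).

Lemma real_law_unique (m1 m2 : {measure set TR -> \bar R}) :
  (forall t, m1 `]t, +oo[%classic = m2 `]t, +oo[%classic) ->
  (m1 [set: TR] < +oo)%E ->
  forall A, measurable A -> m1 A = m2 A.
Proof.
move=> m12 fin A mA.
apply: (@measure_unique _ R TR (@RGenOInfty.G R) (fun k => `](- k%:R), +oo[%classic)) => //.
- exact: RGenOInfty.measurableE.
- move=> _ _ [x ->] [y ->]; exists (Num.max x y).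
  by apply/seteqP; split=> z /=; rewrite !in_itv/= !andbT gt_max; [move=> [-> ->]|move=> /andP[]].
- by move=> i; exists (- i%:R).
- apply/seteqP; split=> // x _; exists (Num.trunc `|x|).+1 => //=.
  rewrite in_itv/= andbT ltrNl; apply: le_lt_trans (ler_norm _) _.
  by rewrite normrN truncnS_gt.
- by move=> _ [x ->].
- move=> k; apply: le_lt_trans fin; apply: le_measure; rewrite ?inE//.
Qed.

Lemma measurable_fun_rays d (T : measurableType d) (f : T -> TR) :
  (forall t, measurable [set x | t < f x]) -> measurable_fun [set: T] f.
Proof.
move=> mf; apply: (@measurability _ _ _ TR _ _ (@RGenOInfty.G R)).
  exact: RGenOInfty.measurableE.
move=> _ [_ [t ->] <-]; rewrite setTI (_ : _ @^-1` _ = [set x | t < f x])//.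
by apply/seteqP; split=> x /=; rewrite in_itv/= andbT.
Qed.

(** The number whose binary digits are the coins, a left inverse of [binary_digits] on [0, 1[. Its
    measurability is that of a countable supremum; the value 1 is reached by the sequence of
    ones. *)
Definition unif (w : coins) : R := sups (fun n => (coin_val n w)%:R / 2 ^+ n) 0.

Let unif_bound w n : 0 <= ((coin_val n w)%:R / 2 ^+ n : R) <= 1.
Proof.
have e0 : 0 < 2 ^+ n :> R by rewrite exprn_gt0.
by rewrite divr_ge0//= ?ler_pdivrMr// ?mul1r ?ltW// -natrX ltr_nat coin_val_lt.
Qed.

Let unif_has_ub w : has_ubound (sdrop (fun n => (coin_val n w)%:R / 2 ^+ n : R) 0).
Proof. by exists 1 => _ [n _ <-]; case/andP: (unif_bound w n). Qed.

Lemma unif_itv w : 0 <= unif w <= 1.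
Proof.
apply/andP; split.
  have /andP[h _] := unif_bound w 0; apply: le_trans h _.
  by apply: ub_le_sup; [exact: unif_has_ub|exists 0%N].
apply: ge_sup; first by eexists; exists 0%N.
by move=> _ [n _ <-]; case/andP: (unif_bound w n).
Qed.

Lemma measurable_unif : measurable_fun [set: coins] unif.
Proof.
apply: measurable_fun_sups => [w _|n].
  by exists 1 => _ [n _ <-]; case/andP: (unif_bound w n).
rewrite (_ : (fun w => _) = fun w => (coin_val n w)%:R * (2 ^- n : R))//.
apply: measurable_funM => //.
elim: n => [|n IH] /=; first exact: measurable_cst.
rewrite (_ : (fun w => _) = fun w : coins => 2 * (coin_val n w)%:R +
    (if w n then 1 else 0) : R); last first.
  by apply/funext => w; rewrite natrD -muln2 natrM mulrC; case: (w n).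
apply: measurable_funD; first exact: measurable_funM.
apply: measurable_fun_ifT => //.
apply: (@measurable_fun_bool _ _ _ _ true); rewrite setTI.
exact: measurable_coin.
Qed.

Lemma unif_digits (t : R) : 0 <= t < 1 -> unif (binary_digits t) = t.
Proof.
move=> t01; have /andP[t0 t1] := t01; apply/eqP; rewrite eq_le; apply/andP; split.
  apply: ge_sup; first by eexists; exists 0%N.
  move=> _ [n _ <-]; rewrite coin_val_digits// ler_pdivrMr ?exprn_gt0//.
  by rewrite mulrC truncn_le// mulr_ge0// exprn_ge0.
rewrite leNgt; apply/negP => lt.
set u := unif _ in lt.
pose n := (Num.trunc (t - u)^-1).+1.
have tu : 0 < t - u by rewrite subr_gt0.
have e0 : 0 < 2 ^+ n :> R by rewrite exprn_gt0.
have hn : (t - u)^-1 < 2 ^+ n.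
  apply: lt_trans (truncnS_gt _) _.
  by rewrite -natrX ltr_nat ltn_expl.
have : (coin_val n (binary_digits t))%:R / 2 ^+ n <= u.
  by apply: ub_le_sup; [exact: unif_has_ub|exists n].
rewrite coin_val_digits// ler_pdivrMr// => h.
have := truncnS_gt (2 ^+ n * t); rewrite -natr1 => h2.
have : 1 < (t - u) * 2 ^+ n by rewrite -ltr_pdivrMl// mulr1.
lra.
Qed.

Lemma coin_unif (A : set TR) :
  @coin R (unif @^-1` A) = lebesgue_measure (`[0, 1[%classic `&` A).
Proof.
rewrite coinE; congr (lebesgue_measure _); apply/seteqP; split=> t /=;
  by rewrite in_itv/= => -[t01]; rewrite unif_digits.
Qed.

Lemma coin_unif_le p : 0 <= p <= 1 -> @coin R [set w | unif w <= p] = p%:E.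
Proof.
move=> /andP[p0 p1]; rewrite (_ : [set w | _] = unif @^-1` `]-oo, p]%classic); last first.
  by apply/seteqP; split=> w /=; rewrite in_itv.
rewrite [LHS]coin_unif; move: p1; rewrite le_eqVlt => /predU1P[->|p1].
  rewrite (_ : _ `&` _ = `[0, 1[%classic); last first.
    by apply/seteqP; split=> t /=; rewrite !in_itv/=; [move=> []|move=> /andP[-> /[dup] /ltW -> ->]].
  by rewrite lebesgue_measure_itv/= lte_fin ltr01 sube0.
rewrite (_ : _ `&` _ = `[0, p]%classic); last first.
  apply/seteqP; split=> t /=; rewrite !in_itv/=; first by move=> [/andP[-> _] ->].
  by move=> /andP[-> tp]; rewrite tp (le_lt_trans tp).
rewrite lebesgue_measure_itv/= lte_fin; case: ltgtP p0 => // [p0 _|<- _].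
  by rewrite sube0.
by [].
Qed.

Lemma coin_unif_lt p : 0 <= p <= 1 -> @coin R [set w | unif w < p] = p%:E.
Proof.
move=> p01; rewrite -[RHS](coin_unif_le p01).
rewrite (_ : [set w | unif w <= p] = [set w | unif w < p] `|` (unif @^-1` [set p])); last first.
  apply/seteqP; split=> w /=; first by rewrite le_eqVlt => /predU1P[|]; [right|left].
  by move=> [/ltW|->].
have mu A : measurable A -> measurable (unif @^-1` A : set coins).
  by move=> mA; rewrite -[X in measurable X]setTI; exact: measurable_unif.
rewrite (_ : [set w | _ < _] = unif @^-1` `]-oo, p[%classic); last first.
  by apply/seteqP; split=> w /=; rewrite in_itv.
rewrite [RHS]measureU; [|exact: mu|exact: mu|]; last first.
  by rewrite -subset0 => w [] /=; rewrite in_itv/= => + e; rewrite e ltxx.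
rewrite [X in (_ + X)%E](_ : _ = 0%E) ?adde0//.
rewrite [LHS]coin_unif; apply/eqP; rewrite eq_le measure_ge0 andbT.
rewrite -(lebesgue_measure_set1 p); apply: le_measure; rewrite ?inE//.
exact: measurableI.
Qed.

(** Inversion of the exponential tail: minus the logarithm of a uniform variable is Exp(1). *)
Definition hold (w : coins) : R := - ln (unif w).

Lemma hold_ge0 w : 0 <= hold w.
Proof. by rewrite /hold oppr_ge0 ln_le0//; case/andP: (unif_itv w). Qed.

Lemma measurable_hold : measurable_fun [set: coins] hold.
Proof.
apply: measurableT_comp => //; apply: measurableT_comp => //.
exact: measurable_unif.
Qed.

Lemma coin_hold t : 0 <= t -> @coin R [set w | t < hold w] = (expR (- t))%:E.
Proof.
move=> t0; have e1 : 0 <= expR (- t) <= 1 by rewrite expR_ge0 expR_le1 oppr_le0.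
rewrite -(coin_unif_lt e1).
have z : 0 <= (0 : R) <= 1 by rewrite lexx ler01.
have mu A : measurable A -> measurable (unif @^-1` A : set coins).
  by move=> mA; rewrite -[X in measurable X]setTI; exact: measurable_unif.
have m1 : measurable [set w : coins | t < hold w].
  rewrite (_ : [set w | _] = hold @^-1` `]t, +oo[%classic).
    by rewrite -[X in measurable X]setTI; exact: measurable_hold.
  by apply/seteqP; split=> w /=; rewrite in_itv/= andbT.
have m0 : measurable [set w : coins | unif w <= 0].
  rewrite (_ : [set w | _] = unif @^-1` `]-oo, 0]%classic); first exact: mu.
  by apply/seteqP; split=> w /=; rewrite in_itv.
have mlt : measurable [set w : coins | unif w < expR (- t)].
  rewrite (_ : [set w | _] = unif @^-1` `]-oo, expR (- t)[%classic); first exact: mu.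
  by apply/seteqP; split=> w /=; rewrite in_itv.
have key w : 0 < unif w -> (t < hold w) = (unif w < expR (- t)).
  by move=> u0; rewrite /hold ltrNr -[in LHS]ltr_expR lnK// posrE.
(* [key] needs [unif] positive, which fails only on a null set; so an inclusion of events up to that
   set is enough to compare probabilities. *)
have sub (A B : set coins) : measurable A -> measurable B ->
    A `<=` B `|` [set w | unif w <= 0] -> (@coin R A <= @coin R B)%E.
  move=> mA mB AB; rewrite -[leRHS]adde0 [X in (_ + X)%E](esym (coin_unif_le z)).
  apply: le_trans (measureU2 _ mB m0); apply: le_measure; rewrite ?inE//.
  exact: measurableU.
apply/eqP; rewrite eq_le; apply/andP; split; apply: sub => // w /= h.
all: have [u0|u0] := ltP 0 (unif w); [left; move: h; rewrite key//|by right].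
Qed.

(** The mean is the integral of the tail, and the tail of Exp(1) coincides with its density, of
    total mass 1. *)
Lemma integral_hold : (\int[@coin R]_w (hold w)%:E = 1)%E.
Proof.
pose X : {RV (@coin R) >-> R} :=
  HB.pack (hold : coins -> R) (isMeasurableFun.Build _ _ _ _ _ measurable_hold).
have := @ge0_expectation_ccdf _ coins R coin X hold_ge0.
rewrite expectation_def => ->.
rewrite -(integral_exponential_pdf (rate := 1))// [RHS]integral_mkcond.
rewrite [LHS]integral_mkcond; apply: eq_integral => t _ /=.
rewrite patch_setT /patch; case: ifPn => [/set_mem/=|].
  rewrite in_itv/= andbT => t0.
  rewrite exponential_pdfE// mul1r mulN1r -coin_hold// /ccdf /distribution /pushforward.
  by congr (coin _); apply/seteqP; split=> w /=; rewrite in_itv/= andbT.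
rewrite notin_setE/= in_itv/= andbT => /negP; rewrite -ltNge => t0.
by rewrite lt0_exponential_pdf.
Qed.

Section sampler.
Variable law : probability TR R.
Hypothesis law01 : law `]0, 1]%classic = 1%E.

Let cdf t : R := fine (law `]-oo, t]%classic).

Let cdfE t : (cdf t)%:E = law `]-oo, t]%classic.
Proof. by rewrite fineK// fin_num_measure. Qed.

Let le_cdf s t : s <= t -> cdf s <= cdf t.
Proof.
move=> st; rewrite -lee_fin !cdfE; apply: le_measure; rewrite ?inE//.
exact: subitvPr.
Qed.

Let cdf_itv t : 0 <= cdf t <= 1.
Proof. by rewrite -!lee_fin cdfE measure_ge0 probability_le1. Qed.

Let cdf1 : cdf 1 = 1.
Proof.
apply/le_anti; case/andP: (cdf_itv 1) => _ -> /=.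
rewrite -lee_fin cdfE -law01; apply: le_measure; rewrite ?inE//.
by move=> x /=; rewrite !in_itv/= => /andP[].
Qed.

Let cdf_right t u : (forall n, u <= cdf (t + n.+1%:R^-1)) -> u <= cdf t.
Proof.
move=> h; rewrite -lee_fin cdfE.
have -> : law `]-oo, t]%classic = limn (law \o (fun n => `]-oo, t + n.+1%:R^-1]%classic)).
  apply/esym/cvg_lim => //.
  rewrite (_ : `]-oo, t]%classic = \bigcap_n `]-oo, t + n.+1%:R^-1]%classic).
    apply: nonincreasing_cvg_mu => //.
    - by rewrite ltey_eq fin_num_measure.
    - exact: bigcapT_measurable.
    - move=> m n mn; apply/subsetPset; apply: subitvPr.
      by rewrite bnd_simp lerD2l lef_pV2 ?posrE// ler_nat.
  apply/seteqP; split=> x /=; rewrite in_itv/=.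
    by move=> xt n _; rewrite /= in_itv/= (le_trans xt)// lerDl invr_ge0.
  move=> h'; rewrite leNgt; apply/negP => tx.
  pose n := Num.trunc (x - t)^-1.
  have := h' n Logic.I; rewrite /= in_itv/= -lerBlDl leNgt => /negP; apply.
  have xt : 0 < x - t by rewrite subr_gt0.
  by rewrite invf_plt ?posrE// truncnS_gt.
apply: lime_ge.
  apply: ereal_nonincreasing_is_cvgn => m n mn /=.
  apply: le_measure; rewrite ?inE//; apply: subitvPr.
  by rewrite bnd_simp lerD2l lef_pV2 ?posrE// ler_nat.
by apply: nearW => n /=; rewrite -cdfE lee_fin.
Qed.

(** The infimum is taken over [0, 1] because at [u = 0] the condition on [cdf] holds on the whole
    line, which has no lower bound. *)
Definition quantile (u : R) : R := inf [set x | 0 <= x <= 1 /\ u <= cdf x].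

Let quantile_nonempty u : u <= 1 -> [set x | 0 <= x <= 1 /\ u <= cdf x] !=set0.
Proof. by move=> u1; exists 1; split; rewrite ?cdf1 ?lexx ?ler01. Qed.

Let quantile_lb u : has_lbound [set x | 0 <= x <= 1 /\ u <= cdf x].
Proof. by exists 0 => x [/andP[]]. Qed.

Lemma quantile_itv u : u <= 1 -> 0 <= quantile u <= 1.
Proof.
move=> u1; apply/andP; split.
  by apply: lb_le_inf; [exact: quantile_nonempty|move=> x [/andP[]]].
apply: ge_inf; first exact: quantile_lb.
by rewrite /= cdf1 u1 lexx ler01.
Qed.

(** Right continuity of [cdf] ([cdf_right]) makes the infimum a minimum, which gives the implication
    from left to right. *)
Lemma quantile_le u t : u <= 1 -> 0 <= t <= 1 -> (quantile u <= t) = (u <= cdf t).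
Proof.
move=> u1 t01; apply/idP/idP => [h|h]; last by apply: ge_inf; [exact: quantile_lb|].
apply: cdf_right => n.
have hn : quantile u < t + n.+1%:R^-1 by rewrite (le_lt_trans h)// ltrDl invr_gt0.
have [x [_ ux] xn] := inf_lt (quantile_nonempty u1) hn.
by rewrite (le_trans ux)// le_cdf// ltW.
Qed.

Definition sampler (w : coins) : TR := quantile (unif w).

Let unif1 w : unif w <= 1. Proof. by case/andP: (unif_itv w). Qed.

Let samplerE t : [set w | t < sampler w] =
  if t < 0 then setT else if t < 1 then unif @^-1` `]cdf t, +oo[%classic else set0.
Proof.
have [t0|t0] := ltP t 0.
  apply/seteqP; split=> // w _ /=; apply: lt_le_trans t0 _.
  by case/andP: (quantile_itv (unif1 w)).
have [t1|t1] := ltP t 1; last first.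
  rewrite -subset0 => w /=; rewrite ltNge (le_trans _ t1)//.
  by case/andP: (quantile_itv (unif1 w)).
by apply/seteqP; split=> w /=;
  rewrite in_itv/= andbT /sampler !ltNge quantile_le// ?t0 ?ltW.
Qed.

Lemma measurable_sampler : measurable_fun [set: coins] sampler.
Proof.
apply: measurable_fun_rays => t; rewrite samplerE.
case: ifP => // _; case: ifP => // _.
by rewrite -[X in measurable X]setTI; exact: measurable_unif.
Qed.

Let law_ray t : law `]t, +oo[%classic = (1 - cdf t)%:E.
Proof.
by rewrite -setCitvl probability_setC// -cdfE.
Qed.

Lemma sampler_law A : measurable A -> @coin R (sampler @^-1` A) = law A.
Proof.
apply: (@real_law_unique (mpush coin measurable_sampler) law); last first.
  by rewrite mpushE preimage_setT [X in (X < _)%E]probability_setT ltry.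
move=> t; rewrite mpushE (_ : _ @^-1` _ = [set w | t < sampler w]); last first.
  by apply/seteqP; split=> w /=; rewrite in_itv/= andbT.
rewrite samplerE; case: ltP => [t0|t0].
  rewrite [LHS]probability_setT; apply/esym/le_anti; rewrite probability_le1//=.
  rewrite -law01; apply: le_measure; rewrite ?inE//.
  by move=> x /=; rewrite !in_itv/= andbT => /andP[x0 _]; exact: lt_trans x0.
rewrite [RHS]law_ray; case: ltP => [t1|t1].
  rewrite (_ : _ @^-1` _ = ~` [set w | unif w <= cdf t]); last first.
    by apply/seteqP; split=> w /=; rewrite in_itv/= andbT ltNge => /negP.
  have mle : measurable [set w : coins | unif w <= cdf t].
    rewrite (_ : [set w | _] = unif @^-1` `]-oo, cdf t]%classic); last first.
      by apply/seteqP; split=> w /=; rewrite in_itv.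
    by rewrite -[X in measurable X]setTI; exact: measurable_unif.
  by rewrite [LHS]probability_setC// EFinB; congr (1 - _)%E; exact: coin_unif_le.
rewrite measure0 (_ : cdf t = 1) ?subrr//; apply/le_anti.
by rewrite -{2}cdf1 le_cdf// andbT; case/andP: (cdf_itv t).
Qed.

End sampler.

End real_laws.

(** * Simulation of jump processes *)

Lemma measurable_inv_ge0 d (T : measurableType d) (R : realType) (f : T -> R) :
  measurable_fun [set: T] f -> (forall x, 0 <= f x) ->
  measurable_fun [set: T] (fun x => (f x)^-1).
Proof.
move=> mf f0; rewrite (_ : (fun x => _) =
    fun x => if 0 < f x then expR (- ln (f x)) else 0); last first.
  apply/funext => x; case: ltP => fx; first by rewrite expRN lnK.
  by rewrite (_ : f x = 0) ?invr0//; apply/le_anti; rewrite fx f0.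
apply: measurable_fun_ifT => //; first exact: measurable_fun_ltr.
apply: measurableT_comp => //; apply: measurableT_comp => //.
by apply: measurableT_comp => //; exact: measurable_ln.
Qed.

Lemma preimage_measurable d d' (T : measurableType d) (T' : measurableType d')
    (f : T -> T') (A : set T') : measurable_fun [set: T] f -> measurable A ->
  measurable (f @^-1` A).
Proof. by move=> mf mA; rewrite -[X in measurable X]setTI; exact: mf. Qed.

Lemma measurable_gt d (T : measurableType d) (R : realType) (f : T -> R) t :
  measurable_fun [set: T] f -> measurable [set x | t < f x].
Proof.
move=> mf; rewrite (_ : [set x | _] = f @^-1` `]t, +oo[%classic).
  exact: preimage_measurable.
by apply/seteqP; split=> z /=; rewrite in_itv/= andbT.
Qed.

Lemma eq_indic (T T' : Type) (R : realType) (A : set T) (B : set T') x y :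
  (A x <-> B y) -> \1_A x = \1_B y :> R.
Proof.
by move=> AB; rewrite !indicE; congr ((nat_of_bool _)%:R); apply/idP/idP;
  rewrite !inE => /AB.
Qed.

Lemma indicM (T T' T'' : Type) (R : realType) (A : set T) (B : set T') (C : set T'') x y z :
  (C z <-> A x /\ B y) -> \1_C z = \1_A x * \1_B y :> R.
Proof.
move=> ABC; rewrite !indicE -natrM mulnb; congr ((nat_of_bool _)%:R).
by apply/idP/andP; rewrite !inE => /ABC.
Qed.

Lemma measurable_eindic d d' (T : measurableType d) (T' : measurableType d')
    (R : realType) (f : T -> T') (A : set T') : measurable_fun [set: T] f -> measurable A ->
  measurable_fun [set: T] (fun x => (\1_A (f x))%:E : \bar R).
Proof.
move=> mf mA; apply/measurable_EFinP.
rewrite (_ : (fun x => _) = \1_(f @^-1` A)); last exact/funext.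
by apply: measurable_indic; exact: preimage_measurable.
Qed.

Section simulation.
Context {R : realType} {N : nat}.
Variables (r : state R N -> R) (F : state R N * coins -> state R N).
Hypothesis mr : measurable_fun [set: state R N] r.
Hypothesis r_ge0 : forall x, 0 <= r x.
Hypothesis mF : measurable_fun [set: state R N * coins] F.

Local Notation Z := (state R N * coins)%type.
Local Notation coin := (@coin R).

(** The coins are split into independent parts: left-left for the holding time, left-right for the
    next state (in [advance]), right for the future. At rate 0 the convention for division makes the
    holding time 0. *)
Definition clock (z : Z) : R := hold (coin_left (coin_left z.2)) / r z.1.

Definition advance (z : Z) : Z :=
  (F (z.1, coin_right (coin_left z.2)), coin_right z.2).

Lemma clock_ge0 z : 0 <= clock z.
Proof. by rewrite /clock divr_ge0// hold_ge0. Qed.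

Lemma measurable_clock : measurable_fun [set: Z] clock.
Proof.
apply: measurable_funM; last first.
  by apply: measurable_inv_ge0 => //; exact: measurableT_comp.
apply: (measurableT_comp measurable_hold).
apply: (measurableT_comp measurable_coin_left).
by apply: (measurableT_comp measurable_coin_left).
Qed.

Lemma measurable_advance : measurable_fun [set: Z] advance.
Proof.
apply: measurable_fun_pair; last exact: (measurableT_comp measurable_coin_right).
apply: (measurableT_comp mF); apply: measurable_fun_pair => //.
apply: (measurableT_comp measurable_coin_right).
by apply: (measurableT_comp measurable_coin_left).
Qed.

Lemma measurable_iter_advance n : measurable_fun [set: Z] (iter n advance).
Proof.
elim: n => [|n IH]; first exact: measurable_id.
by rewrite (_ : iter _ _ = advance \o iter n advance)//; apply: measurableT_comp => //; exact: measurable_advance.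
Qed.

Local Open Scope ereal_scope.

(** One-step Markov property: given the left coins [u], which fix the holding time and the next
    state, the future runs on independent coins [v]. *)
Lemma integral_advance (a : coins -> \bar R) (Phi : Z -> \bar R) x :
  measurable_fun [set: coins] a -> (forall u, 0 <= a u) ->
  measurable_fun [set: Z] Phi -> (forall z, 0 <= Phi z) ->
  \int[coin]_w (a (coin_left w) * Phi (advance (x, w))) =
  \int[coin]_u (a u * \int[coin]_v Phi (F (x, coin_right u), v)).
Proof.
move=> ma a0 mPhi Phi0.
have mg : measurable_fun [set: coins * coins]
    (fun p : coins * coins => a p.1 * Phi (F (x, coin_right p.1), p.2)).
  apply: emeasurable_funM; first exact: measurableT_comp.
  apply: (measurableT_comp mPhi); apply: measurable_fun_pair => //.
  apply: (measurableT_comp mF); apply: measurable_fun_pair => //.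
  exact: (measurableT_comp measurable_coin_right).
have := @integral_coin_split R _ mg; rewrite /advance/= => ->; last first.
  by move=> p; rewrite mule_ge0.
apply: eq_integral => u _; rewrite ge0_integralZl//.
by apply: (measurableT_comp mPhi); exact: measurable_fun_pair.
Qed.

Lemma integral_coin_left (a : coins -> \bar R) :
  measurable_fun [set: coins] a -> (forall u, 0 <= a u) ->
  \int[coin]_w a (coin_left w) = \int[coin]_u a u.
Proof.
move=> ma a0.
have := @integral_coin_split R (a \o fst) ltac:(exact: measurableT_comp).
rewrite /= => ->//; apply: eq_integral => u _.
by rewrite integral_cst//= probability_setT mule1.
Qed.

Lemma integral_coin_right (a : coins -> \bar R) :
  measurable_fun [set: coins] a -> (forall u, 0 <= a u) ->
  \int[coin]_w a (coin_right w) = \int[coin]_u a u.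
Proof.
move=> ma a0.
have := @integral_coin_split R (a \o snd) ltac:(exact: measurableT_comp).
rewrite /= => ->//.
by rewrite integral_cst//= probability_setT mule1.
Qed.

Section jump_law.
Variable rate : state R N -> set (state R N) -> R.
Hypothesis rateT : forall x, rate x setT = r x.
Hypothesis rateE : forall x B, measurable B ->
  rate x B = (r x * fine (coin [set u | B (F (x, u))]))%R.
Variables (B : set (state R N)) (t : R).
Hypotheses (mB : measurable B) (t_ge0 : (0 <= t)%R).

Let q x : R := (expR (- (rate x setT * t)) * (rate x B / rate x setT))%R.

Let mBF x : measurable [set u | B (F (x, u))].
Proof.
rewrite -[X in measurable X]setTI.
by apply: (measurableT_comp mF (measurable_fun_pair _ _)).
Qed.

Let qE x : q x = if r x == 0%R then 0%R
  else (expR (- (r x * t)) * fine (coin [set u | B (F (x, u))]))%R.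
Proof.
rewrite /q !rateT rateE//; case: eqVneq => [->|r0]; first by rewrite invr0 !mulr0.
by rewrite mulrAC divff// mul1r.
Qed.

Let q_ge0 x : (0 <= q x)%R.
Proof. by rewrite qE; case: ifP => // _; rewrite mulr_ge0 ?expR_ge0 ?fine_ge0. Qed.

Let mq : measurable_fun [set: state R N] q.
Proof.
rewrite (_ : q = fun x => if r x == 0%R then 0%R
  else (expR (- (r x * t)) * fine (coin [set u | B (F (x, u))]))%R); last first.
  exact/funext/qE.
apply: measurable_fun_ifT => //.
  by apply: measurable_fun_eqr.
apply: measurable_funM.
  apply: measurableT_comp => //; apply: measurableT_comp => //.
  exact: measurable_funM.
apply: measurableT_comp => //.
rewrite (_ : (fun x => _) = (coin \o xsection (F @^-1` B))); last first.
  apply/funext => x /=; congr (coin _); apply/seteqP; split=> u /=;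
    by rewrite /xsection/= inE.
apply: measurable_fun_xsection.
by rewrite -[X in measurable X]setTI; exact: mF.
Qed.

Let next : set Z := [set z | (t < clock z)%R /\ B (advance z).1].

Let mnext : measurable next.
Proof.
apply: measurableI.
  exact: (measurable_gt t measurable_clock).
exact: (preimage_measurable (measurableT_comp measurable_fst measurable_advance) mB).
Qed.

Let coin_next x : \int[coin]_w (\1_next (x, w))%:E = (q x)%:E.
Proof.
rewrite (_ : (fun w => _) = EFin \o (\1_(coin_left @^-1`
   ((coin_left @^-1` [set w | (t < hold w / r x)%R]) `&`
   (coin_right @^-1` [set u | B (F (x, u))])))) :> (coins -> _)); last first.
  by apply/funext => w /=; congr (_%:E); exact: eq_indic.
have mh : measurable [set w : coins | (t < hold w / r x)%R].
  by apply: measurable_gt; apply: measurable_funM => //; exact: measurable_hold.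
have ml (A : set coins) : measurable A -> measurable (coin_left @^-1` A).
  by move=> mA; rewrite -[X in measurable X]setTI; exact: measurable_coin_left.
have mr' (A : set coins) : measurable A -> measurable (coin_right @^-1` A).
  by move=> mA; rewrite -[X in measurable X]setTI; exact: measurable_coin_right.
have mI : measurable (coin_left @^-1` [set w : coins | (t < hold w / r x)%R] `&`
   coin_right @^-1` [set u | B (F (x, u))]).
  by apply: measurableI; [apply: ml|apply: mr'].
rewrite integral_indic//; last exact: ml.
rewrite setIT.
have cl A : measurable A -> coin (coin_left @^-1` A) = coin A.
  move=> mA; rewrite -[X in coin X]setIT -[X in _ `&` X](@preimage_setT _ _ coin_right).
  by rewrite coin_split// [X in _ * X]probability_setT mule1.
rewrite [LHS]cl// [LHS]coin_split// qE; case: eqVneq => [rx|rx].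
  rewrite (_ : [set w | _] = set0) ?measure0 ?mul0e//.
  by rewrite -subset0 => w /=; rewrite rx invr0 mulr0 ltNge t_ge0.
rewrite EFinM fineK ?fin_num_measure//; congr (_ * _).
have rx0 : (0 < r x)%R by rewrite lt_neqAle eq_sym rx r_ge0.
rewrite -coin_hold; last by rewrite mulr_ge0// ltW.
by congr (coin _); apply/seteqP; split=> w /=; rewrite ltr_pdivlMr// mulrC.
Qed.

Let past n (A : nat -> set (state R N)) (C : nat -> set R) : set Z :=
  [set z | (forall i, (i <= n)%N -> A i (iter i advance z).1) /\
           (forall i, (i < n)%N -> C i (clock (iter i advance z)))].

Let measurable_past n A C : (forall i, measurable (A i)) ->
  (forall i, measurable (C i)) -> measurable (past n A C).
Proof.
move=> mA mC; apply: measurableI.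
  suff : measurable (\bigcap_(i in [set i | (i <= n)%N])
    ((fun z => (iter i advance z).1) @^-1` A i)) by [].
  apply: bigcap_measurableType => i _; apply: preimage_measurable => //.
  exact: (measurableT_comp measurable_fst (measurable_iter_advance i)).
suff : measurable (\bigcap_(i in [set i | (i < n)%N])
    ((fun z => clock (iter i advance z)) @^-1` C i)) by [].
apply: bigcap_measurableType => i _; apply: preimage_measurable => //.
exact: (measurableT_comp measurable_clock (measurable_iter_advance i)).
Qed.

Let pastS n A C z : past n.+1 A C z <->
  (A 0%N z.1 /\ C 0%N (clock z)) /\
  past n (fun i => A i.+1) (fun i => C i.+1) (advance z).
Proof.
split=> [[h1 h2]|[[h1 h2] [h3 h4]]].
  split; first by split; [exact: h1|exact: h2].
  by split=> i ni; rewrite -iterSr; [exact: h1|exact: h2].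
by split=> -[|i] ni//; rewrite iterSr; [exact: h3|exact: h4].
Qed.

(** Induction by conditioning on the first jump instead of the last: after it the process is the
    same simulation started from [advance (x, w)], with the test sets shifted by one index. Hence
    the quantification over [A], [C] and [x]. *)
Lemma jump_law n A C x : (forall i, measurable (A i)) ->
  (forall i, measurable (C i)) ->
  \int[coin]_w ((\1_(past n A C) (x, w))%:E * (\1_next (iter n advance (x, w)))%:E) =
  \int[coin]_w ((\1_(past n A C) (x, w))%:E * (q (iter n advance (x, w)).1)%:E).
Proof.
elim: n A C x => [|n IH] A C x mA mC.
  have past0 w : \1_(past 0 A C) (x, w) = \1_(A 0%N) x :> R.
    apply: eq_indic; split=> [[h _]|h]; first exact: (h 0%N).
    by split=> // -[].
  under eq_integral do rewrite past0.
  under [RHS]eq_integral do rewrite past0.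
  have mn : measurable_fun [set: coins] (fun w => (\1_next (x, w))%:E : \bar R).
    by apply: measurable_eindic => //; exact: measurable_fun_pair.
  rewrite ge0_integralZl//= ?lee_fin//.
  rewrite coin_next -EFinM integral_cst//.
  by rewrite [X in _ * X]probability_setT mule1.
pose A' i := A i.+1; pose C' i := C i.+1.
(* The constraints of index 0, which depend on the left coins only. *)
pose D : set coins := [set u | A 0%N x /\ C 0%N (hold (coin_left u) / r x)%R].
have mD : measurable D.
  have [h|h] := pselect (A 0%N x); last first.
    by rewrite (_ : D = set0)// -subset0 => u [].
  rewrite (_ : D = (fun u : coins => hold (coin_left u) / r x)%R @^-1` C 0%N); last first.
    by apply/seteqP; split=> u //= [].
  apply: preimage_measurable => //; apply: measurable_funM => //.
  exact: (measurableT_comp measurable_hold measurable_coin_left).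
have lift (Phi : Z -> \bar R) w :
    (\1_(past n.+1 A C) (x, w))%:E * Phi (iter n.+1 advance (x, w)) =
    (\1_D (coin_left w))%:E * ((\1_(past n A' C') (advance (x, w)))%:E *
      Phi (iter n advance (advance (x, w)))).
  rewrite iterSr muleA; congr (_ * _); rewrite -EFinM; congr (_%:E).
  exact/indicM/pastS.
have mind (E : set Z) m : measurable E ->
    measurable_fun [set: Z] (fun z => (\1_E (iter m advance z))%:E : \bar R).
  by move=> mE; apply: measurable_eindic => //; exact: measurable_iter_advance.
under eq_integral do rewrite (lift (fun z => (\1_next z)%:E)).
under [RHS]eq_integral do rewrite (lift (fun z => (q z.1)%:E)).
have mDi : measurable_fun [set: coins] (fun u => (\1_D u)%:E : \bar R).
  exact: measurable_eindic.
have mp := mind _ 0%N (measurable_past n (fun i => mA i.+1) (fun i => mC i.+1)).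
rewrite (integral_advance (a := fun u => (\1_D u)%:E)
   (Phi := fun z => (\1_(past n A' C') z)%:E * (\1_next (iter n advance z))%:E)) //; last by apply: emeasurable_funM => //; exact: mind.
rewrite (integral_advance (a := fun u => (\1_D u)%:E)
   (Phi := fun z => (\1_(past n A' C') z)%:E * (q (iter n advance z).1)%:E)) //; last 2 first.
- apply: emeasurable_funM => //; apply/measurable_EFinP; apply: (measurableT_comp mq).
  exact: (measurableT_comp measurable_fst (measurable_iter_advance n)).
- by move=> z; rewrite mule_ge0// lee_fin.
apply: eq_integral => u _; congr (_ * _).
by apply: IH => i; [exact: mA|exact: mC].
Qed.

Lemma jump_law_set n A C x : (forall i, measurable (A i)) ->
  (forall i, measurable (C i)) ->
  let pst := [set w | past n A C (x, w)] in
  measurable pst /\ coin (pst `&` [set w | (t < clock (iter n advance (x, w)))%R /\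
     B (iter n.+1 advance (x, w)).1]) =
  \int[coin]_(w in pst) (q (iter n advance (x, w)).1)%:E.
Proof.
move=> mA mC pst.
have mx (E : set Z) : measurable E -> measurable [set w | E (x, w)].
  move=> mE; apply: (@preimage_measurable _ _ _ _ (fun w => (x, w))) => //.
  exact: measurable_fun_pair.
have mpst : measurable pst by apply: mx; exact: measurable_past.
split=> //.
have mn : measurable [set w | next (iter n advance (x, w))].
  apply: (mx [set z | next (iter n advance z)]); apply: preimage_measurable => //.
  exact: measurable_iter_advance.
rewrite integral_mkcond -[X in coin X]setIT.
rewrite -[LHS](@integral_indic _ _ _ coin setT)//; last exact: measurableI.
transitivity (\int[coin]_w ((\1_(past n A C) (x, w))%:E * (\1_next (iter n advance (x, w)))%:E)).
  by apply: eq_integral => w _; rewrite -EFinM; congr (_%:E); exact: indicM.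
rewrite jump_law//; apply: eq_integral => w _; rewrite patchE.
have -> : \1_(past n A C) (x, w) = \1_pst w :> R by exact: eq_indic.
by rewrite indicE; case: ifPn => h; rewrite ?mul1e ?mul0e.
Qed.

End jump_law.

Lemma sim_is_jump_process rate x0 :
  (forall x, rate x setT = r x) ->
  (forall x B, measurable B ->
    rate x B = (r x * fine (coin [set u | B (F (x, u))]))%R) ->
  is_jump_process rate x0 coin (fun n w => (iter n advance (x0, w)).1)
    (fun n w => clock (iter n advance (x0, w))).
Proof.
move=> rT rE.
have mx : measurable_fun [set: coins] (fun w => (x0, w)).
  exact: measurable_fun_pair.
split=> //.
- move=> n; apply: (measurableT_comp measurable_fst).
  exact: (measurableT_comp (measurable_iter_advance n) mx).
- move=> n; apply: (measurableT_comp measurable_clock).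
  exact: (measurableT_comp (measurable_iter_advance n) mx).
- move=> n A C B t mA mC mB t0 pst.
  by have [_] := jump_law_set rT rE mB t0 n x0 mA mC.
Qed.

End simulation.

(** * Foster's criterion *)

Section foster.
Context {R : realType} {N : nat}.
Variables (r : state R N -> R) (F : state R N * coins -> state R N).
Hypothesis mr : measurable_fun [set: state R N] r.
Hypothesis r_ge0 : forall x, 0 <= r x.
Hypothesis mF : measurable_fun [set: state R N * coins] F.
Variable x0 : state R N.
Hypothesis mx0 : measurable [set x0].

Local Notation Z := (state R N * coins)%type.
Local Notation coin := (@coin R).
Local Notation clock := (clock r).
Local Notation advance := (advance F).

(* Time, plus number of jumps, spent in at most n jumps before the return to x0;
   the flag tells whether x0 has been left already. *)
Fixpoint return_cost (n : nat) (left_x0 : bool) (z : Z) : R :=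
  if n is k.+1 then
    if left_x0 && (z.1 == x0) then 0
    else clock z + 1 + return_cost k (left_x0 || ((advance z).1 != x0)) (advance z)
  else 0.

Lemma return_cost_ge0 n b z : 0 <= return_cost n b z.
Proof.
elim: n b z => //= n IH b z; case: ifP => // _.
by rewrite !addr_ge0// clock_ge0.
Qed.

Lemma return_costS n b z : return_cost n b z <= return_cost n.+1 b z.
Proof.
elim: n b z => [|n IH] b z; first exact: return_cost_ge0.
by rewrite [leLHS]/= [leRHS]/=; case: ifP => // _; rewrite lerD2l.
Qed.

Lemma measurable_return_cost n b : measurable_fun [set: Z] (return_cost n b).
Proof.
have mx d (T : measurableType d) (f : T -> state R N) : measurable_fun [set: T] f ->
    measurable_fun [set: T] (fun x => f x == x0).
  move=> mf; apply: (@measurable_fun_bool _ _ _ _ true); rewrite setTI.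
  rewrite (_ : _ @^-1` _ = f @^-1` [set x0]); first exact: preimage_measurable.
  by apply/seteqP; split=> y /= /eqP.
elim: n b => [|n IH] b; first exact: measurable_cst.
apply: measurable_fun_ifT => //.
  by case: b => //=; exact: mx.
apply: measurable_funD.
  by apply: measurable_funD => //; exact: measurable_clock.
have mA := measurable_advance mF.
case: b => /=; first exact: (measurableT_comp (IH true) mA).
rewrite (_ : (fun z => _) = fun z => if (advance z).1 == x0 then
    return_cost n false (advance z) else return_cost n true (advance z)); last first.
  by apply/funext => z; case: eqP.
apply: measurable_fun_ifT.
- by apply: mx; exact: (measurableT_comp measurable_fst).
- exact: (measurableT_comp (IH false) mA).
- exact: (measurableT_comp (IH true) mA).
Qed.

(** The unit charged for each jump gives the second alternative. A bounded cost thus forces a return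
    after finitely many jumps; a bound on the elapsed time alone would not, since infinitely many
    holding times may have a finite sum. *)
Lemma return_cost_cases n b z : (~~ b -> z.1 = x0) ->
  (exists m, [/\ (iter m advance z).1 = x0,
     b \/ (exists2 j, (j < m)%N & (iter j advance z).1 <> x0) &
     \sum_(i < m) clock (iter i advance z) <= return_cost n b z]) \/
  n%:R <= return_cost n b z.
Proof.
elim: n b z => [|n IH] b z bz; first by right.
rewrite [return_cost _ _ _]/=.
case: ifPn => [/andP[b1 /eqP z1]|nb].
  by left; exists 0%N; split; rewrite ?big_ord0//; left.
set b' := _ || _.
have := IH b' (advance z); case.
- by rewrite /b' negb_or negbK => /andP[_ /eqP].
- move=> [m [Ym bm sm]]; left; exists m.+1; split.
  + by rewrite iterSr.
  + have h : (exists2 j, (j < m)%N & (iter j advance (advance z)).1 <> x0) ->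
      exists2 j, (j < m.+1)%N & (iter j advance z).1 <> x0.
      by move=> [j jm Yj]; exists j.+1; rewrite ?iterSr.
    case: bm => [/orP[|/eqP]|/h]; [by left| |by right].
    move=> a1; right; apply: h; exists 0%N => //; case: m Ym {sm} => //.
  + rewrite big_ord_recl/=.
    under eq_bigr do rewrite -iterS iterSr.
    by rewrite -addrA lerD2l (le_trans sm)// lerDr.
- move=> h; right; rewrite -natr1 addrC lerD//.
  by rewrite lerDr clock_ge0.
Qed.

Local Open Scope ereal_scope.

Lemma integral_return_costS n b x : ~~ (b && (x == x0)) ->
  \int[coin]_w (return_cost n.+1 b (x, w))%:E =
  ((r x)^-1 + 1)%:E + \int[coin]_u \int[coin]_v
     (return_cost n (b || (F (x, u) != x0)) (F (x, u), v))%:E.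
Proof.
move=> bx.
pose Phi z := (return_cost n (b || (z.1 != x0)) z)%:E.
have mPhi : measurable_fun [set: Z] Phi.
  apply/measurable_EFinP; case: (b) => /=; first exact: measurable_return_cost.
  rewrite (_ : (fun z => _) = fun z : Z => if z.1 == x0 then
    return_cost n false z else return_cost n true z); last first.
    by apply/funext => z; case: eqP.
  apply: measurable_fun_ifT; [|exact: measurable_return_cost|exact: measurable_return_cost].
  apply: (@measurable_fun_bool _ _ _ _ true); rewrite setTI.
  rewrite (_ : _ @^-1` _ = fst @^-1` [set x0]); first exact: preimage_measurable.
  by apply/seteqP; split=> y /= /eqP.
have Phi0 z : 0 <= Phi z by rewrite lee_fin return_cost_ge0.
pose c (w : coins) : \bar R := (clock (x, w))%:E.
have mc : measurable_fun [set: coins] c.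
  apply/measurable_EFinP; apply: (measurableT_comp (measurable_clock mr r_ge0)).
  exact: measurable_fun_pair.
have c0 w : 0 <= c w by rewrite lee_fin clock_ge0.
have mxw : measurable_fun [set: coins] (fun w : coins => (x, w)) by exact: measurable_fun_pair.
have mPa : measurable_fun [set: coins] (fun w => Phi (advance (x, w))).
  by apply: (measurableT_comp mPhi); exact: (measurableT_comp (measurable_advance mF) mxw).
transitivity (\int[coin]_w (c w + 1 + Phi (advance (x, w)))).
  by apply: eq_integral => w _ /=; rewrite (negbTE bx) !EFinD.
rewrite ge0_integralD//; [|by move=> w _; rewrite adde_ge0|exact: emeasurable_funD].
rewrite ge0_integralD// integral_cst// [X in _ * X]probability_setT mule1.
congr (_ + _).
  rewrite EFinD; congr (_ + _).
  pose a (w : coins) : \bar R := (r x)^-1%:E * (hold w)%:E.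
  have ma : measurable_fun [set: coins] a.
    by apply: emeasurable_funM => //; apply/measurable_EFinP; exact: measurable_hold.
  have a0 w : 0 <= a w by rewrite /a -EFinM lee_fin mulr_ge0 ?invr_ge0 ?hold_ge0.
  rewrite (_ : c = fun w => a (coin_left (coin_left w))); last first.
    by apply/funext => w; rewrite /c /a /clock/= mulrC.
  have mal : measurable_fun [set: coins] (fun w => a (coin_left w)).
    exact: (measurableT_comp ma measurable_coin_left).
  rewrite (integral_coin_left mal)//.
  rewrite integral_coin_left// /a ge0_integralZl//; last 3 first.
  - by apply/measurable_EFinP; exact: measurable_hold.
  - by move=> w _; rewrite lee_fin hold_ge0.
  - by rewrite lee_fin invr_ge0.
  by rewrite integral_hold mule1.
transitivity (\int[coin]_w (1 * Phi (advance (x, w)))).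
  by apply: eq_integral => w _; rewrite mul1e.
rewrite (integral_advance mF (a := cst 1))//.
pose g u := \int[coin]_v Phi (F (x, u), v).
transitivity (\int[coin]_u g (coin_right u)).
  by apply: eq_integral => u _; rewrite mul1e.
apply: integral_coin_right => [|u]; last exact: integral_ge0.
apply: (@measurable_fun_fubini_tonelli_F _ _ _ _ _ coin (fun p => Phi (F (x, p.1), p.2))) => //.
apply: (measurableT_comp mPhi); apply: measurable_fun_pair => //.
by apply: (measurableT_comp mF); exact: measurable_fun_pair.
Qed.

Section drift.
Variable V : state R N -> \bar R.
Hypothesis V_ge0 : forall x, 0 <= V x.
Hypothesis mV : measurable_fun [set: state R N] V.
Hypothesis drift : forall x, x <> x0 ->
  ((r x)^-1 + 1)%:E + \int[coin]_u V (F (x, u)) <= V x.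
Hypothesis start : \int[coin]_u V (F (x0, u)) < +oo.
Hypothesis leave : coin [set u | F (x0, u) = x0] < 1.

Lemma integral_return_cost_le n x :
  \int[coin]_w (return_cost n true (x, w))%:E <= V x.
Proof.
elim: n x => [|n IH] x; first by rewrite integral0_eq.
have [->|/eqP xx0] := eqVneq x x0.
  by rewrite integral0_eq// => w _; rewrite /= eqxx.
rewrite integral_return_costS; last by apply/negP => /eqP.
apply: le_trans (drift xx0); rewrite leeD2l//; apply: integral_le => u _.
  by apply: integral_ge0 => v _; rewrite lee_fin return_cost_ge0.
exact: IH.
Qed.

Let p := fine (coin [set u | F (x0, u) = x0]).
Let b := ((r x0)^-1 + 1 + fine (\int[coin]_u V (F (x0, u))))%R.

(** A jump from [x0] to itself, of probability [p], does not count as leaving, so the process may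
    start over a geometric number of times; this is the source of the factor 1 / (1 - p). *)
Lemma integral_return_cost_start n :
  \int[coin]_w (return_cost n false (x0, w))%:E <= (b / (1 - p))%:E.
Proof.
have mE : measurable [set u | F (x0, u) = x0].
  apply: (preimage_measurable (f := fun u => F (x0, u)) (A := [set x0])) => //.
  by apply: (measurableT_comp mF); exact: measurable_fun_pair.
have I0 : 0 <= \int[coin]_u V (F (x0, u)) by exact: integral_ge0.
have pE : coin [set u | F (x0, u) = x0] = p%:E by rewrite fineK// fin_num_measure.
have p1 : (p < 1)%R by rewrite -lte_fin -pE.
have b0 : (0 <= b)%R by rewrite !addr_ge0// ?invr_ge0// fine_ge0.
have IE : \int[coin]_u V (F (x0, u)) = (fine (\int[coin]_u V (F (x0, u))))%:E.
  by rewrite fineK// ge0_fin_numE.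
set M := (b / (1 - p))%R.
have M0 : (0 <= M)%R by rewrite divr_ge0// subr_ge0 ltW.
elim: n => [|n IH]; first by rewrite integral0_eq.
rewrite integral_return_costS//=.
(* [M] is the fixed point of the one-step recursion, in which a jump from [x0] to itself costs [M]
   again. *)
have MbE : M%:E = ((r x0)^-1 + 1)%:E + (M%:E * p%:E + \int[coin]_u V (F (x0, u))).
  rewrite IE -EFinM -!EFinD; congr (_%:E).
  have : (M * (1 - p) = b)%R by rewrite /M divfK// subr_eq0 gt_eqF.
  by rewrite /b; lra.
have mV' : measurable_fun [set: coins] (fun u => V (F (x0, u))).
  by apply: (measurableT_comp mV); apply: (measurableT_comp mF); exact: measurable_fun_pair.
have mi : measurable_fun [set: coins] (fun u => (\1_[set u | F (x0, u) = x0] u)%:E : \bar R).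
  exact: measurable_eindic.
rewrite MbE leeD2l// -pE.
have <- : \int[coin]_u (M%:E * (\1_[set u | F (x0, u) = x0] u)%:E) =
    M%:E * coin [set u | F (x0, u) = x0].
  rewrite ge0_integralZl//= ?lee_fin//.
  by rewrite integral_indic// setIT.
rewrite -ge0_integralD//; last 2 first.
- by move=> u _; rewrite -EFinM lee_fin mulr_ge0.
- exact: emeasurable_funM.
apply: integral_le => u _.
  by apply: integral_ge0 => v _; rewrite lee_fin return_cost_ge0.
rewrite indicE; case: (boolP (u \in _)) => [|/negP]; rewrite inE/= => Fu.
  by rewrite Fu eqxx mule1 (le_trans IH)// leeDl.
rewrite mule0 add0e (_ : (_ != _) = true); last by apply/eqP.
exact: integral_return_cost_le.
Qed.

Theorem foster rate : (forall x, rate x setT = r x) ->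
  (forall x B, measurable B ->
    rate x B = (r x * fine (coin [set u | B (F (x, u))]))%R) ->
  positive_recurrent rate x0.
Proof.
move=> rT rE.
pose Y n (w : coins) := (iter n advance (x0, w)).1.
pose H n (w : coins) := clock (iter n advance (x0, w)).
exists _, coins, coin, Y, H; split; first exact: (sim_is_jump_process mr r_ge0 mF x0 rT rE).
pose f n (w : coins) : \bar R := (return_cost n false (x0, w))%:E.
have nd w : nondecreasing_seq (f^~ w).
  by apply/nondecreasing_seqP => n; rewrite lee_fin return_costS.
have fle n w : f n w <= limn (f^~ w).
  rewrite (cvg_lim _ (ereal_nondecreasing_cvgn (nd w)))//.
  by apply: ereal_sup_ubound; exists n.
have f0 n w : 0 <= f n w by rewrite lee_fin return_cost_ge0.
have mf n : measurable_fun [set: coins] (f n).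
  apply/measurable_EFinP; apply: (measurableT_comp (measurable_return_cost n false)).
  exact: measurable_fun_pair.
apply: (@le_lt_trans _ _ (\int[coin]_w limn (f^~ w))).
  apply: integral_le => w _.
    apply: le_ereal_inf_tmp => _ [n _ <-]; rewrite lee_fin sumr_ge0// => i _.
    exact: clock_ge0.
  have [[n [m [Ym lm sm]]]|nh] := pselect (exists n m, [/\ Y m w = x0,
    exists2 j, (j < m)%N & Y j w <> x0 &
     (\sum_(i < m) H i w <= return_cost n false (x0, w))%R]).
    apply: le_trans (fle n w); apply: (@le_trans _ _ (\sum_(i < m) H i w)%:E); last first.
      by rewrite lee_fin.
    by apply: ereal_inf_lbound; exists m.
  (* Without a return all the jumps are charged, so the n-th cost is at least n. *)
  suff -> : limn (f^~ w) = +oo by rewrite leey.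
  apply/eqyP => A A0; apply: le_trans (fle (Num.trunc A).+1 w).
  have [] := @return_cost_cases (Num.trunc A).+1 false (x0, w) ltac:(by []).
    move=> [m [Ym [//|lm] sm]]; exfalso; apply: nh.
    by exists (Num.trunc A).+1, m.
  by rewrite lee_fin; apply: le_trans; rewrite ltW// truncnS_gt.
rewrite monotone_convergence//.
apply: (@le_lt_trans _ _ (b / (1 - p))%:E); last by rewrite ltry.
apply: lime_le.
  apply: ereal_nondecreasing_is_cvgn; apply/nondecreasing_seqP => n.
  by apply: integral_le => // w _; rewrite lee_fin return_costS.
by apply: nearW => n; exact: integral_return_cost_start.
Qed.

End drift.

End foster.

(** * The space of states *)

Section state_measurability.
Context {R : realType} {N : nat}.
Local Notation state := (state R N).

Lemma measurable_from_state d (T : measurableType d) (g : state -> T) :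
  (forall l m, measurable_fun [set: l.-tuple R] (fun s => g (tval s, m))) ->
  measurable_fun [set: state] g.
Proof.
move=> mg _ B mB; rewrite setTI.
rewrite -[measurable _]/(state_measurable _) => l m.
exact: (preimage_measurable (mg l m) mB).
Qed.

Lemma measurable_to_state d (T : measurableType d) (phi : T -> seq R) (k : nat)
    (m : 'I_N.+1) :
  (forall x, size (phi x) = k) ->
  (forall j, (j < k)%N -> measurable_fun [set: T] (fun x => (phi x)`_j)) ->
  measurable_fun [set: T] (fun x => (phi x, m) : state).
Proof.
move=> sphi mphi _ B mB; rewrite setTI.
have psize x : size (phi x) == k by rewrite sphi.
pose g x : k.-tuple R := Tuple (psize x).
have mg : measurable_fun [set: T] g.
  apply/measurable_fun_tnthP => j.
  rewrite (_ : _ \o _ = fun x => (phi x)`_j); first exact: mphi.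
  by apply/funext => x /=; rewrite (tnth_nth 0).
exact: (preimage_measurable mg (mB k m)).
Qed.

Lemma measurable_nth_tuple l j :
  measurable_fun [set: l.-tuple R] (fun s => (tval s)`_j).
Proof.
have [jl|lj] := ltnP j l; last first.
  rewrite (_ : (fun s => _) = cst 0) //.
  by apply/funext => s; rewrite nth_default// size_tuple.
rewrite (_ : (fun s => _) = fun s : l.-tuple R => tnth s (Ordinal jl)).
  exact: measurable_tnth.
by apply/funext => s; rewrite (tnth_nth 0).
Qed.

Lemma measurable_size_state_set l m : measurable [set x : state | size x.1 = l /\ x.2 = m].
Proof.
rewrite -[measurable _]/(state_measurable _) => k m'.
have [[kl mm']|h] := pselect (k = l /\ m' = m).
  subst k m'; rewrite (_ : [set _ | _] = setT)//.
  by apply/seteqP; split=> // s _ /=; rewrite size_tuple.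
rewrite (_ : [set _ | _] = set0)// -subset0 => s /=; rewrite size_tuple => e.
exact: h.
Qed.

(** The sigma-algebra of the product is not given length by length. The projections [pr l], constant
    on lists of another length, are measurable on all states and allow each piece to be treated as a
    product with a space of tuples. *)
Lemma measurable_state_prod d d' (T : measurableType d) (T' : measurableType d')
    (f : state * T -> T') :
  (forall l m, measurable_fun [set: l.-tuple R * T]
     (fun p => f ((tval p.1, m), p.2))) ->
  measurable_fun [set: state * T] f.
Proof.
move=> mf _ B mB; rewrite setTI.
pose pr l (x : state) : l.-tuple R := insubd [tuple of nseq l 0] x.1.
have mpr l : measurable_fun [set: state] (pr l).
  apply: measurable_from_state => k m.
  have [kl|kl] := pselect (k = l); last first.
    rewrite (_ : (fun s => _) = cst [tuple of nseq l 0])//.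
    by apply/funext => s; rewrite /pr /insubd insubN// size_tuple; apply/eqP.
  subst k; rewrite (_ : (fun s => _) = id); first exact: measurable_id.
  by apply/funext => s; apply: val_inj; rewrite /pr /insubd insubT ?size_tuple.
rewrite (_ : f @^-1` B = \bigcup_l \bigcup_(m in [set: 'I_N.+1])
   (([set x : state | size x.1 = l /\ x.2 = m] `*` setT) `&`
    (fun p : state * T => (pr l p.1, p.2)) @^-1`
      ((fun p : l.-tuple R * T => f ((tval p.1, m), p.2)) @^-1` B))).
  apply: bigcup_measurable => l _; apply: fin_bigcup_measurable => [|m _].
    exact: finite_finset.
  apply: measurableI.
    by apply: measurableX => //; exact: measurable_size_state_set.
  apply: preimage_measurable.
    by apply: measurable_fun_pair => //; exact: (measurableT_comp (mpr l) measurable_fst).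
  exact: (preimage_measurable (mf l m) mB).
have prE (x : state) : tval (pr (size x.1) x) = x.1.
  by rewrite /pr /insubd insubT//= eqxx.
apply/seteqP; split=> [[[s m] t] /= h|[[s m] t] [l _ [m' _] [[[sl mm'] _] h]]].
  by exists (size s) => //; exists m => //; split=> //=; rewrite (prE (s, m)).
by move: h; rewrite /preimage/= -sl -mm' (prE (s, m)).
Qed.

Lemma measurable_rcons :
  measurable_fun [set: state * R] (fun p => (rcons p.1.1 p.2, p.1.2) : state).
Proof.
apply: measurable_state_prod => l m /=.
apply: (@measurable_to_state _ _ (fun p : l.-tuple R * R => rcons p.1 p.2) l.+1) => [p|j jl].
  by rewrite size_rcons size_tuple.
have [jl'|lj] := ltnP j l.
  rewrite (_ : (fun p => _) = fun p : l.-tuple R * R => (tval p.1)`_j).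
    exact: (measurableT_comp (@measurable_nth_tuple l j) measurable_fst).
  by apply/funext => p; rewrite nth_rcons size_tuple jl'.
rewrite (_ : (fun p => _) = snd)//.
apply/funext => p; rewrite nth_rcons size_tuple ltnNge lj/=.
by rewrite ifT//; apply/eqP/anti_leq; rewrite lj -ltnS jl.
Qed.

Lemma size_remove_job i (s : seq R) : (i < size s)%N ->
  size (remove_job i s) = (size s).-1.
Proof. by move=> h; rewrite size_cat size_take h size_drop; lia. Qed.

Lemma nth_remove_job i j (s : seq R) : (i < size s)%N ->
  (remove_job i s)`_j = s`_(if (j < i)%N then j else j.+1).
Proof.
move=> h; rewrite nth_cat size_take h; case: ltnP => ji; first by rewrite nth_take.
by rewrite nth_drop; congr nth; lia.
Qed.

Lemma measurable_remove_job i m :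
  measurable_fun [set: state] (fun x => (remove_job i x.1, m) : state).
Proof.
apply: measurable_from_state => l m' /=.
have [il|li] := ltnP i l; last first.
  apply: (@measurable_to_state _ _ (fun s : l.-tuple R => remove_job i s) l) => [s|j jl].
    by rewrite size_cat size_take size_drop size_tuple; case: ltnP; lia.
  rewrite (_ : (fun s => _) = fun s : l.-tuple R => (tval s)`_j).
    exact: measurable_nth_tuple.
  apply/funext => s; rewrite /remove_job take_oversize ?size_tuple//.
  by rewrite drop_oversize ?cats0// size_tuple ltnW.
apply: (@measurable_to_state _ _ (fun s : l.-tuple R => remove_job i s) l.-1) => [s|j jl].
  by rewrite size_remove_job size_tuple.
rewrite (_ : (fun s => _) = fun s : l.-tuple R =>
   (tval s)`_(if (j < i)%N then j else j.+1)); first exact: measurable_nth_tuple.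
by apply/funext => s; rewrite nth_remove_job// size_tuple.
Qed.

Lemma measurable_change_mode m :
  measurable_fun [set: state] (fun x => (x.1, m) : state).
Proof.
apply: measurable_from_state => l m' /=.
apply: (@measurable_to_state _ _ (fun s : l.-tuple R => tval s) l) => [s|j _].
  by rewrite size_tuple.
exact: measurable_nth_tuple.
Qed.

Section patterns.
Variable K : nat.

(* Everything that a discretized policy looks at; the head of each list tells
   whether the requirement is a legal one. *)
Definition job_pattern (v : R) : seq bool :=
  (0 < v <= 1) :: [seq is_type K k v | k <- iota 1 K].

Definition pattern (x : state) : seq (seq bool) * 'I_N.+1 :=
  (map job_pattern x.1, x.2).

Lemma measurable_is_type k : measurable [set v : R | is_type K k v].
Proof.
rewrite (_ : [set v | _] = `]k.-1%:R / K%:R, k%:R / K%:R]%classic).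
  exact: measurable_itv.
by apply/seteqP; split=> v /=; rewrite in_itv.
Qed.

Lemma measurable_job_pattern p : measurable [set v : R | job_pattern v = p].
Proof.
have meq (f : R -> bool) b : measurable [set v | f v] -> measurable [set v | f v = b].
  case: b => // mf; rewrite (_ : [set v | _] = ~` [set v | f v]).
    exact: measurableC.
  by apply/seteqP; split=> v /=; [move=> ->|case: (f v)].
have mseq (fs : seq (R -> bool)) q : (forall f, List.In f fs -> measurable [set v | f v]) ->
    measurable [set v | [seq f v | f <- fs] = q].
  elim: fs q => [|f fs IH] [|b q] h /=.
  - by rewrite (_ : [set _ | _] = setT)//; apply/seteqP; split.
  - by rewrite (_ : [set _ | _] = set0)//; apply/seteqP; split.
  - by rewrite (_ : [set _ | _] = set0)//; apply/seteqP; split.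
  - rewrite (_ : [set _ | _] = [set v | f v = b] `&` [set v | [seq g v | g <- fs] = q]).
      apply: measurableI; first by apply: meq; apply: h; left.
      by apply: IH => g fg; apply: h; right.
    by apply/seteqP; split=> v /= [-> ->].
have -> : [set v | job_pattern v = p] =
    [set v | [seq f v | f <- (fun v => 0 < v <= 1) :: [seq is_type K k | k <- iota 1 K]] = p].
  by apply/seteqP; split=> v /=; rewrite /job_pattern -map_comp.
apply: mseq => f /= [<-|].
  rewrite (_ : [set v | _] = `]0, 1]%classic); first exact: measurable_itv.
  by apply/seteqP; split=> v /=; rewrite in_itv.
elim: (iota 1 K) => //= k ks IH [<-|//]; first exact: measurable_is_type.
Qed.

(** There are countably many patterns, each of them a measurable event, so every set of patterns is
    measurable, however complicated. This settles the measurability of maximization and oldest-first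
    rules at once. *)
Lemma measurable_pattern_set A : measurable [set x : state | A (pattern x)].
Proof.
rewrite (_ : [set x | _] = \bigcup_(p in A) [set x | pattern x = p]); last first.
  by apply/seteqP; split=> [x Ax|x [p Ap /= ->]//]; exists (pattern x).
rewrite bigcup_mkcond; apply: countable_bigcupT_measurable => // -[p m].
case: ifP => // _; rewrite -[measurable _]/(state_measurable _) => l m'.
have [->|/eqP mm'] := eqVneq m' m; last first.
  by rewrite (_ : [set _ | _] = set0)// -subset0 => s /= [].
rewrite (_ : [set s | _] = [set s : l.-tuple R | map job_pattern s = p]); last first.
  by apply/seteqP; split=> s /=; rewrite /pattern /=; [case|move=> ->].
have [pl|/eqP pl] := eqVneq (size p) l; last first.
  rewrite (_ : [set _ | _] = set0)// -subset0 => s /= e.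
  by apply: pl; rewrite -e size_map size_tuple.
rewrite (_ : [set _ | _] = \bigcap_(j in [set j | (j < l)%N])
   [set s : l.-tuple R | job_pattern s`_j = nth [::] p j]).
  apply: bigcap_measurableType => j _.
  exact: (preimage_measurable (@measurable_nth_tuple l j) (measurable_job_pattern _)).
apply/seteqP; split=> s /= h.
  by move=> j /= jl; rewrite -h (nth_map 0)// size_tuple.
apply: (@eq_from_nth _ [::]); first by rewrite size_map size_tuple pl.
by move=> j; rewrite size_map size_tuple => jl; rewrite (nth_map 0) ?size_tuple// h.
Qed.

Lemma measurable_pattern_fun d (T : measurableType d) (g : state -> T) :
  (forall x y, pattern x = pattern y -> g x = g y) ->
  measurable_fun [set: state] g.
Proof.
move=> h _ B mB; rewrite setTI.
rewrite (_ : g @^-1` B = [set x | [set p | exists2 y, pattern y = p & B (g y)] (pattern x)]).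
  exact: measurable_pattern_set.
by apply/seteqP; split=> x /=; [exists x|move=> [y /h <-]].
Qed.

Lemma type_count_pattern k (s : seq R) : (1 <= k <= K)%N ->
  type_count K s k = count (fun b => nth false b k) (map job_pattern s).
Proof.
move=> /andP[k1 kK]; rewrite count_map /type_count; apply: eq_count => v /=.
by rewrite -(prednK k1)/= (nth_map 0%N) ?size_iota ?nth_iota ?add1n ?prednK.
Qed.

Lemma is_type_pattern k (s : seq R) i : (1 <= k <= K)%N -> (i < size s)%N ->
  is_type K k s`_i = nth false (nth [::] (map job_pattern s) i) k.
Proof.
move=> /andP[k1 kK] si; rewrite (nth_map 0)//.
by rewrite -(prednK k1)/= (nth_map 0%N) ?size_iota ?nth_iota ?add1n ?prednK.
Qed.

Lemma valid_jobs_pattern (s : seq R) :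
  valid_jobs s = all (fun b => head false b) (map job_pattern s).
Proof. by rewrite all_map. Qed.

Lemma size_pattern (x y : state) : pattern x = pattern y -> size x.1 = size y.1.
Proof. by move=> [e _]; rewrite -(size_map job_pattern) e size_map. Qed.

End patterns.

End state_measurability.

(** * Transition rate operators *)

Section simulable.
Context {R : realType} {N : nat}.
Local Notation state := (state R N).
Local Notation coin := (@coin R).
Local Open Scope ereal_scope.

(* A is the operator g |-> \int g(y) Q(., dy) of a transition rate kernel Q with
   total rate r, sampled by F. *)
Definition simulates (r : state -> R) (F : state * coins -> state)
    (A : (state -> \bar R) -> state -> \bar R) : Prop :=
  [/\ measurable_fun [set: state] r, (forall x, 0 <= r x)%R,
      measurable_fun [set: state * coins] F &
      forall g, measurable_fun [set: state] g -> (forall x, 0 <= g x) ->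
        forall x, A g x = (r x)%:E * \int[coin]_u g (F (x, u))].

Definition simulable A := exists r F, simulates r F A.

Lemma measurable_sample (F : state * coins -> state) (g : state -> \bar R) x :
  measurable_fun [set: state * coins] F -> measurable_fun [set: state] g ->
  measurable_fun [set: coins] (fun u => g (F (x, u))).
Proof.
move=> mF mg; apply: (measurableT_comp mg); apply: (measurableT_comp mF).
exact: measurable_fun_pair.
Qed.

(** The left coins decide between the two branches with bias [p], and the right coins run the chosen
    one. *)
Lemma integral_coin_choice (p : R) (h1 h2 : coins -> \bar R) : (0 <= p <= 1)%R ->
  measurable_fun [set: coins] h1 -> measurable_fun [set: coins] h2 ->
  (forall u, 0 <= h1 u) -> (forall u, 0 <= h2 u) ->
  \int[coin]_u (if (unif (coin_left u) < p)%R then h1 (coin_right u) else h2 (coin_right u)) =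
  p%:E * \int[coin]_u h1 u + (1 - p)%:E * \int[coin]_u h2 u.
Proof.
move=> p01 mh1 mh2 h10 h20.
pose D := [set w : coins | (unif w < p)%R].
have mD : measurable D.
  rewrite (_ : D = [set w | (- p < - unif w)%R]).
    by apply: measurable_gt; apply: measurableT_comp => //; exact: measurable_unif.
  by apply/seteqP; split=> w /=; rewrite /D/= ltrN2.
have cD : coin D = p%:E by exact: coin_unif_lt.
have cDC : coin (~` D) = (1 - p)%:E.
  by rewrite [LHS]probability_setC// EFinB; congr (1 - _); exact: cD.
pose g (z : coins * coins) := (\1_D z.1)%:E * h1 z.2 + (\1_(~` D) z.1)%:E * h2 z.2.
have mi (E : set coins) : measurable E ->
    measurable_fun [set: coins * coins] (fun z => (\1_E z.1)%:E : \bar R).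
  by move=> mE; exact: measurable_eindic.
have mi1 (E : set coins) : measurable E ->
    measurable_fun [set: coins] (fun z => (\1_E z)%:E : \bar R).
  by move=> mE; exact: measurable_eindic.
have mg : measurable_fun [set: coins * coins] g.
  by apply: emeasurable_funD; apply: emeasurable_funM;
    [exact: mi|exact: measurableT_comp|apply: mi; exact: measurableC|exact: measurableT_comp].
have g0 z : 0 <= g z by rewrite adde_ge0// mule_ge0// lee_fin.
transitivity (\int[coin]_w g (coin_left w, coin_right w)).
  apply: eq_integral => w _; rewrite /g/= !indicE.
  rewrite (_ : (coin_left w \in ~` D) = ~~ (unif (coin_left w) < p)%R).
    rewrite (_ : (coin_left w \in D) = (unif (coin_left w) < p)%R).
      by case: ifP => _; rewrite ?mul1e ?mul0e ?adde0 ?add0e.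
    by apply/idP/idP; rewrite inE.
  by apply/idP/negP; rewrite inE.
rewrite integral_coin_split//.
have I0 h : (forall u, 0 <= h u) -> 0 <= \int[coin]_v h v by move=> h0; exact: integral_ge0.
transitivity (\int[coin]_u ((\1_D u)%:E * (\int[coin]_v h1 v) +
    (\1_(~` D) u)%:E * \int[coin]_v h2 v)).
  apply: eq_integral => u _; rewrite /g/= ge0_integralD//.
  - by rewrite !ge0_integralZl// ?lee_fin.
  - by move=> v _; rewrite mule_ge0// lee_fin.
  - exact: emeasurable_funM.
  - by move=> v _; rewrite mule_ge0// lee_fin.
  - exact: emeasurable_funM.
rewrite ge0_integralD//; last 4 first.
- by move=> v _; rewrite mule_ge0// ?lee_fin// I0.
- by apply: emeasurable_funM => //; exact: mi1.
- by move=> v _; rewrite mule_ge0// ?lee_fin// I0.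
- by apply: emeasurable_funM => //; apply: mi1; exact: measurableC.
have iE (E : set coins) c : measurable E -> 0 <= c ->
    \int[coin]_u ((\1_E u)%:E * c) = coin E * c.
  move=> mE c0; rewrite ge0_integralZr//; last exact: mi1.
  by rewrite integral_indic// setIT.
rewrite !iE ?I0//; last exact: measurableC.
by congr (_ * _ + _ * _).
Qed.

(** Superposition of rates: an event of the sum comes from the first operator with probability r1 /
    (r1 + r2). If both rates vanish, this ratio is 0 by convention and the identity reads 0 = 0. *)
Lemma simulable_add A1 A2 : simulable A1 -> simulable A2 ->
  simulable (fun g x => A1 g x + A2 g x).
Proof.
move=> [r1 [F1 [mr1 r10 mF1 E1]]] [r2 [F2 [mr2 r20 mF2 E2]]].
pose p x := (r1 x / (r1 x + r2 x))%R.
pose F (z : state * coins) := if (unif (coin_left z.2) < p z.1)%R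
  then F1 (z.1, coin_right z.2) else F2 (z.1, coin_right z.2).
have mrr : measurable_fun [set: state] (fun x => r1 x + r2 x)%R by exact: measurable_funD.
exists (fun x => r1 x + r2 x)%R, F; split => //.
- by move=> x; rewrite addr_ge0.
- have mz : measurable_fun [set: state * coins] (fun z => (z.1, coin_right z.2)).
    by apply: measurable_fun_pair => //; exact: (measurableT_comp measurable_coin_right).
  apply: measurable_fun_ifT; [|exact: measurableT_comp|exact: measurableT_comp].
  apply: measurable_fun_ltr.
    by apply: (measurableT_comp measurable_unif); exact: (measurableT_comp measurable_coin_left).
  apply: (@measurableT_comp _ _ _ _ _ _ p) => //; apply: measurable_funM => //.
  by apply: measurable_inv_ge0 => // x; rewrite addr_ge0.
move=> g mg g0 x; rewrite E1// E2//.
have p01 : (0 <= p x <= 1)%R.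
  have [e|r0] := eqVneq (r1 x + r2 x)%R 0%R.
    by rewrite /p e invr0 mulr0 lexx ler01.
  have rp : (0 < r1 x + r2 x)%R by rewrite lt_neqAle eq_sym r0 addr_ge0.
  by rewrite divr_ge0 ?(ltW rp)//= ler_pdivrMr// mul1r lerDl.
pose I1 := \int[coin]_u g (F1 (x, u)); pose I2 := \int[coin]_u g (F2 (x, u)).
have I10 : 0 <= I1 by exact: integral_ge0.
have I20 : 0 <= I2 by exact: integral_ge0.
transitivity ((r1 x + r2 x)%:E * ((p x)%:E * I1 + (1 - p x)%:E * I2)); last first.
  rewrite -(integral_coin_choice p01 (measurable_sample x mF1 mg)
    (measurable_sample x mF2 mg))//.
  by congr (_ * _); apply: eq_integral => u _; rewrite /F/=; case: ifP.
have p1 : (0 <= 1 - p x)%R by case/andP: p01 => _; rewrite subr_ge0.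
have p0 : (0 <= p x)%R by case/andP: p01.
rewrite -/I1 -/I2; clearbody I1 I2.
have pI1 : 0 <= (p x)%:E * I1 by rewrite mule_ge0.
have pI2 : 0 <= (1 - p x)%:E * I2 by rewrite mule_ge0.
rewrite ge0_muleDr// !muleA -!EFinM.
rewrite (_ : (_ * p x)%R = r1 x); last first.
  rewrite /p mulrC; have [e|r0] := eqVneq (r1 x + r2 x)%R 0%R; last by rewrite divfK.
  by rewrite e mulr0; have := r10 x; have := r20 x; lra.
rewrite (_ : (_ * (1 - p x))%R = r2 x)//.
rewrite mulrBr mulr1 /p; have [e|r0] := eqVneq (r1 x + r2 x)%R 0%R.
  by rewrite e mul0r subr0; have := r10 x; have := r20 x; lra.
by rewrite mulrC divfK//; lra.
Qed.

Lemma simulable_scale (a : state -> R) A : measurable_fun [set: state] a ->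
  (forall x, 0 <= a x)%R -> simulable A -> simulable (fun g x => (a x)%:E * A g x).
Proof.
move=> ma a0 [r [F [mr r0 mF E]]]; exists (fun x => a x * r x)%R, F; split=> //.
- exact: measurable_funM.
- by move=> x; rewrite mulr_ge0.
- by move=> g mg g0 x; rewrite E// EFinM muleA.
Qed.

Lemma simulable_move (f : state -> state) : measurable_fun [set: state] f ->
  simulable (fun g x => g (f x)).
Proof.
move=> mf; exists (fun=> 1%R), (fun z => f z.1); split=> //; first exact: measurableT_comp.
move=> g mg g0 x; rewrite mul1e [RHS](_ : _ = \int[coin]_u cst (g (f x)) u)//.
by rewrite integral_cst// [X in _ * X]probability_setT mule1.
Qed.

Lemma simulable0 : simulable (fun _ _ => 0).
Proof.
exists (fun=> 0%R), fst; split=> //.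
by move=> g mg g0 x; rewrite mul0e.
Qed.

Lemma simulable_sum (I : Type) (s : seq I) (P : pred I) A :
  (forall i, P i -> simulable (A i)) ->
  simulable (fun g x => \sum_(i <- s | P i) A i g x).
Proof.
move=> sA; elim: s => [|i s IH].
  rewrite (_ : (fun _ => _) = fun _ _ => 0); first exact: simulable0.
  by apply/funext => g; apply/funext => x; rewrite big_nil.
case Pi : (P i).
  rewrite (_ : (fun _ => _) = fun g x => A i g x + \sum_(j <- s | P j) A j g x).
    by apply: simulable_add => //; exact: sA.
  by apply/funext => g; apply/funext => x; rewrite big_cons Pi.
rewrite (_ : (fun _ => _) = fun g x => \sum_(j <- s | P j) A j g x)//.
by apply/funext => g; apply/funext => x; rewrite big_cons Pi.
Qed.

(** The number of possible departures depends on the length of the list; the samplers for the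
    various lengths are glued along the measurable pieces of constant length. *)
Lemma simulable_by_size (A : nat -> (state -> \bar R) -> state -> \bar R) :
  (forall l, simulable (A l)) -> simulable (fun g x => A (size x.1) g x).
Proof.
move=> /choice[r /choice[F sA]].
exists (fun x => r (size x.1) x), (fun z => F (size z.1.1) z); split.
- apply: measurable_from_state => l m.
  have [mr _ _ _] := sA l.
  rewrite (_ : (fun s => _) = fun s : l.-tuple R => r l (tval s, m)); last first.
    by apply/funext => s; rewrite /= size_tuple.
  apply: (measurableT_comp mr).
  apply: (@measurable_to_state _ _ _ _ (fun s : l.-tuple R => tval s) l) => [s|j _].
    by rewrite size_tuple.
  exact: measurable_nth_tuple.
- by move=> x; have [_ ->] := sA (size x.1).
- apply: measurable_state_prod => l m.
  have [_ _ mF _] := sA l.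
  rewrite (_ : (fun p => _) = fun p : l.-tuple R * coins => F l ((tval p.1, m), p.2)); last first.
    by apply/funext => s; rewrite /= size_tuple.
  apply: (measurableT_comp mF); apply: measurable_fun_pair => //.
  apply: (@measurable_to_state _ _ _ _ (fun p : l.-tuple R * coins => tval p.1) l) => [s|j _].
    by rewrite size_tuple.
  exact: (measurableT_comp (@measurable_nth_tuple _ l j) measurable_fst).
- by move=> g mg g0 x; have [_ _ _ ->] := sA (size x.1).
Qed.

Lemma simulable_arrival (law : probability (measurableTypeR R) R) :
  law `]0%R, 1%R]%classic = 1 ->
  simulable (fun g x => \int[law]_v g (rcons x.1 v, x.2)).
Proof.
move=> law01.
have mS := measurable_sampler law01.
exists (fun=> 1%R), (fun z : state * coins => (rcons z.1.1 (sampler law z.2 : R), z.1.2) : state).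
split=> //.
  apply: (@measurableT_comp _ _ _ _ _ _ _ _ (fun z : state * coins => (z.1, sampler law z.2 : R)) (@measurable_rcons R N)).
  by apply: measurable_fun_pair => //; exact: (measurableT_comp mS).
move=> g mg g0 x; rewrite mul1e.
have mgx : measurable_fun [set: measurableTypeR R] (fun v : R => g (rcons x.1 v, x.2)).
  apply: (measurableT_comp mg).
  apply: (@measurableT_comp _ _ _ _ _ _ _ _ (fun v : measurableTypeR R => (x, v : R)) (@measurable_rcons R N)).
  exact: measurable_fun_pair.
rewrite -(ge0_integral_mpush coin mS mgx)//.
apply: eq_measure_integral => B mB _; apply/esym; exact: sampler_law.
Qed.

Section simulable_theory.
Variable A : (state -> \bar R) -> state -> \bar R.
Hypothesis sA : simulable A.

Lemma simulable_ge0 g x : measurable_fun [set: state] g -> (forall y, 0 <= g y) ->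
  0 <= A g x.
Proof.
move=> mg g0; have [r [F [_ r0 _ ->//]]] := sA.
by rewrite mule_ge0 ?lee_fin// integral_ge0.
Qed.

Lemma simulableD g h x : measurable_fun [set: state] g -> (forall y, 0 <= g y) ->
  measurable_fun [set: state] h -> (forall y, 0 <= h y) ->
  A (fun y => g y + h y) x = A g x + A h x.
Proof.
move=> mg g0 mh h0; have [r [F [_ r0 mF E]]] := sA.
rewrite !E//; [|exact: emeasurable_funD|by move=> y; rewrite adde_ge0].
have mg' := measurable_sample x mF mg; have mh' := measurable_sample x mF mh.
rewrite ge0_integralD//.
have : 0 <= \int[coin]_u g (F (x, u)) by exact: integral_ge0.
have : 0 <= \int[coin]_u h (F (x, u)) by exact: integral_ge0.
move: (\int[coin]_u g _) (\int[coin]_u h _) => a b b0 a0.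
by rewrite ge0_muleDr.
Qed.

Lemma simulableZ c g x : (0 <= c)%R -> measurable_fun [set: state] g ->
  (forall y, 0 <= g y) -> A (fun y => c%:E * g y) x = c%:E * A g x.
Proof.
move=> c0 mg g0; have [r [F [_ r0 mF E]]] := sA.
rewrite !E//; [|exact: emeasurable_funM|by move=> y; rewrite mule_ge0].
have mg' := measurable_sample x mF mg.
rewrite ge0_integralZl//.
by move: (\int[coin]_u _) => a; rewrite !muleA (muleC c%:E).
Qed.

Lemma simulable_le g h x : measurable_fun [set: state] g -> (forall y, 0 <= g y) ->
  measurable_fun [set: state] h -> (forall y, g y <= h y) -> A g x <= A h x.
Proof.
move=> mg g0 mh gh; have [r [F [_ r0 mF E]]] := sA.
have h0 y : 0 <= h y by exact: le_trans (g0 y) (gh y).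
by rewrite !E// lee_wpmul2l ?lee_fin//; apply: integral_le.
Qed.

Lemma simulable_cst_fin x : A (cst 1) x \is a fin_num.
Proof.
have [r [F [_ r0 mF ->//]]] := sA.
by rewrite integral_cst// [X in _ * (_ * X)]probability_setT !mule1.
Qed.

End simulable_theory.

Section foster_simulable.
Variable A : (state -> \bar R) -> state -> \bar R.
Hypothesis sA : simulable A.
Variable rate : state -> set state -> R.
Hypothesis rateE : forall x B, measurable B ->
  rate x B = fine (A (fun y => (\1_B y)%:E) x).

Lemma rate_simulation : exists r F, [/\ simulates r F A,
  forall x, rate x setT = r x &
  forall x B, measurable B -> rate x B = (r x * fine (coin [set u | B (F (x, u))]))%R].
Proof.
have [r [F sim]] := sA; exists r, F; have [mr r0 mF E] := sim; split=> // [x|x B mB].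
  rewrite rateE// (_ : (fun y => _) = cst 1); last first.
    by apply/funext => y; rewrite indicE in_setT.
  by rewrite E// integral_cst// [X in _ * (_ * X)]probability_setT !mule1.
rewrite rateE// E; [|exact: measurable_eindic|by move=> y; rewrite lee_fin].
have mBF : measurable [set u | B (F (x, u))].
  apply: (preimage_measurable (f := fun u => F (x, u))) => //.
  by apply: (measurableT_comp mF); exact: measurable_fun_pair.
rewrite (_ : \int[coin]_u _ = coin [set u | B (F (x, u))]).
  by rewrite fineM// fin_num_measure.
rewrite -[X in coin X]setIT -[RHS](@integral_indic _ _ _ coin setT)//.
Qed.

Variable x0 : state.
Hypothesis mx0 : measurable [set x0].
Variable V : state -> \bar R.
Hypothesis mV : measurable_fun [set: state] V.
Hypothesis V_ge0 : forall x, 0 <= V x.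

(** The drift condition of [foster] is multiplied by the rate, which replaces the mean over the next
    state by the operator [A]. Where [V] is infinite the condition is automatic. *)
Lemma simulable_foster :
  (forall x, x <> x0 -> V x < +oo ->
     (0 < rate x setT)%R /\
     (1 + rate x setT)%:E + A V x <= (rate x setT)%:E * V x) ->
  A V x0 < +oo -> (rate x0 [set x0] < rate x0 setT)%R ->
  positive_recurrent rate x0.
Proof.
move=> drift start leave.
have [r [F [[mr r0 mF E] rT rE]]] := rate_simulation.
have r0x0 : (0 < r x0)%R.
  by rewrite -rT; apply: le_lt_trans leave; rewrite rE// mulr_ge0 ?fine_ge0.
apply: (@foster _ _ r F mr r0 mF x0 mx0 V) => //.
- move=> x xx0; have [Voo|] := ltP (V x) +oo; last by rewrite leye_eq => /eqP ->; rewrite leey.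
  have [] := drift x xx0 Voo; rewrite rT => rx; rewrite E// => h.
  have rV : 0 <= (r x)^-1%:E by rewrite lee_fin invr_ge0.
  have : 0 <= \int[coin]_u V (F (x, u)) by exact: integral_ge0.
  move: h; move: (\int[coin]_u V _) => I h I0.
  have := lee_wpmul2l rV h; rewrite ge0_muleDr ?lee_fin ?addr_ge0 ?mule_ge0 ?lee_fin//.
  by rewrite !muleA -!EFinM mulVf ?gt_eqF// !mul1e mulrDr mulr1 mulVf ?gt_eqF.
- have : 0 <= \int[coin]_u V (F (x0, u)) by exact: integral_ge0.
  move: start; rewrite E//; move: (\int[coin]_u V _) => [I _ _|h _|//].
    by rewrite ltry.
  by move: h; rewrite mulry gtr0_sg// mul1e ltxx.
- have mE : measurable [set u | F (x0, u) = x0].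
    apply: (preimage_measurable (f := fun u => F (x0, u)) (A := [set x0])) => //.
    by apply: (measurableT_comp mF); exact: measurable_fun_pair.
  move: leave; rewrite rT rE// -[ltRHS]mulr1 ltr_pM2l// => h.
  by rewrite -[X in X < _]fineK ?fin_num_measure// lte_fin.
Qed.

End foster_simulable.

End simulable.

(** * Foster's criterion with a correction on short lists *)

Section lyapunov.
Context {R : realType} {N : nat}.
Local Notation state := (state R N).
Local Open Scope ereal_scope.

Variable A : (state -> \bar R) -> state -> \bar R.
Hypothesis sA : simulable A.
Variable rate : state -> set state -> R.
Hypothesis rateE : forall x B, measurable B ->
  rate x B = fine (A (fun y => (\1_B y)%:E) x).
Variable x0 : state.
Hypothesis mx0 : measurable [set x0].
Hypothesis valid_x0 : valid_jobs x0.1.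
Variables (v : state -> R) (d : state -> nat).
Hypothesis mv : measurable_fun [set: state] v.
Hypothesis v_ge0 : forall x, (0 <= v x)%R.
Hypothesis md : forall B : set nat, measurable [set x | B (d x)].

(* Illegal requirements are made unreachable by giving them an infinite value. *)
Definition on_valid (f : state -> R) (x : state) : \bar R :=
  if valid_jobs x.1 then (f x)%:E else +oo.

Lemma measurable_valid : measurable_fun [set: state] (fun x => valid_jobs x.1).
Proof.
apply: (measurable_pattern_fun (K := 0)) => x y xy.
by rewrite !(valid_jobs_pattern 0); case: xy => ->.
Qed.

Lemma measurable_on_valid f : measurable_fun [set: state] f ->
  measurable_fun [set: state] (on_valid f).
Proof.
move=> mf; apply: measurable_fun_ifT => //; first exact: measurable_valid.
exact/measurable_EFinP.
Qed.

Lemma on_valid_ge0 f x : (forall x, (0 <= f x)%R) -> 0 <= on_valid f x.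
Proof. by move=> f0; rewrite /on_valid; case: ifP => // _; rewrite lee_fin. Qed.

Variables (rmax C eps r0 : R) (D : nat -> nat).
Hypotheses (eps_gt0 : (0 < eps)%R) (r0_gt0 : (0 < r0)%R) (C_ge0 : (0 <= C)%R).
Hypothesis total_le : forall x, valid_jobs x.1 -> A (cst 1) x <= rmax%:E.
Hypothesis v_drift : forall x, valid_jobs x.1 ->
  A (on_valid v) x <= (rate x setT * v x + C - eps * (size x.1)%:R)%:E.
Hypothesis d_decrease : forall x, valid_jobs x.1 -> x <> x0 ->
  r0%:E <= A (fun y => (\1_[set y | (d y < d x)%N] y)%:E) x.
Hypothesis d_le : forall x n, valid_jobs x.1 -> (size x.1 <= n)%N -> (d x <= D n)%N.
Hypothesis leave : (rate x0 [set x0] < rate x0 setT)%R.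

(** The drift of [v] is surely negative only on long lists. The term [kappa * e], with
    [e = 1 - rho ^+ d], is bounded and takes over on short ones: a decrease of [d] lowers [e] by at
    least rho^(d-1) - rho^d, whereas any other transition, even to a state of very large [d], raises
    it by at most rho^d. For small [rho] the former prevails, since [d] decreases at rate at least
    [r0]. *)
Theorem lyapunov_recurrent : positive_recurrent rate x0.
Proof.
have r_ge0 x : (0 <= rate x setT)%R.
  rewrite rateE// fine_ge0// simulable_ge0//; exact: measurable_eindic.
have rE x : A (cst 1) x = (rate x setT)%:E.
  rewrite rateE// (_ : (fun y => _) = cst 1); last first.
    by apply/funext => y; rewrite indicE in_setT.
  by rewrite fineK// simulable_cst_fin.
have r_le x : valid_jobs x.1 -> (rate x setT <= rmax)%R.
  by move=> vx; rewrite -lee_fin -rE total_le.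
have rmax_ge0 : (0 <= rmax)%R by exact: le_trans (r_ge0 x0) (r_le _ valid_x0).
(* Chosen so that [rmax * rho <= r0 / 2]: the rises of [e], at total rate at most [rmax], cancel at
   most half of the gain. *)
pose rho := (r0 / (2 * (rmax + r0)))%R.
have rr_gt0 : (0 < rmax + r0)%R by rewrite ltr_wpDl.
have rho_gt0 : (0 < rho)%R by rewrite divr_gt0// mulr_gt0.
have rho_r : (rmax * rho <= r0 / 2)%R.
  rewrite /rho mulrA ler_pdivrMr ?mulr_gt0//.
  have : (0 <= r0 * r0)%R by rewrite mulr_ge0// ltW.
  by lra.
have rho_le1 : (rho <= 1)%R.
  by rewrite ler_pdivrMr ?mulr_gt0// mul1r; lra.
pose e (x : state) : R := (1 - rho ^+ d x)%R.
have e01 x : (0 <= e x <= 1)%R.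
  rewrite subr_ge0 exprn_ile1 ?(ltW rho_gt0)//=.
  by rewrite gerBl exprn_ge0// ltW.
have me : measurable_fun [set: state] e.
  move=> _ B mB; rewrite setTI.
  exact: (md [set n | B (1 - rho ^+ n)%R]).
have [n0 hn0] : exists n0 : nat, (C + 1 <= eps * n0%:R)%R.
  exists (Num.trunc ((C + 1) / eps)).+1.
  by rewrite -ler_pdivrMl// mulrC ltW// truncnS_gt.
(* On lists of length at most [n0] one has [d <= D n0], so this factor brings the drift of
   [kappa * e] down to -(C + 1), which offsets [C] with one unit to spare. On longer lists [hn0]
   gives the same margin. *)
pose kappa := (2 * (C + 1) / (r0 * rho ^+ D n0))%R.
have kappa_ge0 : (0 <= kappa)%R.
  by rewrite divr_ge0// ?mulr_ge0 ?addr_ge0// ?exprn_ge0// ltW.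
(* The combined drift is at most -1; scaling by [M] brings it below minus 1 plus the rate, as
   [simulable_foster] requires. *)
pose M := (1 + rmax)%R.
have M_ge0 : (0 <= M)%R by rewrite addr_ge0.
pose V x := M%:E * (on_valid v x + kappa%:E * (e x)%:E).
have mV' : measurable_fun [set: state] (on_valid v) by exact: measurable_on_valid.
have meE : measurable_fun [set: state] (fun x => (e x)%:E) by exact/measurable_EFinP.
have e0 x : 0 <= (e x)%:E by rewrite lee_fin; case/andP: (e01 x).
have mke : measurable_fun [set: state] (fun x => kappa%:E * (e x)%:E) by exact: emeasurable_funM.
have ke0 x : 0 <= kappa%:E * (e x)%:E by rewrite mule_ge0.
have v0 x : 0 <= on_valid v x by exact: on_valid_ge0.
have AVE x : A V x = M%:E * (A (on_valid v) x + kappa%:E * A (fun y => (e y)%:E) x).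
  rewrite /V (simulableZ sA) //; last 2 first.
  - exact: emeasurable_funD.
  - by move=> y; rewrite adde_ge0.
  by rewrite (simulableD sA)// (simulableZ sA).
have Ae_le x : A (fun y => (e y)%:E) x <= (rate x setT)%:E.
  by rewrite -rE; apply: simulable_le => // y; rewrite lee_fin; case/andP: (e01 y).
have Ae_fin x : exists2 ae : R, A (fun y => (e y)%:E) x = ae%:E & (ae <= rate x setT)%R.
  have := Ae_le x; have : 0 <= A (fun y => (e y)%:E) x by exact: simulable_ge0.
  by case: (A _ x) => // ae _; rewrite lee_fin; exists ae.
have Av_fin x : valid_jobs x.1 -> exists2 av : R, A (on_valid v) x = av%:E &
    (av <= rate x setT * v x + C - eps * (size x.1)%:R)%R.
  move=> /v_drift; have : 0 <= A (on_valid v) x by exact: simulable_ge0.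
  by case: (A _ x) => // av _; rewrite lee_fin; exists av.
apply: (simulable_foster sA rateE mx0 (V := V)) => //.
- exact: emeasurable_funM (emeasurable_funD mV' mke).
- by move=> x; rewrite mule_ge0// adde_ge0.
- move=> x xx0 Voo.
  have vx : valid_jobs x.1.
    apply: contraTT Voo => vx; rewrite /V /on_valid (negbTE vx) -leNgt.
    by rewrite addye// mulry gtr0_sg ?mul1e// /M ltr_wpDr.
  have dec := d_decrease vx xx0.
  pose Idec y : R := \1_[set y | (d y < d x)%N] y.
  have mI : measurable_fun [set: state] (fun y => (Idec y)%:E : \bar R).
    by apply: measurable_eindic => //; exact: (md [set n | (n < d x)%N]).
  have I0 y : 0 <= (Idec y)%:E by rewrite lee_fin.
  have Idec_le : A (fun y => (Idec y)%:E) x <= (rate x setT)%:E.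
    rewrite -rE; apply: simulable_le => // y.
    by rewrite lee_fin /Idec indicE; case: (_ \in _).
  have [ai aiE r0ai] : exists2 ai : R, A (fun y => (Idec y)%:E) x = ai%:E & (r0 <= ai)%R.
    move: dec Idec_le; rewrite -/Idec; case: (A _ x) => // ai; rewrite !lee_fin.
    by exists ai.
  have r_gt0 : (0 < rate x setT)%R.
    by apply: lt_le_trans r0_gt0 _; rewrite (le_trans r0ai)// -lee_fin -aiE.
  split=> //.
  have d_gt0 : (0 < d x)%N.
    rewrite lt0n; apply/eqP => dx0.
    have : A (fun y => (Idec y)%:E) x <= A (cst 0) x.
      apply: simulable_le => // y; rewrite /Idec indicE lee_fin.
      by rewrite (_ : _ \in _ = false)//; apply/negbTE/negP; rewrite inE/= dx0.
    have [r' [F [_ _ _ E]]] := sA.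
    rewrite aiE E// integral0 mule0 lee_fin leNgt => /negP; apply.
    exact: lt_le_trans r0ai.
  have [ae aeE ae_r] := Ae_fin x; have [av avE av_le] := Av_fin x vx.
  have key : (ae + rho ^+ (d x).-1 * ai <= rate x setT)%R.
    rewrite -lee_fin EFinD EFinM -aeE -aiE -rE -(simulableZ sA)//; last first.
      by rewrite exprn_ge0// ltW.
    have mrI : measurable_fun [set: state] (fun y => (rho ^+ (d x).-1)%:E * (Idec y)%:E).
      exact: emeasurable_funM.
    have rI0 y : 0 <= (rho ^+ (d x).-1)%:E * (Idec y)%:E.
      by rewrite mule_ge0// lee_fin exprn_ge0// ltW.
    rewrite -(simulableD sA)//; apply: simulable_le => //.
    + exact: emeasurable_funD.
    + by move=> y; rewrite adde_ge0.
    move=> y; rewrite -EFinM -EFinD lee_fin /Idec indicE.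
    case: (boolP (y \in _)) => [|_]; last by rewrite mulr0 addr0; case/andP: (e01 y).
    rewrite inE/= => dyx; rewrite mulr1 /e -addrA gerDl addrC subr_le0.
    by apply: ler_wiXn2l; [exact: ltW| |rewrite -ltnS prednK].
  have Vx : V x = (M * (v x + kappa * e x))%:E by rewrite /V /on_valid vx.
  rewrite AVE avE aeE Vx -!EFinM -!EFinD lee_fin.
  set r := rate x setT in r_gt0 ae_r av_le key *.
  have rr := r_le x vx; rewrite -/r in rr.
  pose q := (rho ^+ (d x).-1)%R.
  have q_gt0 : (0 < q)%R by rewrite exprn_gt0.
  have eE : e x = (1 - rho * q)%R by rewrite /e /q -exprS prednK.
  have h1 : (kappa * (ae - r * e x) <= - (kappa * q * r0 / 2))%R.
    have : (ae - r * e x <= - (q * r0 / 2))%R.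
      have : (q * r0 <= q * ai)%R by rewrite ler_pM2l.
      have : (r * rho * q <= r0 / 2 * q)%R.
        by rewrite ler_pM2r//; apply: le_trans rho_r; rewrite ler_pM2r.
      by rewrite eE; move: key; rewrite -/q; lra.
    by move=> /(ler_wpM2l kappa_ge0); lra.
  have h2 : (1 + C - eps * (size x.1)%:R - kappa * q * r0 / 2 <= 0)%R.
    have [ns|sn] := leqP n0 (size x.1).
      have : (eps * n0%:R <= eps * (size x.1)%:R)%R by rewrite ler_pM2l// ler_nat.
      have : (0 <= kappa * q * r0)%R by exact: (mulr_ge0 (mulr_ge0 kappa_ge0 (ltW q_gt0)) (ltW r0_gt0)).
      lra.
    have : (0 <= eps * (size x.1)%:R)%R by rewrite mulr_ge0// ltW.
    have : (C + 1 <= kappa * q * r0 / 2)%R.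
      have qD : (rho ^+ D n0 <= q)%R.
        apply: ler_wiXn2l => //; first exact: ltW.
        by apply: leq_trans (leq_pred _) _; apply: d_le => //; exact: ltnW.
      have -> : (C + 1 = kappa * rho ^+ D n0 * r0 / 2)%R.
        rewrite /kappa; field; rewrite ?gt_eqF ?exprn_gt0//.
      by rewrite ler_pM2r ?invr_gt0// ler_pM2r// ler_wpM2l.
    lra.
  have h3 : (1 + r <= M)%R by rewrite /M lerD2l.
  have h4 : (av + kappa * ae <= r * (v x + kappa * e x) - 1)%R by lra.
  have := ler_wpM2l M_ge0 h4.
  by lra.
- have [ae aeE _] := Ae_fin x0; have [av avE _] := Av_fin x0 valid_x0.
  rewrite AVE avE aeE; exact: (ltry (M * (av + kappa * ae))%R).
Qed.

End lyapunov.

(** * Mixtures of 2-bucket options *)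

Section two_bucket.

Lemma two_bucket_double L k j : (1 <= k <= 2 ^ L)%N ->
  two_bucket L.+1 k j = (2 * two_bucket L k j)%N.
Proof.
move=> /andP[k1 kL]; rewrite /two_bucket.
have lL : (up_log 2 k <= L)%N by rewrite -(up_expnK L (isT : 1 < 2)%N) leq_up_log.
by rewrite subSn// expnS; case: ifP => _; rewrite mulnCA.
Qed.

Lemma two_bucket_high L k j : (2 ^ L < k < 2 ^ L.+1)%N ->
  two_bucket L.+1 k j = ((j == k) || (j == 2 ^ L.+1 - k))%N.
Proof.
move=> /andP[kL kL1]; rewrite /two_bucket.
have -> : up_log 2 k = L.+1 by apply: up_log_eq => //; rewrite kL ltnW.
by rewrite ltn_eqF// subnn expn0 muln1.
Qed.

Lemma two_bucket_top L j : two_bucket L (2 ^ L) j = (j == 2 ^ L)%N.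
Proof. by rewrite /two_bucket up_expnK// eqxx subnn expn0 muln1. Qed.

Lemma two_bucket_out L k j : (1 <= k <= 2 ^ L)%N -> (2 ^ L < j)%N ->
  two_bucket L k j = 0%N.
Proof.
move=> /andP[k1 kL] jL; rewrite /two_bucket.
have lL : (2 ^ up_log 2 k <= 2 ^ L)%N.
  by rewrite leq_exp2l// -(up_expnK L (isT : 1 < 2)%N) leq_up_log.
have -> : (j == k) = false by apply/negbTE; rewrite neq_ltn; apply/orP; right; lia.
have -> : (j == 2 ^ up_log 2 k - k)%N = false by apply/negbTE; lia.
by case: ifP.
Qed.

Lemma two_bucket_self L k : (1 <= k <= 2 ^ L)%N -> (0 < two_bucket L k k)%N.
Proof. by rewrite /two_bucket eqxx/=; case: ifP; rewrite mul1n expn_gt0. Qed.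

Section decomposition.
Context {R : realFieldType}.

Lemma sum_nat_single m n k0 (F : nat -> R) : (m <= k0 < n)%N ->
  (forall k, (m <= k < n)%N -> k != k0 -> F k = 0) ->
  \sum_(m <= k < n) F k = F k0.
Proof.
move=> k0mn F0; rewrite (bigD1_seq k0) ?mem_index_iota ?iota_uniq//=.
rewrite big_seq_cond big1 ?addr0// => k; rewrite mem_index_iota => /andP[h1 h2].
exact: F0.
Qed.

(** Every 2-bucket option fills the capacity exactly, which forces the total weight and gives the
    second conclusion. Monotonicity is only asked below 2^L because in the induction the load [b K]
    of the last type, which has no partner, need not lie below the others. *)
Lemma two_bucket_exact L (a : nat -> R) :
  (forall k, (1 <= k <= 2 ^ L)%N -> 0 <= a k) ->
  (forall i j, (1 <= i <= j)%N -> (j < 2 ^ L)%N -> a j <= a i) ->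
  exists th : nat -> R,
    [/\ forall k, (1 <= k <= 2 ^ L)%N -> 0 <= th k,
        (\sum_(1 <= k < (2 ^ L).+1) th k) * (2 ^ L)%:R =
          \sum_(1 <= k < (2 ^ L).+1) k%:R * a k &
        forall j, (1 <= j <= 2 ^ L)%N ->
          \sum_(1 <= k < (2 ^ L).+1) th k * (two_bucket L k j)%:R = a j].
Proof.
elim: L a => [|L IH] a a0 amon.
  exists a; split=> //; first by rewrite expn0 !big_nat1 mulrC.
  move=> j; rewrite expn0 big_nat1 => j1; have -> : j = 1%N by lia.
  by rewrite (two_bucket_top 0) mulr1.
set K := (2 ^ L)%N.
have K0 : (0 < K)%N by rewrite expn_gt0.
have K2 : (2 ^ L.+1 = K + K)%N by rewrite expnS mul2n addnn.
rewrite K2 in a0 amon *.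
(* Each option M_k with K < k < 2K gets weight [a k] and serves type 2K - k at that rate too, which
   leaves the difference of [a j] and [a (K + K - j)] for a type j < K. The halving compensates the
   factor 2 of [two_bucket_double]. *)
pose b j := (if j == K then a K else a j - a (K + K - j)%N) / 2.
have [k k1K|i j ij jK|th' [th0 thsum thE]] := IH b.
- rewrite /b; case: eqP => [_|kK].
    by rewrite divr_ge0// a0//; lia.
  by rewrite divr_ge0// subr_ge0 amon//; lia.
- rewrite /b !ltn_eqF//; last by lia.
  have h1 := amon i j ij; have h2 := amon (K + K - j)%N (K + K - i)%N.
  have {h1}h1 : a j <= a i by apply: h1; lia.
  have {h2}h2 : a (K + K - i)%N <= a (K + K - j)%N by apply: h2; lia.
  by rewrite ler_pM2r ?invr_gt0//; lra.
pose th k := if (k <= K)%N then th' k else a k.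
have lowE (G : nat -> R -> R) : \sum_(1 <= k < K.+1) G k (th k) =
    \sum_(1 <= k < K.+1) G k (th' k).
  by apply: eq_big_nat => k /andP[_ kK]; rewrite /th -ltnS kK.
have highE (G : nat -> R -> R) : \sum_(K.+1 <= k < K + K) G k (th k) =
    \sum_(K.+1 <= k < K + K) G k (a k).
  by apply: eq_big_nat => k /andP[kK _]; rewrite /th leqNgt kK.
have topE : th (K + K)%N = a (K + K)%N by rewrite /th ifN// -ltnNge; lia.
have split3 (F : nat -> R) : \sum_(1 <= k < (K + K).+1) F k =
    \sum_(1 <= k < K.+1) F k + \sum_(K.+1 <= k < K + K) F k + F (K + K)%N.
  rewrite big_nat_recr/=; last by lia.
  by rewrite (big_cat_nat (n := K.+1))//=; lia.
exists th; split.
- move=> k kK; rewrite /th; case: ifP => h; first by apply: th0; lia.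
  by apply: a0.
- rewrite !split3 (lowE (fun _ x => x)) (highE (fun _ x => x)) topE natrD.
  have rev : \sum_(1 <= j < K) j%:R * a (K + K - j)%N =
      \sum_(K.+1 <= k < K + K) (K + K - k)%:R * a k.
    rewrite -(add1n K) big_addn addnK big_nat_rev/=.
    apply: eq_big_nat => j /andP[j1 jK].
    by congr (_%:R * a _); lia.
  have bsum : \sum_(1 <= k < K.+1) k%:R * b k *+ 2 = \sum_(1 <= k < K.+1) k%:R * a k
      - \sum_(K.+1 <= k < K + K) (K + K - k)%:R * a k.
    rewrite -rev !big_nat_recr//= addrAC -sumrB; congr (_ + _).
      apply: eq_big_nat => j /andP[j1 jK].
      by rewrite /b ltn_eqF//; field.
    by rewrite /b eqxx; field.
  have hsum : \sum_(K.+1 <= k < K + K) (K + K - k)%:R * a k =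
    (K + K)%:R * \sum_(K.+1 <= k < K + K) a k - \sum_(K.+1 <= k < K + K) k%:R * a k.
    rewrite big_distrr/= -sumrB; apply: eq_big_nat => k /andP[_ kK].
    by rewrite natrB ?mulrBl//; lia.
  have := bsum; rewrite sumrMnl -thsum hsum natrD.
  rewrite -/K; move: (\sum_(1 <= k < K.+1) th' k) (\sum_(K.+1 <= k < K + K) a k)
    (\sum_(K.+1 <= k < K + K) k%:R * a k) (\sum_(1 <= k < K.+1) k%:R * a k).
  by move=> s1 s2 s3 s4; lra.
- move=> j jK; rewrite split3.
  rewrite (lowE (fun k x => x * (two_bucket L.+1 k j)%:R)).
  rewrite (highE (fun k x => x * (two_bucket L.+1 k j)%:R)) topE.
  rewrite -K2 two_bucket_top K2.
  rewrite (_ : \sum_(1 <= k < K.+1) _ =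
    2 * \sum_(1 <= k < K.+1) th' k * (two_bucket L k j)%:R); last first.
    rewrite big_distrr/=; apply: eq_big_nat => k kK.
    by rewrite two_bucket_double ?natrM 1?mulrCA//; lia.
  have high k : (K.+1 <= k < K + K)%N ->
      two_bucket L.+1 k j = ((j == k) || (j == K + K - k))%N :> nat.
    by move=> h; rewrite two_bucket_high ?K2//; rewrite -/K; lia.
  have [jK'|Kj] := leqP j K.
    rewrite thE; last by rewrite -/K; lia.
    rewrite (_ : (j == K + K)%N = false) ?mulr0 ?addr0; last by lia.
    rewrite /b; case: eqP => [jeqK|jneK].
      rewrite big_nat_cond big1 ?addr0; first by rewrite jeqK; field.
      move=> k; rewrite andbT => kK; rewrite high//.
      by rewrite (_ : (_ || _) = false) ?mulr0//; lia.
    rewrite (@sum_nat_single _ _ (K + K - j)%N); [|by lia|].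
      rewrite high; last by lia.
      rewrite (_ : (_ || _) = true); last by lia.
      by rewrite mulr1; field.
    move=> k kK kne; rewrite high//.
    by rewrite (_ : (_ || _) = false) ?mulr0//; lia.
  rewrite big_nat_cond big1 ?mulr0 ?add0r; last first.
    move=> k; rewrite andbT => kK; rewrite two_bucket_out ?mulr0//.
  have [je|jne] := eqVneq j (K + K)%N.
    rewrite mulr1 big_nat_cond big1 ?add0r ?je// => k; rewrite andbT -je => kK.
    by rewrite high; [rewrite (_ : (_ || _) = false) ?mulr0//; lia|lia].
  rewrite mulr0 addr0 (@sum_nat_single _ _ j); [|by lia|].
    by rewrite high ?eqxx ?mulr1//; lia.
  move=> k kK kne; rewrite high//.
  by rewrite (_ : (_ || _) = false) ?mulr0//; lia.
Qed.

(** Raising every load by [delta] keeps the total weight below 1, and the missing weight is spread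
    evenly over the options. This also makes every weight positive, so that the modulating process
    can afford a long stay in each option. *)
Lemma two_bucket_decomposition L (a : nat -> R) :
  (forall k, (1 <= k <= 2 ^ L)%N -> 0 <= a k) ->
  (forall i j, (1 <= i <= j)%N -> (j <= 2 ^ L)%N -> a j <= a i) ->
  \sum_(1 <= k < (2 ^ L).+1) k%:R * a k < (2 ^ L)%:R ->
  exists (th : nat -> R) (eps : R),
    [/\ forall k, (1 <= k <= 2 ^ L)%N -> 0 < th k,
        \sum_(1 <= k < (2 ^ L).+1) th k = 1, 0 < eps &
        forall j, (1 <= j <= 2 ^ L)%N ->
          a j + eps <= \sum_(1 <= k < (2 ^ L).+1) th k * (two_bucket L k j)%:R].
Proof.
set K := (2 ^ L)%N => a0 amon asum.
have K0 : (0 < K)%N by rewrite expn_gt0.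
have K0r : 0 < K%:R :> R by rewrite ltr0n.
pose S : R := \sum_(1 <= k < K.+1) k%:R.
have S0 : 0 <= S by rewrite sumr_ge0.
(* The raise adds [S * delta] to the sum of the [k * a k], less than the available slack. *)
pose delta := (K%:R - \sum_(1 <= k < K.+1) k%:R * a k) / (2 * (S + 1)).
have S1 : 0 < 2 * (S + 1) by rewrite mulr_gt0// ltr_wpDl.
have delta0 : 0 < delta by rewrite divr_gt0// subr_gt0.
have [k kK|i j ij jK|th [th0 thsum thE]] := @two_bucket_exact L (fun k => a k + delta).
- by rewrite addr_ge0 ?a0// ltW.
- by rewrite lerD2r amon// ltnW.
pose sg := \sum_(1 <= k < K.+1) th k.
have sg1 : sg < 1.
  rewrite -(ltr_pM2r K0r) mul1r thsum.
  under eq_bigr do rewrite mulrDr.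
  rewrite big_split/= -mulr_suml -/S.
  have : S * delta < K%:R - \sum_(1 <= k < K.+1) k%:R * a k.
    rewrite /delta mulrCA gtr_pMr ?subr_gt0// ltr_pdivrMr// mul1r; lra.
  by rewrite -/K; lra.
exists (fun k => th k + (1 - sg) / K%:R), delta; split=> //.
- move=> k kK; rewrite ltr_wpDl ?th0// divr_gt0// subr_gt0//.
- rewrite big_split/= -/sg sumr_const_nat subSS subn0 -[_ / _ *+ _]mulr_natr divfK ?gt_eqF//.
  by rewrite addrC subrK.
- move=> j jK; rewrite -thE//; apply: ler_sum => k _.
  rewrite ler_wpM2r// lerDl divr_ge0// subr_ge0 ltW//.
Qed.

End decomposition.

End two_bucket.

(** * Job types *)

Section job_types.
Context {R : realType}.
Variable K : nat.
Hypothesis K_gt0 : (0 < K)%N.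

Lemma is_type_unique k j (v : R) : is_type K k v -> is_type K j v -> k = j.
Proof.
have K0 : 0 < K%:R :> R by rewrite ltr0n.
wlog kj : k j / (k < j)%N => [H|].
  by move=> tk tj; case: (ltngtP k j) => // h; [exact: H|apply/esym; exact: H].
rewrite /is_type => /andP[_ vk] /andP[jv _].
have : (k%:R / K%:R : R) <= j.-1%:R / K%:R by rewrite ler_pM2r ?invr_gt0// ler_nat; lia.
by move=> h; exfalso; lra.
Qed.

Lemma is_type_exists (v : R) : 0 < v <= 1 ->
  exists2 k, (1 <= k <= K)%N & is_type K k v.
Proof.
have K0 : 0 < K%:R :> R by rewrite ltr0n.
move=> /andP[v0 v1].
have ex : exists k, v <= k%:R / K%:R by exists K; rewrite divff// gt_eqF.
have [k vk kmin] := ex_minnP ex; exists k.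
  apply/andP; split; last by apply: kmin; rewrite divff// gt_eqF.
  by case: k vk {kmin} => // ; rewrite mul0r leNgt v0.
rewrite /is_type vk andbT ltNge; apply/negP => /kmin.
case: k vk {kmin} => [|k _]; last by rewrite ltnn.
by rewrite mul0r leNgt v0.
Qed.

Lemma sum_is_type (v : R) : 0 < v <= 1 ->
  (\sum_(1 <= k < K.+1) is_type K k v = 1)%N.
Proof.
move=> /is_type_exists[k kK tk].
rewrite (bigD1_seq k) ?mem_index_iota ?iota_uniq//= tk big1 ?addn0// => j jk.
by case tj : (is_type K j v) => //; move: jk; rewrite (is_type_unique tk tj) eqxx.
Qed.

Lemma type_count_rcons (s : seq R) v k :
  type_count K (rcons s v) k = (type_count K s k + is_type K k v)%N.
Proof. by rewrite /type_count -cats1 count_cat/= addn0. Qed.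

Lemma type_count_remove (s : seq R) i k : (i < size s)%N ->
  (type_count K (remove_job i s) k + is_type K k s`_i)%N = type_count K s k.
Proof.
move=> si; rewrite /type_count /remove_job count_cat -[in RHS](cat_take_drop i s).
by rewrite count_cat (drop_nth 0 si)/=; lia.
Qed.

Lemma valid_rcons (s : seq R) v :
  valid_jobs (rcons s v) = (0 < v <= 1) && valid_jobs s.
Proof. by rewrite /valid_jobs all_rcons. Qed.

Lemma valid_remove (s : seq R) i : valid_jobs s -> valid_jobs (remove_job i s).
Proof.
rewrite /valid_jobs /remove_job -{1}(cat_take_drop i.+1 s) !all_cat => /andP[h ->].
rewrite andbT; apply/allP => x xs; apply: (allP h).
by move: xs; rewrite -(take_takel s (leqnSn i)) => /mem_take.
Qed.

Lemma valid_nth (s : seq R) i : valid_jobs s -> (i < size s)%N -> 0 < s`_i <= 1.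
Proof. by move=> /allP h si; apply: h; exact: mem_nth. Qed.

Lemma sum_type_count (s : seq R) : valid_jobs s ->
  (\sum_(1 <= k < K.+1) type_count K s k = size s)%N.
Proof.
elim/last_ind: s => [|s v IH]; first by rewrite big1.
rewrite valid_rcons => /andP[v01 vs]; under eq_bigr do rewrite type_count_rcons.
by rewrite big_split/= IH// sum_is_type// size_rcons addn1.
Qed.

Section quadratic.
Context {N : nat}.
Variable h : nat -> 'I_N.+1 -> R.
Hypothesis h_ge0 : forall k m, 0 <= h k m.

(** The shift [h] is 0 for MaxWeight and is the corrector attached to the modulating state for nMSR
    policies. *)
Definition shifted_count (x : state R N) (k : nat) : R :=
  (type_count K x.1 k)%:R + h k x.2.

Definition quad (x : state R N) : R :=
  \sum_(1 <= k < K.+1) shifted_count x k ^+ 2.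

Lemma shifted_count_ge0 x k : 0 <= shifted_count x k.
Proof. by rewrite addr_ge0. Qed.

Lemma quad_ge0 x : 0 <= quad x.
Proof. by rewrite sumr_ge0// => k _; rewrite exprn_ge0// shifted_count_ge0. Qed.

Lemma measurable_quad : measurable_fun [set: state R N] quad.
Proof.
apply: (measurable_pattern_fun (K := K)) => x y xy; apply: eq_big_nat => k kK.
by rewrite /shifted_count !type_count_pattern//; case: xy => -> ->.
Qed.

Lemma quad_rcons (s : seq R) m v :
  quad (rcons s v, m) = quad (s, m) +
    \sum_(1 <= k < K.+1) (is_type K k v)%:R * (2 * shifted_count (s, m) k + 1).
Proof.
rewrite /quad -big_split; apply: eq_bigr => k _.
rewrite /shifted_count/= type_count_rcons natrD.
by case: (is_type K k v) => /=; [rewrite mul1r|rewrite mul0r]; ring.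
Qed.

End quadratic.

Section arrivals.
Variable law : probability (measurableTypeR R) R.
Hypothesis law01 : law `]0, 1]%classic = 1%E.

Definition type_prob (k : nat) : R := fine (law [set v | is_type K k v]).

Lemma type_probE k : (type_prob k)%:E = law [set v | is_type K k v].
Proof. by rewrite fineK// fin_num_measure//; exact: measurable_is_type. Qed.

Lemma type_prob_ge0 k : 0 <= type_prob k.
Proof. by rewrite fine_ge0. Qed.

Lemma type_indicatorE k v : \1_[set v : R | is_type K k v] v = (is_type K k v)%:R :> R.
Proof. by rewrite indicE; congr (nat_of_bool _)%:R; apply/idP/idP; rewrite inE. Qed.

Lemma measurable_type_indicator k :
  measurable_fun [set: measurableTypeR R] (fun v => (is_type K k v)%:R : R).
Proof.
rewrite (_ : (fun v => _) = \1_[set v : R | is_type K k v]).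
  by apply: measurable_indic; exact: measurable_is_type.
by apply/funext => v; rewrite type_indicatorE.
Qed.

Local Open Scope ereal_scope.

Lemma integral_type_sum (c : nat -> R) : (forall k, (0 <= c k)%R) ->
  \int[law]_v (\sum_(1 <= k < K.+1) (is_type K k v)%:R * c k)%R%:E =
  (\sum_(1 <= k < K.+1) type_prob k * c k)%R%:E.
Proof.
move=> c0; under eq_integral do rewrite -sumEFin.
have mi k : measurable_fun [set: measurableTypeR R] (fun v => ((is_type K k v)%:R : R)%:E).
  by apply/measurable_EFinP; exact: measurable_type_indicator.
rewrite ge0_integral_sum//; last 2 first.
- move=> k; apply/measurable_EFinP; apply: measurable_funM => //.
  exact: measurable_type_indicator.
- by move=> k v _; rewrite lee_fin mulr_ge0.
rewrite -sumEFin; apply: eq_bigr => k _.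
under eq_integral do rewrite EFinM muleC.
rewrite ge0_integralZl//; last 1 first.
- by rewrite lee_fin.
rewrite EFinM muleC; congr (_ * _); rewrite type_probE.
rewrite -[X in law X]setIT -[RHS](@integral_indic _ _ _ law setT)//.
  by apply: eq_integral => v _; rewrite /= type_indicatorE.
exact: measurable_is_type.
Qed.

(** The law is carried by ]0, 1]. Elsewhere [f] may be infinite, as [on_valid] is; it is compared
    with the measurable [G], which equals [g] almost everywhere. *)
Lemma integral_valid (f : R -> \bar R) (g : R -> R) :
  measurable_fun [set: measurableTypeR R] (EFin \o g) ->
  (forall v, (0 <= g v)%R) -> (forall v, 0 <= f v) ->
  (forall v, (0 < v <= 1)%R -> f v <= (g v)%:E) ->
  \int[law]_v f v <= \int[law]_v (g v)%:E.
Proof.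
move=> mg g0 f0 fg.
pose D := `]0%R, 1%R]%classic : set (measurableTypeR R).
pose G v : \bar R := if (0 < v <= 1)%R then (g v)%:E else +oo.
apply: (@le_trans _ _ (\int[law]_v G v)).
  by apply: integral_le => v _ //; rewrite /G; case: ifP => [/fg//|_]; rewrite leey.
rewrite (_ : \int[law]_v G v = \int[law]_v (g v)%:E)//.
have mD : measurable D by exact: measurable_itv.
apply: ge0_ae_eq_integral => //.
- apply: measurable_fun_ifT => //.
  apply: (@measurable_fun_bool _ _ _ _ true); rewrite setTI.
  by rewrite (_ : _ @^-1` _ = D)//; apply/seteqP; split=> v /=; rewrite /D/= in_itv.
- by move=> v _; rewrite /G; case: ifP => // _; rewrite lee_fin.
- by move=> v _; rewrite lee_fin.
exists (~` D); split; first exact: measurableC.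
  by rewrite [LHS]probability_setC// law01 subee.
move=> v /= nv Dv; apply: nv => _; rewrite /G.
by move: Dv; rewrite /D/= in_itv/= => ->.
Qed.

Lemma integral_arrival_le N (f : state R N -> R) (s : seq R) m c0 (c : nat -> R) :
  valid_jobs s -> (forall x, (0 <= f x)%R) -> (0 <= c0)%R -> (forall k, (0 <= c k)%R) ->
  (forall v, (0 < v <= 1)%R -> (f (rcons s v, m) <=
     c0 + \sum_(1 <= k < K.+1) (is_type K k v)%:R * c k)%R) ->
  \int[law]_v on_valid f (rcons s v, m) <=
  (c0 + \sum_(1 <= k < K.+1) type_prob k * c k)%:E.
Proof.
move=> vs f0 c00 ck0 fc.
pose S (v : R) := (\sum_(1 <= k < K.+1) (is_type K k v)%:R * c k)%R.
have S0 v : (0 <= S v)%R by rewrite sumr_ge0// => k _; rewrite mulr_ge0.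
have mS : measurable_fun [set: measurableTypeR R] (EFin \o S).
  apply/measurable_EFinP; apply: measurable_sum => k; apply: measurable_funM => //.
  exact: measurable_type_indicator.
apply: (@le_trans _ _ (\int[law]_v (c0 + S v)%:E)).
  apply: integral_valid => //.
  - apply/measurable_EFinP; apply: measurable_funD => //; exact/measurable_EFinP.
  - by move=> v; rewrite addr_ge0.
  - by move=> v; exact: on_valid_ge0.
  by move=> v v01; rewrite /on_valid/= valid_rcons v01 vs lee_fin fc.
under eq_integral do rewrite EFinD.
rewrite ge0_integralD//; last by move=> v _; rewrite lee_fin.
by rewrite integral_type_sum// integral_cst// [X in _ * X]probability_setT mule1.
Qed.

Lemma sum_type_prob : (\sum_(1 <= k < K.+1) type_prob k <= 1)%R.
Proof.
rewrite -lee_fin.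
under eq_bigr do rewrite -[type_prob _]mulr1.
rewrite -(@integral_type_sum (fun=> 1%R))//.
apply: (@le_trans _ _ (\int[law]_v (cst 1 v)%:E)).
  apply: integral_valid => //; first exact/measurable_EFinP.
    by move=> v; rewrite lee_fin sumr_ge0// => k _; rewrite mulr_ge0.
  move=> v v01; rewrite lee_fin; under eq_bigr do rewrite mulr1.
  by rewrite -natr_sum sum_is_type.
by rewrite (_ : (fun v => _) = cst 1)// integral_cst// [X in _ * X]probability_setT mule1.
Qed.

End arrivals.

End job_types.

(** * MaxWeight *)

Lemma two_bucket_option L k : (1 <= k <= 2 ^ L)%N ->
  service_option (2 ^ L) (two_bucket L k).
Proof.
move=> /andP[k1 kL]; rewrite /service_option.
have lL : (up_log 2 k <= L)%N by rewrite -(up_expnK L (isT : 1 < 2)%N) leq_up_log.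
have kl : (k <= 2 ^ up_log 2 k)%N by exact: up_logP.
have eL : (2 ^ up_log 2 k * 2 ^ (L - up_log 2 k) = 2 ^ L)%N by rewrite -expnD subnKC.
have single c : (c <= 2 ^ L)%N -> (\sum_(1 <= j < (2 ^ L).+1) j * ((j == c) * 2 ^ (L - up_log 2 k)) <=
    c * 2 ^ (L - up_log 2 k))%N.
  move=> cL; case: (posnP c) => [->|c0].
    rewrite big_nat_cond big1// => j /andP[/andP[j1 _] _].
    by rewrite (_ : (j == 0)%N = false) ?muln0//; lia.
  rewrite (bigD1_seq c) ?mem_index_iota ?iota_uniq//= ?eqxx ?mul1n; last by lia.
  rewrite big1 ?addn0// => j /negbTE ->; by rewrite muln0.
rewrite /two_bucket; case: eqP => [kE|kE].
  apply: leq_trans (single k kL) _; by rewrite {1}kE eL.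
apply: (@leq_trans (\sum_(1 <= j < (2 ^ L).+1) (j * ((j == k) * 2 ^ (L - up_log 2 k)) +
   j * ((j == 2 ^ up_log 2 k - k)%N * 2 ^ (L - up_log 2 k))))).
  apply: leq_sum => j _; rewrite -mulnDr -mulnDl leq_mul2l leq_mul2r.
  by apply/orP; right; apply/orP; right; case: (j == k); case: (j == _).
rewrite big_split/= -{3}eL -[X in (_ <= X * _)%N](subnKC kl) mulnDl.
by apply: leq_add; apply: single => //; rewrite -eL; nia.
Qed.

Lemma two_bucket_le L k j : (two_bucket L k j <= 2 ^ L)%N.
Proof.
have h (b : bool) : (b * 2 ^ (L - up_log 2 k) <= 2 ^ L)%N.
  by case: b => //=; rewrite mul1n leq_exp2l// leq_subr.
by rewrite /two_bucket; case: ifP.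
Qed.

Lemma sum_bool_count n (P Q : pred nat) :
  (\sum_(i < n | P i) Q i = count (fun i => P i && Q i) (iota 0 n))%N.
Proof.
rewrite -sum1_count -[in RHS](subn0 n) -/(index_iota 0 n) big_mkord big_mkcondr/=.
by apply: eq_bigr => i _; case: (Q i).
Qed.

Section arrival_rate.
Context {R : realType} {N : nat}.
Variable law : probability (measurableTypeR R) R.

Lemma measurable_arrival_set (s : seq R) (m : 'I_N.+1) (B : set (state R N)) :
  measurable B -> measurable [set v : measurableTypeR R | B (rcons s v, m)].
Proof.
move=> mB; apply: (preimage_measurable (f := fun v : measurableTypeR R => (rcons s (v : R), m) : state R N)) => //.
apply: (@measurableT_comp _ _ _ _ _ _ _ _ (fun v : measurableTypeR R => ((s, m) : state R N, v : R)) (@measurable_rcons R N)).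
exact: measurable_fun_pair.
Qed.

Lemma integral_arrival_indic (s : seq R) (m : 'I_N.+1) (B : set (state R N)) :
  measurable B ->
  (\int[law]_v (\1_B (rcons s v, m))%:E =
   (fine (law [set v | B (rcons s v, m)]))%:E)%E.
Proof.
move=> mB; have mB' := measurable_arrival_set s m mB.
rewrite fineK ?fin_num_measure//.
rewrite -[X in law X]setIT -[RHS](@integral_indic _ _ _ law setT)//.
Qed.

End arrival_rate.

Section policy_generator.
Context {R : realType}.
Variables (lam : R) (law : probability (measurableTypeR R) R) (pi : seq R -> pred nat).
Hypothesis lam_gt0 : 0 < lam.
Hypothesis law01 : law `]0, 1]%classic = 1%E.
Hypothesis pi_markovian : markovian_policy pi.

Definition policy_generator (g : state R 0 -> \bar R) (x : state R 0) : \bar R :=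
  (lam%:E * \int[law]_v g (rcons x.1 v, ord0) +
   \sum_(i < size x.1 | pi x.1 i) g (remove_job i x.1, ord0))%E.

Lemma simulable_policy : simulable policy_generator.
Proof.
(* The set of served jobs becomes a measurable coefficient, so that for lists of a given length the
   sum has a fixed range. *)
pose B l (g : state R 0 -> \bar R) (x : state R 0) : \bar R :=
  (\sum_(i < l) ((pi x.1 i)%:R : R)%:E * g (remove_job i x.1, ord0))%E.
have -> : policy_generator = (fun g x => lam%:E * (\int[law]_v g (rcons x.1 v, x.2)) + B (size x.1) g x)%E.
  apply/funext => g; apply/funext => x; rewrite /policy_generator /B (ord1 x.2); congr (_ + _)%E.
  by rewrite big_mkcond; apply: eq_bigr => i _; case: (pi x.1 i); rewrite ?mul1e ?mul0e.
apply: simulable_add.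
  apply: (simulable_scale (a := fun=> lam)) => //; first by move=> x; exact: ltW.
  exact: simulable_arrival.
apply: simulable_by_size => l; rewrite /B.
apply: (@simulable_sum _ _ _ _ _ (fun (i : 'I_l) g (x : state R 0) =>
  (((pi x.1 i)%:R : R)%:E * g (remove_job i x.1, ord0))%E)) => i _.
apply: (simulable_scale (a := fun x : state R 0 => (pi x.1 i)%:R)) => //; last first.
  by apply: simulable_move; exact: measurable_remove_job.
apply: measurable_from_state => k m.
have [mpi _] := pi_markovian.
rewrite (_ : (fun s => _) = \1_[set s : k.-tuple R | pi (tval s) i]).
  by apply: measurable_indic; exact: mpi.
apply/funext => s; rewrite indicE; congr (nat_of_bool _)%:R.
by apply/idP/idP; rewrite inE.
Qed.

Lemma policy_rateE x B : measurable B ->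
  policy_generator (fun y => (\1_B y)%:E) x = (policy_rate lam law pi x B)%:E.
Proof.
move=> mB; rewrite /policy_generator /policy_rate integral_arrival_indic// EFinD EFinM.
by congr (_ + _)%E; rewrite sumEFin.
Qed.

End policy_generator.

Section emw.
Context {R : realType}.
Variables (lam : R) (law : probability (measurableTypeR R) R) (L : nat).
Hypothesis lam_gt0 : 0 < lam.
Hypothesis law01 : law `]0, 1]%classic = 1%E.
Let K := (2 ^ L)%N.
Let K_gt0 : (0 < K)%N. Proof. by rewrite expn_gt0. Qed.
Variables (th : nat -> R) (eps : R).
Hypothesis th_gt0 : forall k, (1 <= k <= K)%N -> 0 < th k.
Hypothesis th1 : \sum_(1 <= k < K.+1) th k = 1.
Hypothesis eps_gt0 : 0 < eps.
Hypothesis th_ge : forall j, (1 <= j <= K)%N ->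
  lam * type_prob K law j + eps <= \sum_(1 <= k < K.+1) th k * (two_bucket L k j)%:R.

Section policy.
Variable pi : seq R -> pred nat.
Hypothesis pi_emw : two_bucket_emw L pi.

Local Notation A := (policy_generator lam law pi).

Let sA : simulable A.
Proof. by apply: simulable_policy => //; case: pi_emw. Qed.

Let nserved (s : seq R) k :=
  count (fun i => pi s i && is_type K k s`_i) (iota 0 (size s)).

Let sum_served (s : seq R) (c : nat -> R) :
  \sum_(i < size s | pi s i) \sum_(1 <= k < K.+1) (is_type K k s`_i)%:R * c k =
  \sum_(1 <= k < K.+1) (nserved s k)%:R * c k.
Proof.
rewrite exchange_big/=; apply: eq_bigr => k _.
by rewrite -mulr_suml -natr_sum (sum_bool_count _ (pi s) (fun i => is_type K k s`_i)).
Qed.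

Let sum_served1 (s : seq R) : valid_jobs s ->
  (\sum_(i < size s | pi s i) 1 : R) = \sum_(1 <= k < K.+1) (nserved s k)%:R.
Proof.
move=> vs; transitivity (\sum_(1 <= k < K.+1) (nserved s k)%:R * (1 : R)); last first.
  by apply: eq_bigr => k _; rewrite mulr1.
rewrite -sum_served; apply: eq_bigr => i _.
under eq_bigr do rewrite mulr1.
by rewrite -natr_sum sum_is_type//; exact: valid_nth.
Qed.

Let rateT x : valid_jobs x.1 -> policy_rate lam law pi x setT =
  lam + \sum_(1 <= k < K.+1) (nserved x.1 k)%:R.
Proof.
move=> vx; rewrite /policy_rate -sum_served1//; congr (_ + _).
  rewrite (_ : [set v | _] = setT); last by apply/seteqP; split.
  by rewrite [X in fine X]probability_setT mulr1.
by apply: eq_bigr => i _; rewrite indicE in_setT.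
Qed.

Let served_spec (s : seq R) : valid_jobs s -> exists k0, [/\ (1 <= k0 <= K)%N,
  forall k, (1 <= k <= K)%N ->
    (weight K (type_count K s) (two_bucket L k) <= weight K (type_count K s) (two_bucket L k0))%N &
  forall k, (1 <= k <= K)%N ->
    nserved s k = minn (two_bucket L k0 k) (type_count K s k)].
Proof.
move=> vs; have [_ [sel h]] := pi_emw; have [h1 h2 h3] := h s vs.
by exists (sel (type_count K s)).
Qed.

Let nserved_le (s : seq R) k : valid_jobs s -> (1 <= k <= K)%N -> (nserved s k <= K)%N.
Proof.
move=> vs kK; have [k0 [_ _ ->//]] := served_spec vs.
by apply: leq_trans (geq_minl _ _) _; exact: two_bucket_le.
Qed.

Let sum_const (c : R) : \sum_(1 <= k < K.+1) c = K%:R * c.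
Proof. by rewrite sumr_const_nat subSS subn0 mulr_natl. Qed.

Let quadK := @quad R K 0 (fun _ _ => 0).

Let quad_remove (s : seq R) i : (i < size s)%N ->
  quadK (remove_job i s, ord0) = quadK (s, ord0) +
   \sum_(1 <= k < K.+1) (is_type K k s`_i)%:R * (1 - 2 * (type_count K s k)%:R).
Proof.
move=> si; rewrite /quadK /quad -big_split; apply: eq_bigr => k _.
rewrite /shifted_count/= !addr0 -(type_count_remove K_gt0 k si) natrD.
by case: (is_type K k s`_i) => /=; [rewrite mul1r|rewrite mul0r]; ring.
Qed.

(** The maximal weight is at least the average of the weights under the mixture [th], which
    dominates the loads. Serving min(M, q) jobs instead of M costs at most K * K per type after
    multiplication by q, since a loss occurs only when q < M <= K. *)
Let served_weight (s : seq R) : valid_jobs s ->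
  \sum_(1 <= k < K.+1) (type_count K s k)%:R * (lam * type_prob K law k + eps) <=
  \sum_(1 <= k < K.+1) (type_count K s k)%:R * (nserved s k)%:R + K%:R * (K%:R * K%:R).
Proof.
move=> vs; have [k0 [k0K wmax ns]] := served_spec vs.
set q := type_count K s in wmax ns *.
have wE M : (weight K q M)%:R = \sum_(1 <= k < K.+1) (q k)%:R * (M k)%:R :> R.
  by rewrite /weight natr_sum; apply: eq_bigr => k _; rewrite natrM.
apply: (@le_trans _ _ (weight K q (two_bucket L k0))%:R).
  apply: (@le_trans _ _ (\sum_(1 <= j < K.+1) (q j)%:R *
      \sum_(1 <= k < K.+1) th k * (two_bucket L k j)%:R)).
    apply: ler_sum_nat => j /andP[j1 jK].
    by rewrite ler_wpM2l// th_ge// j1 -ltnS.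
  rewrite (_ : \sum_(1 <= j < K.+1) _ =
      \sum_(1 <= k < K.+1) th k * (weight K q (two_bucket L k))%:R); last first.
    under eq_bigr do rewrite big_distrr/=.
    rewrite exchange_big/=; apply: eq_bigr => k _.
    by rewrite wE big_distrr/=; apply: eq_bigr => j _; rewrite mulrCA.
  rewrite -[leRHS]mul1r -[X in _ <= X * _]th1 mulr_suml; apply: ler_sum_nat => k /andP[k1 kK].
  by rewrite ler_wpM2l ?ler_nat ?wmax// ?ltW ?th_gt0// k1 -ltnS.
rewrite wE -sum_const -big_split/=; apply: ler_sum_nat => k /andP[k1 kK].
rewrite ns; last by rewrite k1 -ltnS.
rewrite -!natrM -natrD ler_nat.
have : (two_bucket L k0 k <= K)%N by exact: two_bucket_le.
move: (two_bucket L k0 k) (q k) => M n MK.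
have : (M * M <= K * K)%N by rewrite leq_mul.
by rewrite /minn; case: ltnP; nia.
Qed.

(** The three terms bound the squared increments at arrivals, those at departures, and the service
    lost to slots without a job. *)
Let C := lam + K%:R * K%:R + 2 * (K%:R * (K%:R * K%:R)).

Let drift x : valid_jobs x.1 ->
  (A (on_valid quadK) x <=
   (policy_rate lam law pi x setT * quadK x + C - 2 * eps * (size x.1)%:R)%:E)%E.
Proof.
case: x => s m; rewrite (ord1 m) /= => vs; rewrite /policy_generator/=.
set q := type_count K s.
have q0 k : 0 <= (2 * (q k)%:R + 1 : R) by rewrite addr_ge0// mulr_ge0.
have arr : (\int[law]_v on_valid quadK (rcons s v, ord0) <=
   (quadK (s, ord0) + \sum_(1 <= k < K.+1) type_prob K law k * (2 * (q k)%:R + 1))%:E)%E.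
  apply: (integral_arrival_le law01) => //; try by move=> *; exact: quad_ge0.
  move=> v _; rewrite /quadK quad_rcons/=.
  by under eq_bigr do rewrite /shifted_count/= addr0.
have dep : (\sum_(i < size s | pi s i) on_valid quadK (remove_job i s, ord0) =
   (\sum_(i < size s | pi s i) quadK (s, ord0) +
    \sum_(1 <= k < K.+1) (nserved s k)%:R * (1 - 2 * (q k)%:R))%:E)%E.
  rewrite -sum_served -big_split/= -sumEFin; apply: eq_bigr => i _.
  by rewrite /on_valid/= valid_remove// quad_remove.
rewrite dep; apply: le_trans (leeD (lee_wpmul2l _ arr) (le_refl _)) _.
  by rewrite lee_fin ltW.
rewrite -EFinM -EFinD lee_fin rateT//.
have -> : \sum_(i < size s | pi s i) quadK (s, ord0) =
    (\sum_(1 <= k < K.+1) (nserved s k)%:R) * quadK (s, ord0).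
  by rewrite -sum_served1// mulr_suml; apply: eq_bigr => i _; rewrite mul1r.
have sw := served_weight vs; rewrite -/q in sw.
have psum := sum_type_prob K_gt0 law01.
have nsum : \sum_(1 <= k < K.+1) (nserved s k)%:R <= K%:R * K%:R :> R.
  rewrite -sum_const; apply: ler_sum_nat => k /andP[k1 kK].
  by rewrite ler_nat nserved_le// k1 -ltnS.
have e1 : \sum_(1 <= k < K.+1) type_prob K law k * (2 * (q k)%:R + 1) =
   2 * \sum_(1 <= k < K.+1) (q k)%:R * type_prob K law k + \sum_(1 <= k < K.+1) type_prob K law k.
  rewrite big_distrr/= -big_split/=; apply: eq_bigr => k _; ring.
have e2 : \sum_(1 <= k < K.+1) (nserved s k)%:R * (1 - 2 * (q k)%:R) =
   \sum_(1 <= k < K.+1) (nserved s k)%:R - 2 * \sum_(1 <= k < K.+1) (q k)%:R * (nserved s k)%:R :> R.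
  rewrite big_distrr/= -sumrB; apply: eq_bigr => k _; ring.
have e3 : \sum_(1 <= k < K.+1) (q k)%:R * (lam * type_prob K law k + eps) =
   lam * (\sum_(1 <= k < K.+1) (q k)%:R * type_prob K law k) + eps * (size s)%:R.
  rewrite -(sum_type_count K_gt0 vs) natr_sum !big_distrr/= -big_split/=.
  by apply: eq_bigr => k _; rewrite /q; ring.
rewrite e1 e2 /C; rewrite e3 in sw.
have {psum} := ler_wpM2l (ltW lam_gt0) psum; move: sw nsum => /=.
move: (quadK _) (\sum_(1 <= k < K.+1) (nserved s k)%:R) (\sum_(1 <= k < K.+1) type_prob K law k).
move: (\sum_(1 <= k < K.+1) (q k)%:R * type_prob K law k) (\sum_(1 <= k < K.+1) (q k)%:R * (nserved s k)%:R).
by clear arr dep => *; lra.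
Qed.

(** The option M_k for the type k of a job present has positive weight, so the maximal weight is
    positive and the chosen option serves a type that is present. *)
Let some_served (s : seq R) : valid_jobs s -> s <> [::] ->
  exists2 i : 'I_(size s), pi s i & true.
Proof.
move=> vs s0; have [k0 [k0K wmax ns]] := served_spec vs.
have s0' : (0 < size s)%N by case: s s0 {vs wmax ns} => //.
have [k kK tk] := is_type_exists K_gt0 (valid_nth vs s0').
have w0 : (0 < weight K (type_count K s) (two_bucket L k0))%N.
  apply: leq_trans (wmax k kK).
  rewrite /weight (bigD1_seq k) ?mem_index_iota ?iota_uniq//=.
  apply: ltn_addr; rewrite muln_gt0 two_bucket_self// andbT.
  by rewrite /type_count -has_count; apply/hasP; exists s`_0 => //; exact: mem_nth.
have [j jK jw] : exists2 j, (1 <= j <= K)%N & (0 < type_count K s j * two_bucket L k0 j)%N.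
  apply: contrapT => hn; move: w0; rewrite /weight big_nat_cond big1// => j.
  rewrite andbT => jK; apply/eqP; rewrite -leqn0 leqNgt; apply/negP => h.
  by apply: hn; exists j.
have : (0 < nserved s j)%N.
  by rewrite ns// leq_min; move: jw; rewrite muln_gt0 andbC.
rewrite /nserved -has_count => /hasP[i]; rewrite mem_iota add0n => /andP[_ si] /andP[pii _].
by exists (Ordinal si).
Qed.

Lemma emw_stable_policy : stable lam law pi.
Proof.
pose x0 : state R 0 := ([::], ord0).
have size0 (x : state R 0) : x <> x0 -> x.1 <> [::].
  by case: x => s m xx0 /= s0; apply: xx0; rewrite s0 (ord1 m).
have mx0 : measurable [set x0].
  rewrite (_ : [set x0] = [set x | [set p | size p.1 = 0%N] (pattern 0 x)]).
    exact: measurable_pattern_set.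
  apply/seteqP; split=> [x ->//|[s m] /=]; rewrite size_map => /size0nil ->.
  by rewrite (ord1 m).
have A1 x : A (cst 1%E) x = (policy_rate lam law pi x setT)%:E.
  rewrite -policy_rateE//; congr (A _ x); apply/funext => y.
  by rewrite indicE in_setT.
have rE x B : measurable B ->
    policy_rate lam law pi x B = fine (A (fun y => (\1_B y)%:E) x).
  by move=> mB; rewrite policy_rateE.
have mq : measurable_fun [set: state R 0] quadK by exact: measurable_quad.
(* Here [d] is the number of jobs: a served job leaves at rate 1, which gives [r0 = 1], and [D] is
   the identity. *)
apply: (@lyapunov_recurrent _ _ A sA _ rE x0 mx0 isT quadK (fun x => size x.1) mq _ _
   (lam + K%:R * K%:R) C (2 * eps) 1 id) => //.
- by move=> x; exact: quad_ge0.
- move=> B; rewrite (_ : [set x | _] = [set x | [set p | B (size p.1)] (pattern 0 x)]).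
    exact: measurable_pattern_set.
  by apply/seteqP; split=> x /=; rewrite size_map.
- by rewrite mulr_gt0.
- by rewrite !addr_ge0// ?mulr_ge0// ltW.
- move=> x vx; rewrite A1 lee_fin rateT// lerD2l -sum_const.
  by apply: ler_sum_nat => k /andP[k1 kK]; rewrite ler_nat nserved_le// k1 -ltnS.
- move=> x vx /size0 s0; have [i pii _] := some_served vx s0.
  rewrite /policy_generator; apply: le_trans (leeDr _ _); last first.
    rewrite mule_ge0 ?lee_fin ?(ltW lam_gt0)//; apply: integral_ge0 => v _.
    by rewrite lee_fin.
  rewrite (bigD1 i)//=; apply: le_trans (leeDl _ _); last first.
    by apply: sume_ge0 => j _; rewrite lee_fin.
  rewrite indicE (_ : _ \in _)//; apply/mem_set => /=.
  rewrite size_remove_job// prednK//; exact: leq_ltn_trans (ltn_ord i).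
- rewrite /policy_rate /= !big_ord0 !addr0.
  rewrite (_ : [set v | _] = set0); last by rewrite -subset0 => v.
  rewrite measure0 mulr0 (_ : [set v | _] = setT); last by apply/seteqP; split.
  by rewrite [X in fine X]probability_setT mulr1.
Qed.

End policy.

End emw.

(** * Existence of a 2-bucket MaxWeight policy *)

Section emw_policy.
Context {R : realType}.
Variable L : nat.
Let K := (2 ^ L)%N.
Let K_gt0 : (0 < K)%N. Proof. by rewrite expn_gt0. Qed.

Definition best_option (q : nat -> nat) : nat :=
  ([arg max_(i > ord0 : 'I_K.-1.+1) weight K q (two_bucket L i.+1)]%N : 'I_K.-1.+1).+1.

Lemma best_option_range q : (1 <= best_option q <= K)%N.
Proof.
rewrite /best_option; set i := [arg max_(_ > _) _]%N.
have : (i < K.-1.+1)%N by [].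
by move: K_gt0; lia.
Qed.

Lemma best_option_max q k : (1 <= k <= K)%N ->
  (weight K q (two_bucket L k) <= weight K q (two_bucket L (best_option q)))%N.
Proof.
move=> /andP[k1 kK]; rewrite /best_option; case: arg_maxnP => // i _ imax.
have kK' : (k.-1 < K.-1.+1)%N by rewrite prednK// prednK.
by have := imax (Ordinal kK') isT; rewrite /= prednK.
Qed.

Lemma eq_best_option (q q' : nat -> nat) :
  (forall k, (1 <= k <= K)%N -> q k = q' k) -> best_option q = best_option q'.
Proof.
move=> qq; rewrite /best_option.
rewrite (_ : (fun i : 'I_K.-1.+1 => weight K q (two_bucket L i.+1)) =
   fun i => weight K q' (two_bucket L i.+1))//.
apply/funext => i; apply: eq_big_nat => k /andP[k1 kK].
by rewrite qq// k1 -ltnS.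
Qed.

(** Appending a job does not affect whether the older ones get a slot, hence the induction from the
    right. The same count gives the number of busy slots of an nMSR policy. *)
Lemma count_oldest (s : seq R) k c :
  count (fun i => is_type K k s`_i && (type_count K (take i s) k < c)%N) (iota 0 (size s)) =
  minn c (type_count K s k).
Proof.
elim/last_ind: s => [|s v IH]; first by rewrite minn0.
rewrite size_rcons -(addn1 (size s)) iotaD count_cat/= add0n addn0.
rewrite nth_rcons ltnn eqxx type_count_rcons.
rewrite (_ : count _ _ = minn c (type_count K s k)); last first.
  rewrite -IH; apply: eq_in_count => i; rewrite mem_iota add0n => /andP[_ si].
  by rewrite nth_rcons si -cats1 takel_cat// ltnW.
rewrite -cats1 take_size_cat//; case: (is_type K k v) => /=; last by rewrite !addn0.
by case: (ltnP (type_count K s k) c) => h /=; lia.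
Qed.

Definition oldest_first (s : seq R) (i : nat) : bool :=
  (i < size s)%N &&
  has (fun k => is_type K k s`_i &&
        (type_count K (take i s) k < two_bucket L (best_option (type_count K s)) k)%N)
      (iota 1 K).

Let oldest_first_type (s : seq R) k i : (1 <= k <= K)%N -> (i < size s)%N ->
  oldest_first s i && is_type K k s`_i =
  is_type K k s`_i && (type_count K (take i s) k < two_bucket L (best_option (type_count K s)) k)%N.
Proof.
move=> kK si; rewrite /oldest_first si/=; apply/andP/andP => -[].
  move=> /hasP[j _ /andP[tj cj]] tk.
  by rewrite tk; move: cj; rewrite (is_type_unique K_gt0 tj tk).
move=> tk ck; split=> //; apply/hasP; exists k; last by rewrite tk.
by rewrite mem_iota add1n ltnS.
Qed.

Lemma oldest_first_count (s : seq R) k : (1 <= k <= K)%N ->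
  count (fun i => oldest_first s i && is_type K k s`_i) (iota 0 (size s)) =
  minn (two_bucket L (best_option (type_count K s)) k) (type_count K s k).
Proof.
move=> kK; rewrite -count_oldest; apply: eq_in_count => i.
by rewrite mem_iota add0n => /andP[_ si]; exact: oldest_first_type.
Qed.

Lemma measurable_oldest_first n i :
  measurable [set s : n.-tuple R | oldest_first (tval s) i].
Proof.
suff : measurable [set x : state R 0 | oldest_first x.1 i].
  rewrite -[measurable _]/(state_measurable _) => /(_ n ord0); exact.
have mf : measurable_fun [set: state R 0] (fun x => oldest_first x.1 i).
  apply: (measurable_pattern_fun (K := K)) => x y xy.
  rewrite /oldest_first (size_pattern xy); case: ltnP => //= si.
  have e : map (job_pattern K) x.1 = map (job_pattern K) y.1 by case: xy.
  have bo : best_option (type_count K x.1) = best_option (type_count K y.1).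
    by apply: eq_best_option => k kK; rewrite !type_count_pattern// e.
  apply: eq_in_has => k; rewrite mem_iota add1n ltnS => kK.
  by rewrite !(is_type_pattern kK) ?(size_pattern xy)// bo !type_count_pattern// !map_take e.
have := preimage_measurable mf (A := [set true]) ltac:(by []).
by congr (measurable _); apply/seteqP; split.
Qed.

(** The served jobs fit even with requirements rounded up to multiples of 1 / K, since service
    options are constrained through the rounded sizes. *)
Lemma oldest_first_fits (s : seq R) : valid_jobs s ->
  \sum_(i < size s | oldest_first s i) s`_i <= 1.
Proof.
move=> vs; have K0 : 0 < K%:R :> R by rewrite ltr0n.
set M := two_bucket L (best_option (type_count K s)).
apply: (@le_trans _ _ (\sum_(i < size s | oldest_first s i)
    \sum_(1 <= k < K.+1) (is_type K k s`_i)%:R * (k%:R / K%:R))).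
  apply: ler_sum => i _; have [k kK tk] := is_type_exists K_gt0 (valid_nth vs (ltn_ord i)).
  rewrite (bigD1_seq k) ?mem_index_iota ?iota_uniq//= tk mul1r.
  rewrite -[leLHS]addr0 lerD//; first by case/andP: tk.
  by rewrite sumr_ge0// => j _; rewrite mulr_ge0// divr_ge0.
rewrite exchange_big/=.
apply: (@le_trans _ _ (\sum_(1 <= k < K.+1) (k * M k)%:R / K%:R)); last first.
  rewrite -mulr_suml -natr_sum ler_pdivrMr// mul1r ler_nat.
  exact: two_bucket_option (best_option_range _).
apply: ler_sum_nat => k kK.
have kK' : (1 <= k <= K)%N by rewrite -ltnS.
rewrite -mulr_suml -natr_sum (sum_bool_count _ (oldest_first s) (fun i => is_type K k s`_i)).
rewrite oldest_first_count// mulrA ler_pM2r ?invr_gt0// -natrM ler_nat mulnC leq_mul2l.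
by rewrite geq_minl orbT.
Qed.

Lemma oldest_first_emw : two_bucket_emw L oldest_first.
Proof.
split; first by split; [exact: measurable_oldest_first|exact: oldest_first_fits].
exists best_option => s vs q; split.
- exact: best_option_range.
- exact: best_option_max.
- by move=> k kK; exact: oldest_first_count.
Qed.

End emw_policy.

Lemma emw_stable_of_load (R : realType) (lam : R)
    (law : probability (measurableTypeR R) R) (L : nat) :
  0 < lam -> law `]0, 1]%classic = 1%E ->
  (forall i j, (1 <= i <= j)%N -> (j <= 2 ^ L)%N ->
     type_prob (2 ^ L) law j <= type_prob (2 ^ L) law i) ->
  \sum_(1 <= k < (2 ^ L).+1) k%:R * (lam * type_prob (2 ^ L) law k) < (2 ^ L)%:R ->
  emw_stable lam law L.
Proof.
move=> lam_gt0 law01 pmon load.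
have [k kK|i j ij jK|th [eps [th_gt0 th1 eps_gt0 th_ge]]] :=
  @two_bucket_decomposition R L (fun k => lam * type_prob (2 ^ L) law k) _ _ load.
- by rewrite mulr_ge0 ?type_prob_ge0// ltW.
- by rewrite ler_pM2l// pmon.
split; first by exists (oldest_first L); exact: oldest_first_emw.
by move=> pi pi_emw; exact: (emw_stable_policy lam_gt0 law01 th_gt0 th1 eps_gt0 th_ge pi_emw).
Qed.

(** * The modulating process *)

Section cycle_slots.
Variable L : nat.
Let K := (2 ^ L)%N.
Let K_gt0 : (0 < K)%N. Proof. by rewrite expn_gt0. Qed.

(* The modulating process runs through the states 0, ..., K^2 - 1 in cyclic order.
   State (a - 1) * K + c is the working state of option M_a when c = 0; for c > 0
   it is a switching state in which c of the slots of M_a are closed, except that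
   one slot is always kept open. *)
Definition cycle_option (m : nat) : nat := (m %/ K).+1.
Definition bucket_slots (m : nat) : nat := (2 ^ (L - up_log 2 (cycle_option m)))%N.
Definition partner (m : nat) : nat := (2 ^ up_log 2 (cycle_option m) - cycle_option m)%N.
Definition full_slots (m : nat) : nat :=
  if cycle_option m == (2 ^ up_log 2 (cycle_option m))%N then bucket_slots m
  else (2 * bucket_slots m)%N.
Definition open_slots (m : nat) : nat := maxn 1 (full_slots m - m %% K).
Definition cycle_slots (m j : nat) : nat :=
  ((j == cycle_option m) * minn (bucket_slots m) (open_slots m) +
   (j == partner m) * (open_slots m - bucket_slots m))%N.
(** The partner slots close before those of type [cycle_option m]. Completions of the closing type
    trigger the next transition, so one of its slots always has to be open
    ([cycle_slots_closing]). *)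
Definition closing_type (m : nat) : nat :=
  if (bucket_slots m < open_slots m)%N then partner m else cycle_option m.

Lemma cycle_option_range m : (m < K * K)%N -> (1 <= cycle_option m <= K)%N.
Proof. by move=> mK; rewrite /cycle_option ltn_divLR. Qed.

Lemma bucket_slots_gt0 m : (0 < bucket_slots m)%N.
Proof. by rewrite expn_gt0. Qed.

Let log_le m : (m < K * K)%N -> (up_log 2 (cycle_option m) <= L)%N.
Proof.
move=> /cycle_option_range/andP[_ aK].
by rewrite -(up_expnK L (isT : 1 < 2)%N) leq_up_log.
Qed.

Let option_le m : (cycle_option m <= 2 ^ up_log 2 (cycle_option m))%N.
Proof. exact: up_logP. Qed.

Lemma full_slots_range m : (m < K * K)%N -> (1 <= full_slots m <= K)%N.
Proof.
move=> mK; have lL := log_le mK; have s0 := bucket_slots_gt0 m.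
have eL : (2 ^ up_log 2 (cycle_option m) * bucket_slots m = K)%N.
  by rewrite /bucket_slots -expnD subnKC.
rewrite /full_slots; case: eqP => [_|ne]; first by nia.
have l0 : (0 < up_log 2 (cycle_option m))%N.
  rewrite lt0n; apply/eqP => l0; apply: ne; have := option_le m.
  by rewrite l0 expn0 /cycle_option; case: (m %/ K)%N.
move: eL; rewrite -(prednK l0) expnS.
have : (0 < 2 ^ (up_log 2 (cycle_option m)).-1)%N by rewrite expn_gt0.
by move: (2 ^ _)%N (bucket_slots m) s0 => u v; nia.
Qed.

Lemma partner_range m : (m < K * K)%N ->
  (bucket_slots m < open_slots m)%N -> (1 <= partner m <= K)%N.
Proof.
move=> mK so; have lL := log_le mK.
have : (2 ^ up_log 2 (cycle_option m) <= K)%N by rewrite leq_exp2l.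
have s0 := bucket_slots_gt0 m; have ol := option_le m.
move: so; rewrite /open_slots /full_slots /partner; case: eqP => [_|ne]; first by lia.
have a0 : (0 < cycle_option m)%N by [].
move=> _; move: ol ne; move: (2 ^ up_log 2 (cycle_option m))%N => u.
by move: (cycle_option m) a0 => a; lia.
Qed.

(** A type equal to its own partner would be half of a power of two, hence itself a power of two,
    and for those no partner slot is ever open. *)
Lemma partner_neq m : (bucket_slots m < open_slots m)%N -> partner m <> cycle_option m.
Proof.
have s0 := bucket_slots_gt0 m.
rewrite /open_slots /full_slots; case: eqP => [_|ne]; first by lia.
move=> _ h; apply: ne; move: h; rewrite /partner; have := option_le m.
set l := up_log 2 (cycle_option m) => al h.
have e2 : (2 ^ l = 2 * cycle_option m)%N by lia.
case lE : l => [|l']; first by move: e2; rewrite lE expn0; lia.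
have e3 : (2 ^ l' = cycle_option m)%N by move: e2; rewrite lE expnS; lia.
by move: lE; rewrite /l -{1}e3 up_expnK//; lia.
Qed.

Lemma closing_type_range m : (m < K * K)%N -> (1 <= closing_type m <= K)%N.
Proof.
move=> mK; rewrite /closing_type; case: ifP => h; first exact: partner_range.
exact: cycle_option_range.
Qed.

Lemma cycle_slots_closing m : (0 < cycle_slots m (closing_type m))%N.
Proof.
have s0 := bucket_slots_gt0 m.
rewrite /cycle_slots /closing_type; case: (ltnP (bucket_slots m) (open_slots m)) => h; rewrite eqxx mul1n.
  by apply: ltn_addl; rewrite subn_gt0.
by apply: ltn_addr; rewrite /open_slots; lia.
Qed.

Lemma cycle_slots_working a j : (a < K)%N -> (1 <= j)%N ->
  cycle_slots (a * K) j = two_bucket L a.+1 j.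
Proof.
move=> aK j1; have mK : (a * K < K * K)%N by rewrite ltn_mul2r K_gt0.
have aE : cycle_option (a * K) = a.+1 by rewrite /cycle_option mulnK.
have oE : open_slots (a * K) = full_slots (a * K).
  by rewrite /open_slots modnMl subn0; have := full_slots_range mK; lia.
have := @partner_neq (a * K).
rewrite /cycle_slots /two_bucket oE /full_slots aE.
have sE : bucket_slots (a * K) = (2 ^ (L - up_log 2 a.+1))%N by rewrite /bucket_slots aE.
have pE : partner (a * K) = (2 ^ up_log 2 a.+1 - a.+1)%N by rewrite /partner aE.
have s0 := bucket_slots_gt0 (a * K).
case: eqP => [pw|npw] ne; rewrite pE -sE.
  by rewrite minnn subnn muln0 addn0.
have {}ne : partner (a * K) <> a.+1 by apply: ne; lia.
rewrite (_ : minn _ _ = bucket_slots (a * K)); last by lia.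
rewrite (_ : (2 * _ - _)%N = bucket_slots (a * K)); last by lia.
rewrite -pE; case: (eqVneq j a.+1) => [->|_] /=; last by rewrite mul0n add0n.
by case: eqP => [/esym//|_]; rewrite mul0n addn0.
Qed.

Lemma cycle_slots_le m j : (m < K * K)%N ->
  (cycle_slots m j <= cycle_slots (m %/ K * K) j)%N.
Proof.
move=> mK; have mK' : (m %/ K * K < K * K)%N by rewrite ltn_mul2r K_gt0 ltn_divLR.
have aE : cycle_option (m %/ K * K) = cycle_option m by rewrite /cycle_option mulnK.
have := full_slots_range mK.
rewrite /cycle_slots /partner /open_slots /full_slots /bucket_slots aE modnMl subn0.
by case: (j == cycle_option m); case: (j == _); case: (cycle_option m == _); lia.
Qed.

(** Within a block at most one slot, of the closing type, disappears at each step. At the end of a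
    block a single slot is open; it is of the closing type and is freed by the completion that
    triggers the transition, so any option may follow. *)
Lemma cycle_slots_next m j : (m < K * K)%N -> (1 <= j <= K)%N ->
  (cycle_slots m j <= cycle_slots (m.+1 %% (K * K)) j + (j == closing_type m))%N.
Proof.
move=> mK jK; have fr := full_slots_range mK; have s0 := bucket_slots_gt0 m.
have cK : (m %% K < K)%N by rewrite ltn_mod.
have [c1|c1] := ltnP (m %% K).+1 K.
  have mE : m = (m %/ K * K + m %% K)%N by exact: divn_eq.
  have mE' : m.+1 = (m %/ K * K + (m %% K).+1)%N by rewrite addnS -mE.
  have dE : (m.+1 %/ K = m %/ K)%N.
    by rewrite [in LHS]mE' divnMDl// (divn_small c1) addn0.
  have rE : (m.+1 %% K = (m %% K).+1)%N.
    by rewrite [in LHS]mE' modnMDl modn_small.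
  have m1K : (m.+1 < K * K)%N.
    have : (m %/ K < K)%N by rewrite ltn_divLR.
    by move: mE c1; move: (m %/ K)%N (m %% K)%N => u v; nia.
  rewrite modn_small//.
  have aE : cycle_option m.+1 = cycle_option m by rewrite /cycle_option dE.
  rewrite /closing_type /cycle_slots /partner /open_slots /full_slots /bucket_slots aE rE.
  rewrite -/(bucket_slots m) -/(partner m).
  rewrite -[if _ then bucket_slots m else _]/(full_slots m).
  move: (bucket_slots m) (full_slots m) (partner m) (cycle_option m) (m %% K)%N s0 fr => S C p a c s0 fr.
  by case: (ltnP S (maxn 1 (C - c))) => h; case: (eqVneq j a) => ja; case: (eqVneq j p) => jp;
    rewrite ?mul1n ?mul0n ?add0n ?addn0 /= ; lia.
have o1 : open_slots m = 1%N by rewrite /open_slots; lia.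
rewrite {1}/cycle_slots /closing_type o1 (_ : (bucket_slots m < 1)%N = false); last by lia.
rewrite (_ : minn _ _ = 1%N); last by lia.
by rewrite (_ : (1 - _ = 0)%N); lia.
Qed.

Lemma cycle_slots_option m : (m < K * K)%N -> service_option K (cycle_slots m).
Proof.
move=> mK; have aK : (m %/ K < K)%N by rewrite ltn_divLR.
apply: leq_trans (@two_bucket_option L (m %/ K).+1 aK).
rewrite big_nat_cond [leqRHS]big_nat_cond; apply: leq_sum => j.
rewrite andbT => /andP[j1 _].
by rewrite leq_mul2l -cycle_slots_working// cycle_slots_le ?orbT.
Qed.

Lemma cycle_slots_bound m j : (m < K * K)%N -> (1 <= j)%N -> (cycle_slots m j <= K)%N.
Proof.
move=> mK j1; apply: leq_trans (cycle_slots_le j mK) _.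
by rewrite cycle_slots_working ?ltn_divLR//; exact: two_bucket_le.
Qed.

End cycle_slots.

Section cycle_policy.
Context {R : realType}.
Variable L : nat.
Let K := (2 ^ L)%N.
Let K_gt0 : (0 < K)%N. Proof. by rewrite expn_gt0. Qed.
Let n := (K * K).-1.
Let nE : n.+1 = (K * K)%N. Proof. by rewrite prednK// muln_gt0 K_gt0. Qed.
Let ltKK (m : 'I_n.+1) : (m < K * K)%N. Proof. by rewrite -nE. Qed.

(* w m is the mean sojourn time in state m. *)
Variable w : nat -> R.
Hypothesis w_ge1 : forall m, (m < K * K)%N -> 1 <= w m.

Let w_gt0 (m : 'I_n.+1) : 0 < w m.
Proof. by apply: lt_le_trans (w_ge1 (ltKK m)). Qed.

(** The slots of the closing type complete at a total rate equal to their number, so the process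
    moves on from [m] at rate [(w m)^-1]; [w_ge1] makes this a probability. *)
Definition exit_prob (m : nat) : R := (w m)^-1 / (cycle_slots L m (closing_type L m))%:R.

Definition cycle_policy : nmsr R (2 ^ L) (2 ^ L * 2 ^ L).-1 :=
  Nmsr (2 ^ L) (fun m : 'I_n.+1 => cycle_slots L m) (fun m : 'I_n.+1 => (m %% K == 0)%N)
    (fun _ _ => 0)
    (fun k m m' => if k == closing_type L m
       then exit_prob m * (m' == ordS m)%:R + (1 - exit_prob m) * (m' == m)%:R
       else (m' == m)%:R).

Let p := cycle_policy.

Lemma exit_prob_itv (m : 'I_n.+1) : 0 < exit_prob m <= 1.
Proof.
have s0 := cycle_slots_closing L m.
have s1 : 1 <= (cycle_slots L m (closing_type L m))%:R :> R by rewrite ler1n.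
have s0' : 0 < (cycle_slots L m (closing_type L m))%:R :> R by rewrite ltr0n.
rewrite /exit_prob divr_gt0 ?invr_gt0//= ler_pdivrMr// mul1r.
by apply: le_trans s1; rewrite invf_le1// w_ge1// ltKK.
Qed.

Lemma sum_eq_ord (m0 : 'I_n.+1) (c : R) (phi : 'I_n.+1 -> R) :
  \sum_m' c * (m' == m0)%:R * phi m' = c * phi m0.
Proof.
rewrite (bigD1 m0)//= eqxx mulr1 big1 ?addr0// => m' /negbTE ->.
by rewrite mulr0 mul0r.
Qed.

Lemma sum_compl k (m : 'I_n.+1) (phi : 'I_n.+1 -> R) :
  \sum_m' compl p k m m' * phi m' =
  phi m + (k == closing_type L m)%:R * exit_prob m * (phi (ordS m) - phi m).
Proof.
rewrite /=; case: eqP => _.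
  under eq_bigr do rewrite mulrDl.
  by rewrite big_split/= !sum_eq_ord; ring.
rewrite !mul0r addr0 -[RHS]mul1r -sum_eq_ord.
by apply: eq_bigr => m' _; rewrite mul1r.
Qed.

Lemma sum_modulating (m : 'I_n.+1) (phi : 'I_n.+1 -> R) :
  \sum_(1 <= k < K.+1) (slots p m k)%:R * \sum_m' compl p k m m' * phi m' =
  (\sum_(1 <= k < K.+1) (slots p m k)%:R) * phi m + (w m)^-1 * (phi (ordS m) - phi m).
Proof.
under eq_bigr do rewrite sum_compl mulrDr.
rewrite big_split/= mulr_suml; congr (_ + _).
rewrite (sum_nat_single (k0 := closing_type L m)); last 2 first.
- by rewrite ltnS closing_type_range.
- by move=> k _ /negbTE ->; rewrite !mul0r mulr0.
rewrite eqxx mul1r mulrA; congr (_ * _); rewrite /exit_prob mulrC divfK//.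
by rewrite pnatr_eq0 -lt0n cycle_slots_closing.
Qed.

Lemma modulating_rate_next (m : 'I_n.+1) : 0 < modulating_rate p m (ordS m).
Proof.
rewrite /modulating_rate/= add0r.
have := sum_modulating m (fun m' => (m' == ordS m)%:R).
have -> : \sum_(1 <= k < K.+1) (slots p m k)%:R *
    \sum_m' compl p k m m' * (m' == ordS m)%:R =
  \sum_(1 <= k < K.+1) (slots p m k)%:R * compl p k m (ordS m).
  apply: eq_bigr => k _; congr (_ * _).
  rewrite (bigD1 (ordS m))//= eqxx mulr1 big1 ?addr0// => m' /negbTE ->.
  by rewrite mulr0.
move=> /= ->; rewrite eqxx.
have S1 : 1 <= \sum_(1 <= k < K.+1) (cycle_slots L m k)%:R :> R.
  rewrite (bigD1_seq (closing_type L m)) ?mem_index_iota ?iota_uniq//=.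
    rewrite -[leLHS]addr0 lerD ?ler1n ?cycle_slots_closing//.
    by rewrite sumr_ge0.
  by rewrite ltnS closing_type_range.
(* For K = 1 there is a single state, and every completion contributes to its rate to itself. *)
have [_|_] := eqVneq m (ordS m).
  by rewrite mulr1 subrr mulr0 addr0 (lt_le_trans _ S1).
by rewrite mulr0 add0r subr0 mulr1 invr_gt0.
Qed.

Lemma iter_ordS i (m : 'I_n.+1) : iter i (@ordS n.+1) m = ((m + i) %% n.+1)%N :> nat.
Proof.
elim: i => [|i IH]; first by rewrite addn0 modn_small.
by rewrite iterS /= IH -addn1 modnDml addn1 addnS.
Qed.

Lemma cycle_policy_is_nmsr : is_nmsr p.
Proof.
split => //=.
- by move=> m; exact: cycle_slots_option.
- move=> k m m'; have /andP[e0 e1] := exit_prob_itv m.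
  by case: ifP => // _; rewrite addr_ge0// mulr_ge0// ?(ltW e0)// subr_ge0.
- move=> k m; have := sum_compl k m (fun=> 1) => /=.
  rewrite subrr mulr0 addr0 => h; rewrite -[RHS]h.
  by apply: eq_bigr => m' _; rewrite mulr1.
- move=> m m'.
  have step i : connect (fun a b => 0 < modulating_rate p a b) m (iter i (@ordS n.+1) m).
    elim: i => [|i IH]; first exact: connect0.
    apply: connect_trans IH _; apply: connect1; exact: modulating_rate_next.
  suff -> : m' = iter (m' + (n.+1 - m)) (@ordS n.+1) m by [].
  apply: val_inj; rewrite [RHS]iter_ordS.
  have -> : (m + (m' + (n.+1 - m)) = m' + n.+1)%N by have := ltn_ord m; lia.
  by rewrite modnDr modn_small.
- apply/andP; split.
    by apply/card_gt0P; exists ord0; rewrite unfold_in mod0n.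
  pose f (m : 'I_n.+1) : 'I_K := Ordinal (etrans (ltn_divLR _ _ K_gt0) (ltKK m)).
  rewrite -[X in (_ <= X)%N]card_ord.
  apply: (@leq_card_in _ _ f) => // m m'; rewrite !unfold_in => /eqP h /eqP h' [mm].
  by apply: val_inj; rewrite /= (divn_eq m K) (divn_eq m' K) h h' mm.
- move=> m _.
  have mK' : (m %/ K * K < n.+1)%N by apply: leq_ltn_trans (ltn_ord m); exact: leq_trunc_div.
  (* The working state of the same block serves as both endpoints, since a switching state only
     closes slots of its option. *)
  exists (Ordinal mK'), (Ordinal mK'); rewrite /= modnMl eqxx; split=> // k kK.
  by rewrite maxnn cycle_slots_le.
- by move=> m m' j _; rewrite ltxx.
move=> k m m' j kK jK sk; have /andP[e0 e1] := exit_prob_itv m.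
have stay : (cycle_slots L m j <= cycle_slots L m j + (j == k))%N by rewrite leq_addr.
case: (eqVneq m' m) => [->//|mm'].
rewrite mulr0 addr0; case: (eqVneq k (closing_type L m)) => [->|_]; last by rewrite ltxx.
case: (eqVneq m' (ordS m)) => [->|_]; last by rewrite mulr0 ltxx.
by move=> _; rewrite /= [X in (_ %% X)%N]nE cycle_slots_next// ltKK.
Qed.

Lemma cycle_policy_two_bucket : two_bucket_nmsr p.
Proof.
split; first exact: cycle_policy_is_nmsr.
move=> m /= /eqP m0; have aK : (m %/ K < K)%N by rewrite ltn_divLR// ltKK.
exists (m %/ K).+1 => // j /andP[j1 _].
rewrite -cycle_slots_working//; congr cycle_slots.
by rewrite [LHS](divn_eq m K) m0 addn0.
Qed.

End cycle_policy.

(** * Drift under the cyclic policy *)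

Section cycle_stability.
Context {R : realType}.
Variables (lam : R) (law : probability (measurableTypeR R) R) (L : nat).
Hypothesis lam_gt0 : 0 < lam.
Hypothesis law01 : law `]0, 1]%classic = 1%E.
Local Notation K := (2 ^ L)%N.
Local Notation n := (2 ^ L * 2 ^ L).-1.
Let K_gt0 : (0 < K)%N. Proof. by rewrite expn_gt0. Qed.
Let nE : n.+1 = (K * K)%N. Proof. by rewrite prednK// muln_gt0 K_gt0. Qed.
Let ltKK (m : 'I_n.+1) : (m < K * K)%N.
Proof. by have := ltn_ord m; rewrite [X in (_ < X)%N]nE. Qed.
Variables (w : nat -> R) (T H eps : R) (h : nat -> 'I_n.+1 -> R) (m0 : 'I_n.+1).
Hypothesis w_ge1 : forall m, (m < K * K)%N -> 1 <= w m.
Hypothesis w_le : forall m, (m < K * K)%N -> w m <= T.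
Hypothesis h_ge0 : forall k m, 0 <= h k m.
Hypothesis h_le : forall k m, h k m <= H.
Hypothesis eps_gt0 : 0 < eps.
Variable p : nmsr R K n.
Hypothesis slotsE : forall m k, slots p m k = cycle_slots L m k.
Hypothesis spontE : forall m m', spont p m m' = 0.
Hypothesis compl_ge0 : forall k m m', 0 <= compl p k m m'.
Hypothesis compl1 : forall k m, \sum_m' compl p k m m' = 1.
Hypothesis modulating : forall m (phi : 'I_n.+1 -> R),
  \sum_(1 <= k < K.+1) (slots p m k)%:R * \sum_m' compl p k m m' * phi m' =
  (\sum_(1 <= k < K.+1) (slots p m k)%:R) * phi m + (w m)^-1 * (phi (ordS m) - phi m).
(* The corrector h replaces the slots that are open in state m by their average
   over a cycle. *)
Hypothesis h_next : forall j (m : 'I_n.+1), (1 <= j <= K)%N ->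
  (w m)^-1 * (h j (ordS m) - h j m) <=
  (slots p m j)%:R - lam * type_prob K law j - eps.
Local Notation state := (state R n).

Let w_gt0 (m : 'I_n.+1) : 0 < w m.
Proof. by apply: lt_le_trans (w_ge1 (ltKK m)). Qed.

Let T_gt0 : 0 < T. Proof. exact: lt_le_trans (w_gt0 m0) (w_le (ltKK m0)). Qed.

Let H_ge0 : 0 <= H. Proof. exact: le_trans (h_ge0 0%N m0) (h_le _ _). Qed.

Let A (g : state -> \bar R) (x : state) : \bar R :=
  (lam%:E * \int[law]_v g (rcons x.1 v, x.2) +
   (\sum_(1 <= k < K.+1) \sum_(i < size x.1 | in_slot p x.2 x.1 k i)
      \sum_m' (compl p k x.2 m')%:E * g (remove_job i x.1, m') +
    \sum_(1 <= k < K.+1) ((slots p x.2 k - type_count K x.1 k)%N%:R : R)%:E *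
      \sum_m' (compl p k x.2 m')%:E * g (x.1, m')))%E.

Let events (g : state -> R) (x : state) : R :=
  \sum_(1 <= k < K.+1) \sum_(i < size x.1 | in_slot p x.2 x.1 k i)
      \sum_m' compl p k x.2 m' * g (remove_job i x.1, m') +
  \sum_(1 <= k < K.+1) (slots p x.2 k - type_count K x.1 k)%N%:R *
      \sum_m' compl p k x.2 m' * g (x.1, m').

Let in_slot_pattern k i (x y : state) : (1 <= k <= K)%N -> (i < size x.1)%N ->
  pattern K x = pattern K y -> in_slot p x.2 x.1 k i = in_slot p y.2 y.1 k i.
Proof.
move=> kK si xy; have e : map (job_pattern K) x.1 = map (job_pattern K) y.1 by case: xy.
have e2 : x.2 = y.2 by case: xy.
by rewrite /in_slot !(is_type_pattern kK) -?(size_pattern xy)// e e2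
  !type_count_pattern// !map_take e.
Qed.

Let sA : simulable A.
Proof.
pose B l (g : state -> \bar R) (x : state) : \bar R :=
  (\sum_(1 <= k < K.+1) \sum_(i < l) ((((i < size x.1)%N && in_slot p x.2 x.1 k i)%:R : R)%:E *
     \sum_m' (compl p k x.2 m')%:E * g (remove_job i x.1, m')))%E.
pose D (g : state -> \bar R) (x : state) : \bar R :=
  (\sum_(1 <= k < K.+1) ((slots p x.2 k - type_count K x.1 k)%N%:R : R)%:E *
      \sum_m' (compl p k x.2 m')%:E * g (x.1, m'))%E.
have -> : A = (fun g x => lam%:E * (\int[law]_v g (rcons x.1 v, x.2)) + (B (size x.1) g x + D g x))%E.
  apply/funext => g; apply/funext => x; rewrite /A /B; congr (_ + (_ + _))%E.
  apply: eq_bigr => k _; rewrite big_mkcond; apply: eq_bigr => i _.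
  by rewrite ltn_ord/=; case: (in_slot _ _ _ _ _); rewrite ?mul1e ?mul0e.
apply: simulable_add.
  apply: (simulable_scale (a := fun=> lam)) => //; first by move=> x; exact: ltW.
  exact: simulable_arrival.
have sumC k (f : 'I_n.+1 -> state -> state) : (forall m', measurable_fun [set: state] (f m')) ->
    simulable (fun g x => \sum_m' (compl p k x.2 m')%:E * g (f m' x))%E.
  move=> mf.
  apply: (@simulable_sum _ _ _ _ _ (fun m' g (x : state) => (compl p k x.2 m')%:E * g (f m' x))%E) => m' _.
  apply: (simulable_scale (a := fun x : state => compl p k x.2 m')) => //.
    by apply: (measurable_pattern_fun (K := K)) => x y [_ ->].
  exact: simulable_move.
apply: simulable_add.
  apply: simulable_by_size => l; rewrite /B.
  rewrite (_ : (fun _ _ => _) = fun g (x : state) => (\sum_(k <- index_iota 1 K.+1 | (k \in index_iota 1 K.+1) && true)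
   \sum_(i < l) ((((i < size x.1)%N && in_slot p x.2 x.1 k i)%:R : R)%:E *
     \sum_m' (compl p k x.2 m')%:E * g (remove_job i x.1, m')))%E); last first.
    by apply/funext => g; apply/funext => x; rewrite big_seq_cond.
  apply: (@simulable_sum _ _ _ _ _ (fun k g (x : state) =>
    \sum_(i < l) ((((i < size x.1)%N && in_slot p x.2 x.1 k i)%:R : R)%:E *
     \sum_m' (compl p k x.2 m')%:E * g (remove_job i x.1, m')))%E) => k.
  rewrite andbT mem_index_iota => kK.
  apply: (@simulable_sum _ _ _ _ _ (fun (i : 'I_l) g (x : state) =>
    ((((i < size x.1)%N && in_slot p x.2 x.1 k i)%:R : R)%:E *
     \sum_m' (compl p k x.2 m')%:E * g (remove_job i x.1, m')))%E) => i _.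
  apply: (simulable_scale (a := fun x : state => ((i < size x.1)%N && in_slot p x.2 x.1 k i)%:R)) => //.
    apply: (measurable_pattern_fun (K := K)) => x y xy; rewrite -(size_pattern xy).
    by case: ltnP => //= si; rewrite (in_slot_pattern _ si xy).
  by apply: sumC => m'; exact: measurable_remove_job.
rewrite /D (_ : (fun _ _ => _) = fun g (x : state) =>
  (\sum_(k <- index_iota 1 K.+1 | (k \in index_iota 1 K.+1) && true)
    ((slots p x.2 k - type_count K x.1 k)%N%:R : R)%:E *
      \sum_m' (compl p k x.2 m')%:E * g (x.1, m'))%E); last first.
  by apply/funext => g; apply/funext => x; rewrite big_seq_cond.
apply: (@simulable_sum _ _ _ _ _ (fun k g (x : state) =>
   ((slots p x.2 k - type_count K x.1 k)%N%:R : R)%:E *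
      \sum_m' (compl p k x.2 m')%:E * g (x.1, m'))%E) => k.
rewrite andbT mem_index_iota => kK.
apply: (simulable_scale (a := fun x : state => (slots p x.2 k - type_count K x.1 k)%N%:R)) => //.
  apply: (measurable_pattern_fun (K := K)) => x y xy.
  by rewrite !type_count_pattern//; case: xy => -> ->.
by apply: sumC => m'; exact: measurable_change_mode.
Qed.

Let A_events (G : state -> \bar R) (g : state -> R) (x : state) :
  (forall i m', (i < size x.1)%N -> G (remove_job i x.1, m') = (g (remove_job i x.1, m'))%:E) ->
  (forall m', G (x.1, m') = (g (x.1, m'))%:E) ->
  A G x = (lam%:E * \int[law]_v G (rcons x.1 v, x.2) + (events g x)%:E)%E.
Proof.
move=> Gi G0; rewrite /A /events EFinD; congr (_ + (_ + _))%E; rewrite -sumEFin;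
  apply: eq_bigr => k _.
  rewrite -sumEFin; apply: eq_bigr => i _; rewrite -sumEFin; apply: eq_bigr => m' _.
  by rewrite Gi.
rewrite EFinM -sumEFin; congr (_ * _)%E; apply: eq_bigr => m' _.
by rewrite G0.
Qed.

Let nmsr_rateE (x : state) B : nmsr_rate lam law p x B =
  lam * fine (law [set v | B (rcons x.1 v, x.2)]) + events (\1_B) x.
Proof.
rewrite /nmsr_rate /events [X in _ + X + _ + _]big1 ?addr0 ?addrA//.
by move=> m' _; rewrite spontE mul0r.
Qed.

Let rateE x B : measurable B ->
  A (fun y => (\1_B y)%:E) x = (nmsr_rate lam law p x B)%:E.
Proof.
move=> mB; rewrite nmsr_rateE (A_events (g := \1_B))// integral_arrival_indic//.
Qed.

Let busy (x : state) k : nat := minn (slots p x.2 k) (type_count K x.1 k).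

Let sum_in_slot (x : state) k (c : R) :
  \sum_(i < size x.1 | in_slot p x.2 x.1 k i) c = (busy x k)%:R * c.
Proof.
rewrite /busy -count_oldest -[in LHS](mul1r c) -mulr_suml; congr (_ * _).
have := sum_bool_count (size x.1) (in_slot p x.2 x.1 k) xpredT.
under [X in _ = X -> _]eq_count do rewrite andbT.
by move=> <-; rewrite natr_sum.
Qed.

(** A real completion of type k is credited [psi k]; apart from this credit, values are bounded by a
    function [phi] of the mode alone, on which [modulating] evaluates all completions, real or
    dummy. Applied to an opposite through [events_opp], the bound also yields lower bounds. *)
Let events_bound (g : state -> R) (x : state) (phi : 'I_n.+1 -> R) (psi : nat -> R) :
  (forall k i m', (1 <= k <= K)%N -> (i < size x.1)%N -> is_type K k x.1`_i ->
     g (remove_job i x.1, m') <= phi m' - psi k) ->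
  (forall m', g (x.1, m') <= phi m') ->
  events g x <= (\sum_(1 <= k < K.+1) (slots p x.2 k)%:R) * phi x.2 +
    (w x.2)^-1 * (phi (ordS x.2) - phi x.2) -
    \sum_(1 <= k < K.+1) (busy x k)%:R * psi k.
Proof.
move=> gi g0; rewrite -modulating -sumrB /events -big_split/=.
apply: ler_sum_nat => k kK; have {}kK : (1 <= k <= K)%N by rewrite -ltnS.
pose Phi := \sum_m' compl p k x.2 m' * phi m'.
have c1 := compl1 k x.2.
apply: (@le_trans _ _ ((busy x k)%:R * (Phi - psi k) +
    (slots p x.2 k - type_count K x.1 k)%N%:R * Phi)).
  apply: lerD.
    rewrite -sum_in_slot; apply: ler_sum => i /andP[ti _].
    rewrite /Phi -[psi k]mul1r -[X in X * psi k]c1 mulr_suml -sumrB; apply: ler_sum => m' _.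
    rewrite -mulrBr ler_wpM2l//; exact: gi kK (ltn_ord i) ti.
  by rewrite ler_wpM2l//; apply: ler_sum => m' _; rewrite ler_wpM2l.
have e : (slots p x.2 k)%:R = (busy x k)%:R + (slots p x.2 k - type_count K x.1 k)%N%:R :> R.
  by rewrite -natrD; congr _%:R; rewrite /busy; lia.
rewrite -/Phi e.
by rewrite mulrBr mulrDl; lra.
Qed.

Let events_opp g x : events (fun y => - g y) x = - events g x.
Proof.
rewrite /events opprD -!sumrN; congr (_ + _); apply: eq_bigr => k _.
  rewrite -sumrN; apply: eq_bigr => i _; rewrite -sumrN; apply: eq_bigr => m' _.
  by rewrite mulrN.
by rewrite -mulrN -sumrN; congr (_ * _); apply: eq_bigr => m' _; rewrite mulrN.
Qed.

Let total_slots (m : 'I_n.+1) : R := \sum_(1 <= k < K.+1) (slots p m k)%:R.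

Let events1 x : events (cst 1) x = total_slots x.2.
Proof.
have c1 k : \sum_m' compl p k x.2 m' * 1 = 1 :> R.
  by under eq_bigr do rewrite mulr1; exact: compl1.
rewrite /events -big_split/=; apply: eq_bigr => k _.
rewrite /= c1 mulr1.
by rewrite sum_in_slot mulr1 -natrD; congr _%:R; rewrite /busy/=; lia.
Qed.

Let total_slots_le m : total_slots m <= K%:R * K%:R.
Proof.
apply: (@le_trans _ _ (\sum_(1 <= k < K.+1) K%:R)); last first.
  by rewrite sumr_const_nat subSS subn0 -[K%:R *+ K]mulr_natl.
apply: ler_sum_nat => k /andP[k1 _].
by rewrite slotsE ler_nat cycle_slots_bound.
Qed.

Let rateT x : nmsr_rate lam law p x setT = lam + total_slots x.2.
Proof.
rewrite nmsr_rateE (_ : [set v | _] = setT); last by apply/seteqP; split.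
rewrite [X in fine X]probability_setT mulr1 -events1; congr (_ + events _ _).
by apply/funext => y; rewrite indicE in_setT.
Qed.

Let A1 x : A (cst 1%E) x = (nmsr_rate lam law p x setT)%:E.
Proof.
rewrite -rateE//; congr (A _ x); apply/funext => y.
by rewrite indicE in_setT.
Qed.

Let v := @quad R K n h.
Let sc := @shifted_count R K n h.
Let B := K%:R * (1 + H) ^+ 2.
(** As for MaxWeight, with two changes. A completion may also change the mode, so squared increments
    are bounded by [B]. A slot is idle only if fewer than K jobs of its type are present, and then
    the shifted count is at most K + H. *)
Let C := lam + K%:R * K%:R * B + 2 * (K%:R * ((K%:R + H) * K%:R)).

Let sq_bound (d : R) : - (1 + H) <= d <= 1 + H -> d ^+ 2 <= (1 + H) ^+ 2.
Proof.
by move=> dH; rewrite -subr_ge0 subr_sqr mulr_ge0//; lra.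
Qed.

(** The square is expanded around [x]; the increment of each shifted count has absolute value at
    most 1 + H, which gives [B]. The function [b] marks the type of the removed job, if any. *)
Let quad_step (x : state) (s' : seq R) m' (b : nat -> bool) :
  (forall j, (1 <= j <= K)%N -> (type_count K s' j + b j)%N = type_count K x.1 j) ->
  v (s', m') <= v x + B + \sum_(1 <= j < K.+1) 2 * sc x j * (h j m' - h j x.2)
     - \sum_(1 <= j < K.+1) (b j)%:R * (2 * sc x j).
Proof.
move=> hb; rewrite /v /quad /B.
have -> : K%:R * (1 + H) ^+ 2 = \sum_(1 <= j < K.+1) (1 + H) ^+ 2.
  by rewrite sumr_const_nat subSS subn0 mulr_natl.
rewrite -!big_split/= -sumrB; apply: ler_sum_nat => j jK.
have {}jK : (1 <= j <= K)%N by rewrite -ltnS.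
have e : shifted_count K h (s', m') j = sc x j + (h j m' - h j x.2 - (b j)%:R).
  by rewrite /sc /shifted_count/= -(hb j jK) natrD; ring.
rewrite e -/(sc x j); set d := _ - (b j)%:R.
have : d ^+ 2 <= (1 + H) ^+ 2.
  apply: sq_bound; rewrite /d.
  have := h_ge0 j m'; have := h_ge0 j x.2; have := h_le j m'; have := h_le j x.2.
  have : 0 <= ((b j)%:R : R) <= 1 by case: (b j); rewrite ?lexx ler01.
  by lra.
move: (sc x j) => q dB; have -> : (q + d) ^+ 2 = q ^+ 2 + 2 * q * d + d ^+ 2 by ring.
have -> : 2 * q * d = 2 * q * (h j m' - h j x.2) - (b j)%:R * (2 * q) by rewrite /d; ring.
by lra.
Qed.

Let drift x : valid_jobs x.1 ->
  (A (on_valid v) x <=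
   (nmsr_rate lam law p x setT * v x + C - 2 * eps * (size x.1)%:R)%:E)%E.
Proof.
move=> vx.
have sc0 k : 0 <= sc x k by exact: shifted_count_ge0.
have q0 k : 0 <= 2 * sc x k + 1 by rewrite addr_ge0// mulr_ge0.
have arr : (\int[law]_y on_valid v (rcons x.1 y, x.2) <=
   (v x + \sum_(1 <= k < K.+1) type_prob K law k * (2 * sc x k + 1))%:E)%E.
  apply: (integral_arrival_le law01) => //; try by move=> *; exact: quad_ge0.
  by move=> y _; rewrite /v quad_rcons -surjective_pairing.
rewrite (A_events (g := v)); last 2 first.
- by move=> i m' si; rewrite /on_valid/= valid_remove.
- by move=> m'; rewrite /on_valid/= vx.
apply: le_trans (leeD (lee_wpmul2l _ arr) (le_refl _)) _.
  by rewrite lee_fin ltW.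
rewrite -EFinM -EFinD lee_fin rateT {arr}.
have ev : events v x <= total_slots x.2 * (v x + B) +
    (w x.2)^-1 * (\sum_(1 <= j < K.+1) 2 * sc x j * (h j (ordS x.2) - h j x.2)) -
    \sum_(1 <= k < K.+1) (busy x k)%:R * (2 * sc x k).
  pose phi m' := v x + B + \sum_(1 <= j < K.+1) 2 * sc x j * (h j m' - h j x.2).
  have := @events_bound v x phi (fun k => 2 * sc x k).
  have -> : phi x.2 = v x + B.
    by rewrite /phi big1 ?addr0// => j _; rewrite subrr mulr0.
  rewrite {1}/phi [_ + \sum_(_ <= _ < _) _ - _]addrAC subrr add0r; apply.
    move=> k i m' kK si tk; rewrite /phi.
    have := @quad_step x (remove_job i x.1) m' (fun j => is_type K j x.1`_i)
      (fun j _ => type_count_remove K_gt0 j si).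
    rewrite [X in _ - X](sum_nat_single (k0 := k)) ?tk ?mul1r//.
    move=> j jK jk; case tj : (is_type K j _); last by rewrite mul0r.
    by move: jk; rewrite (is_type_unique K_gt0 tj tk) eqxx.
  move=> m'; rewrite /phi.
  have := @quad_step x x.1 m' (fun _ => false) (fun j _ => addn0 _).
  by rewrite [X in _ - X]big1 ?subr0// => j _; rewrite mul0r.
have psum := ler_wpM2l (ltW lam_gt0) (sum_type_prob K_gt0 law01).
have B0 : 0 <= B by rewrite mulr_ge0// exprn_ge0// addr_ge0.
have sB : total_slots x.2 * B <= K%:R * K%:R * B by rewrite ler_wpM2r.
have e1 : lam * \sum_(1 <= k < K.+1) type_prob K law k * (2 * sc x k + 1) =
   \sum_(1 <= k < K.+1) 2 * (sc x k * (lam * type_prob K law k)) +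
   lam * \sum_(1 <= k < K.+1) type_prob K law k.
  by rewrite !big_distrr/= -big_split/=; apply: eq_bigr => k _; ring.
have e2 : (w x.2)^-1 * (\sum_(1 <= j < K.+1) 2 * sc x j * (h j (ordS x.2) - h j x.2)) =
  \sum_(1 <= j < K.+1) 2 * (sc x j * ((w x.2)^-1 * (h j (ordS x.2) - h j x.2))).
  by rewrite big_distrr/=; apply: eq_bigr => k _; ring.
(* By [h_next], arrivals together with the motion of the corrector amount to at most the open slots
   minus [eps]. Open and busy slots differ only where the queue is short. *)
have key : \sum_(1 <= k < K.+1) 2 * (sc x k * (lam * type_prob K law k)) +
  \sum_(1 <= j < K.+1) 2 * (sc x j * ((w x.2)^-1 * (h j (ordS x.2) - h j x.2))) -
  \sum_(1 <= k < K.+1) (busy x k)%:R * (2 * sc x k) <=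
  2 * (K%:R * ((K%:R + H) * K%:R)) - 2 * eps * (size x.1)%:R.
  rewrite -(sum_type_count K_gt0 vx) natr_sum.
  have -> : 2 * (K%:R * ((K%:R + H) * K%:R)) = \sum_(1 <= k < K.+1) (2 * ((K%:R + H) * K%:R)) :> R.
    by rewrite sumr_const_nat subSS subn0 -[RHS]mulr_natl mulrCA.
  rewrite big_distrr/= -!big_split/= -!sumrB; apply: ler_sum_nat => k kK.
  have {}kK : (1 <= k <= K)%N by rewrite -ltnS.
  have hn := ler_wpM2l (sc0 k) (h_next x.2 kK).
  have qs : (type_count K x.1 k)%:R <= sc x k by rewrite /sc /shifted_count lerDl.
  have qe := ler_wpM2l (ltW eps_gt0) qs.
  have sl : (slots p x.2 k <= K)%N by rewrite slotsE cycle_slots_bound// (andP kK).1.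
  have hs : sc x k * ((slots p x.2 k)%:R - (busy x k)%:R) <= (K%:R + H) * K%:R.
    have [qk|qk] := leqP (slots p x.2 k) (type_count K x.1 k).
      by rewrite /busy (minn_idPl qk) subrr mulr0 mulr_ge0// addr_ge0.
    apply: ler_pM => //.
    - by rewrite subr_ge0 ler_nat geq_minl.
    - by rewrite lerD// ler_nat (leq_trans (ltnW qk)).
    - by rewrite lerBlDr -natrD ler_nat; apply: leq_trans sl (leq_addr _ _).
  by lra.
rewrite mulrDr e1 /C; rewrite e2 in ev.
move: key ev sB psum; rewrite -/v.
set s1 := \sum_(1 <= k < K.+1) 2 * (sc x k * (lam * _)).
set s2 := \sum_(1 <= j < K.+1) 2 * (sc x j * ((w x.2)^-1 * _)).
set s3 := \sum_(1 <= k < K.+1) (busy x k)%:R * _.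
set s4 := \sum_(1 <= k < K.+1) type_prob K law k.
move: s1 s2 s3 s4 (events v x) (total_slots x.2) (v x) => s1 s2 s3 s4 s5 s6 s7.
by lra.
Qed.

(** Types are counted from 0 here, to match the blocks of the cycle: block a holds the option of
    index a + 1. *)
Definition head_type (y : R) : nat := find (fun k => is_type K k y) (iota 1 K).

Let head_typeP (y : R) : 0 < y <= 1 -> (head_type y < K)%N /\ is_type K (head_type y).+1 y.
Proof.
move=> /(is_type_exists K_gt0)[k kK tk].
have hk : has (fun k => is_type K k y) (iota 1 K).
  by apply/hasP; exists k => //; rewrite mem_iota add1n ltnS.
have lt : (head_type y < K)%N by rewrite -[X in (_ < X)%N](size_iota 1) -has_find.
split=> //; have := nth_find 0%N hk.
by rewrite nth_iota.
Qed.

(** The working state of the option indexed by the type of the oldest job, which serves that type;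
    once the list is empty, the mode [m0] to be reached. [cdist] is the forward distance along the
    cycle. *)
Let target (s : seq R) : nat := if s is y :: _ then (head_type y * K)%N else m0.
Let cdist (m t : nat) : nat := ((t + n.+1 - m) %% n.+1)%N.

(* The number of transitions of a shortest way to the empty state, up to the
   overestimation of the time between two services. *)
Let d (x : state) : nat := (n.+1 * size x.1 + cdist x.2 (target x.1))%N.

Let cdist_lt m t : (cdist m t < n.+1)%N. Proof. by rewrite ltn_mod. Qed.

Let cdist_next m t : (m < n.+1)%N -> (t < n.+1)%N -> m <> t ->
  (cdist (m.+1 %% n.+1) t < cdist m t)%N.
Proof.
move=> mn tn mt; rewrite /cdist; move: mn tn; move: (n.+1) => N mn tn.
have [m1|m1] := ltnP m.+1 N.
  rewrite (modn_small m1).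
  have [tm|tm] := leqP t m.
    by rewrite !modn_small; lia.
  have -> : (t + N - m = (t - m) + N)%N by lia.
  have -> : (t + N - m.+1 = (t - m.+1) + N)%N by lia.
  by rewrite !modnDr !modn_small; lia.
have -> : m.+1 = N by lia.
rewrite modnn subn0 modnDr [X in (X < _)%N]modn_small//.
by rewrite modn_small; lia.
Qed.

Let dec (x : state) : set state := [set y | (d y < d x)%N].

Let remove_dec (x : state) i m' : (i < size x.1)%N -> dec x (remove_job i x.1, m').
Proof.
move=> si; rewrite /dec /d/= size_remove_job//.
have := cdist_lt m' (target (remove_job i x.1)).
have -> : (n.+1 * size x.1 = n.+1 * (size x.1).-1 + n.+1)%N.
  by rewrite -{1}(prednK (leq_ltn_trans (leq0n _) si)) mulnS addnC.
by move: (cdist m' _) (cdist x.2 _) (n.+1 * _)%N => a b c; lia.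
Qed.

Let invT_le (m : 'I_n.+1) : T^-1 <= (w m)^-1.
Proof. by rewrite lef_pV2 ?posrE// w_le// ltKK. Qed.

Let x0 : state := ([::], m0).

(** Either the mode is at its target and a job of the type of the oldest one completes, at rate at
    least 1, or the mode moves one step towards the target at rate at least 1 / T. A departure
    always lowers [d], because distances along the cycle are less than the weight [n.+1] of a
    job. *)
Let events_dec x : valid_jobs x.1 -> x <> x0 -> T^-1 <= events (\1_(dec x)) x.
Proof.
move=> vx xx0; rewrite -[leRHS]opprK lerNr -events_opp.
have ind1 y : dec x y -> - \1_(dec x) y = -1 :> R.
  by move=> dy; rewrite indicE mem_set.
have ind0 y : - \1_(dec x) y <= 0 :> R by rewrite oppr_le0.
have tn : (target x.1 < n.+1)%N.
  move: vx; rewrite /target; case: (x.1) => [//|y s] /= /andP[y01 _].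
  by rewrite nE ltn_mul2r K_gt0; have [] := head_typeP y01.
have [xt|/eqP xt] := eqVneq (x.2 : nat) (target x.1).
  have s0 : (0 < size x.1)%N.
    rewrite lt0n size_eq0; apply/eqP => s0; apply: xx0.
    rewrite [LHS]surjective_pairing s0; congr pair.
    by apply: val_inj; rewrite [LHS]xt s0.
  have := @events_bound (fun y => - \1_(dec x) y) x (fun=> 0) (fun=> 1).
  rewrite mulr0 subrr mulr0 addr0 add0r => h1; apply: le_trans (h1 _ _) _.
  - by move=> k i m' _ si _; rewrite ind1 ?add0r//; exact: remove_dec.
  - by move=> m'; exact: ind0.
  have [tK tk] := head_typeP (valid_nth vx s0).
  rewrite sub0r lerN2 (bigD1_seq (head_type x.1`_0).+1) ?mem_index_iota ?iota_uniq//=.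
  rewrite -[leLHS]addr0 lerD ?sumr_ge0// mulr1.
  apply: (@le_trans _ _ 1).
    by rewrite invf_le1//; exact: le_trans (w_ge1 (ltKK m0)) (w_le (ltKK m0)).
  rewrite ler1n /busy leq_min /type_count -has_count; apply/andP; split; last first.
    by apply/hasP; exists x.1`_0 => //; exact: mem_nth.
  move: xt; rewrite /target nth0; case: (x.1) s0 tK => //= y s _ tK xt.
  by rewrite slotsE xt cycle_slots_working// two_bucket_self.
have nm : ordS x.2 <> x.2.
  move=> e; apply: xt; move: (cdist_next (ltn_ord x.2) tn).
  have -> : (x.2.+1 %% n.+1)%N = x.2 by rewrite -[in RHS]e.
  by rewrite ltnn => h1; apply: contrapT => /h1.
have := @events_bound (fun y => - \1_(dec x) y) x (fun m' => - (m' == ordS x.2)%:R) (fun=> 0).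
rewrite eqxx (_ : (x.2 == _) = false); last by apply/negbTE/eqP => /esym.
rewrite oppr0 mulr0 add0r subr0 mulrN1 [X in _ - X]big1 ?subr0; last first.
  by move=> k _; rewrite mulr0.
move=> h1; apply: le_trans (h1 _ _) _; last by rewrite lerN2 invT_le.
- move=> k i m' _ si _; rewrite addr0 ind1; last exact: remove_dec.
  by rewrite lerN2; case: eqP => _; rewrite ?lexx ?ler01.
- move=> m'; case: eqP => [->|_]; last by rewrite oppr0.
  rewrite ind1//= /dec /d/= ltn_add2l; exact: cdist_next.
Qed.

Lemma cycle_positive_recurrent : positive_recurrent (nmsr_rate lam law p) x0.
Proof.
have mx0 : measurable [set x0].
  rewrite (_ : [set x0] = [set x | [set q | q = ([::], m0)] (pattern K x)]).
    exact: measurable_pattern_set.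
  apply/seteqP; split=> [x ->//|[s m] /=] [].
  by case: s => // _ ->.
have rE x E : measurable E ->
    nmsr_rate lam law p x E = fine (A (fun y => (\1_E y)%:E) x).
  by move=> mE; rewrite rateE.
have mv : measurable_fun [set: state] v by exact: measurable_quad.
have md E : measurable [set x | E (d x)].
  have md' : measurable_fun [set: state] d.
    apply: (measurable_pattern_fun (K := K)) => x y xy.
    rewrite /d (size_pattern xy); congr (_ + cdist _ _)%N; first by case: xy => _ ->.
    case: xy => xy _; rewrite /target; case: (x.1) (y.1) xy => [|a s] [|b t]//= [_ ab _].
    have hE c : head_type c = find id [seq is_type K k c | k <- iota 1 K].
      by rewrite find_map.
    by rewrite !hE ab.
  exact: (preimage_measurable md' (A := E)).
apply: (@lyapunov_recurrent _ _ A sA _ rE x0 mx0 isT v d mv _ md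
   (lam + K%:R * K%:R) C (2 * eps) T^-1 (fun k => n.+1 * k + n.+1)%N) => //.
- by move=> x; exact: quad_ge0.
- by rewrite mulr_gt0.
- by rewrite invr_gt0.
- by rewrite !addr_ge0// ?mulr_ge0 ?addr_ge0// ?exprn_ge0// ?addr_ge0// ltW.
- by move=> x _; rewrite A1 lee_fin rateT lerD2l.
- move=> x vx xx0; rewrite (A_events (g := \1_(dec x)))//.
  apply: le_trans (leeDr _ _); last first.
    rewrite mule_ge0 ?lee_fin ?(ltW lam_gt0)//; apply: integral_ge0 => y _.
    by rewrite lee_fin.
  by rewrite lee_fin events_dec.
- move=> x k _ xk; rewrite /d; apply: leq_add; last exact/ltnW/cdist_lt.
  by rewrite leq_mul2l xk orbT.
- rewrite rateT nmsr_rateE (_ : [set y | _] = set0); last by rewrite -subset0 => y.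
  rewrite measure0 mulr0 add0r.
  (* Completions may all stay at [x0], but arrivals, at rate [lam], leave it. *)
  apply: (@le_lt_trans _ _ (total_slots m0)); last by rewrite ltrDr.
  have := @events_bound (\1_[set x0]) x0 (fun=> 1) (fun=> 0).
  rewrite subrr mulr0 addr0 mulr1 (_ : (\sum_(_ <= k < _) _ * 0) = 0); last first.
    by apply: big1 => k _; rewrite mulr0.
  rewrite !subr0.
  have i1 y : \1_[set x0] y <= 1 :> R by rewrite indicE; case: (_ \in _).
  by apply=> *; exact: i1.
Qed.

End cycle_stability.

(** * Sojourn times and corrector of the cyclic policy *)

Section cycle_exists.
Context {R : realType}.
Variables (lam : R) (law : probability (measurableTypeR R) R) (L : nat).
Hypothesis lam_gt0 : 0 < lam.
Hypothesis law01 : law `]0, 1]%classic = 1%E.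
Local Notation K := (2 ^ L)%N.
Local Notation n := (2 ^ L * 2 ^ L).-1.
Let K_gt0 : (0 < K)%N. Proof. by rewrite expn_gt0. Qed.
Let nE : n.+1 = (K * K)%N. Proof. by rewrite prednK// muln_gt0 K_gt0. Qed.
Variables (th : nat -> R) (eps : R).
Hypothesis th_gt0 : forall k, (1 <= k <= K)%N -> 0 < th k.
Hypothesis th1 : \sum_(1 <= k < K.+1) th k = 1.
Hypothesis eps_gt0 : 0 < eps.
Hypothesis th_ge : forall j, (1 <= j <= K)%N ->
  lam * type_prob K law j + eps <= \sum_(1 <= k < K.+1) th k * (two_bucket L k j)%:R.

(* The time scale T is so large that the switching states, visited for one unit
   of time each, cost at most half of the slack eps. *)
Let T : R := 2 * (lam + eps) * (K%:R * K%:R) / eps + \sum_(1 <= k < K.+1) (th k)^-1 + 1.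
Let w (m : nat) : R := if (m %% K == 0)%N then T * th (m %/ K).+1 else 1.
Let load j := lam * type_prob K law j.
(** The surplus of open slots of type j over the load, with half of [eps] set aside, accumulated
    over a mean stay in state m. *)
Let gain j m : R := ((cycle_slots L m j)%:R - load j - eps / 2) * w m.

Let half : 0 < eps / 2 < eps.
Proof. by rewrite divr_gt0//= ltr_pdivrMr// ltr_pMr// ltr1n. Qed.

Let term_le (F : nat -> R) k : (forall j, (1 <= j <= K)%N -> 0 < F j) ->
  (1 <= k <= K)%N -> F k <= \sum_(1 <= j < K.+1) F j.
Proof.
move=> F0 kK; rewrite (bigD1_seq k) ?mem_index_iota ?iota_uniq//=.
rewrite -[leLHS]addr0 lerD// big_seq_cond sumr_ge0// => j /andP[+ _].
by rewrite mem_index_iota ltnS => /F0/ltW.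
Qed.

Let T0 : 0 <= 2 * (lam + eps) * (K%:R * K%:R) / eps.
Proof. by rewrite divr_ge0 ?mulr_ge0 ?(ltW eps_gt0)// addr_ge0// ltW. Qed.

(** The sum of inverses in [T] provides this bound, which keeps the sojourn times at least 1 and
    [exit_prob] at most 1. *)
Let T_th k : (1 <= k <= K)%N -> 1 <= T * th k.
Proof.
move=> kK; have tk := th_gt0 kK; rewrite -ler_pdivrMr// mul1r.
have iv j : (1 <= j <= K)%N -> 0 < (th j)^-1 by move=> jK; rewrite invr_gt0 th_gt0.
by have := @term_le (fun j => (th j)^-1) k iv kK; rewrite /T; move: T0; lra.
Qed.

Let T_ge1 : 1 <= T.
Proof.
rewrite /T lerDr addr_ge0// big_seq_cond sumr_ge0// => j /andP[+ _].
by rewrite mem_index_iota ltnS invr_ge0 => /th_gt0/ltW.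
Qed.

Let block m : (m < K * K)%N -> (1 <= (m %/ K).+1 <= K)%N.
Proof. by move=> mK; rewrite /= ltn_divLR. Qed.

Let w_ge1 m : (m < K * K)%N -> 1 <= w m.
Proof. by move=> mK; rewrite /w; case: ifP => // _; exact/T_th/block. Qed.

Let w_le m : (m < K * K)%N -> w m <= T.
Proof.
move=> mK; rewrite /w; case: ifP => // _.
rewrite -[leRHS]mulr1 ler_wpM2l ?(le_trans ler01)// -th1.
by apply: term_le => //; exact: block.
Qed.

Let load_ge0 j : 0 <= load j.
Proof. by rewrite mulr_ge0 ?type_prob_ge0// ltW. Qed.

Let load_le j : (1 <= j <= K)%N -> load j <= lam.
Proof.
move=> jK; rewrite -[leRHS]mulr1 ler_wpM2l ?(ltW lam_gt0)//.
apply: le_trans (sum_type_prob K_gt0 law01).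
rewrite (bigD1_seq j) ?mem_index_iota ?iota_uniq//=.
by rewrite -[leLHS]addr0 lerD// sumr_ge0// => i _; exact: type_prob_ge0.
Qed.

Let gain_sum j : (1 <= j <= K)%N -> 0 <= \sum_(0 <= m < K * K) gain j m.
Proof.
move=> jK; have aj := load_le jK; have aj0 := load_ge0 j.
(* A lower bound for block a: a stay [T * th a.+1] in the working state, then fewer than K switching
   states of unit stay, each losing at most [lam + eps / 2]. *)
pose lo a : R := T * (th a.+1 * (two_bucket L a.+1 j)%:R) -
   T * (load j + eps / 2) * th a.+1 - (lam + eps / 2) * K%:R.
have step a : (a < K)%N -> lo a <= \sum_(a * K <= m < a.+1 * K) gain j m.
  move=> aK; rewrite big_ltn ?ltn_pmul2r//.
  have e : gain j (a * K) = T * (th a.+1 * (two_bucket L a.+1 j)%:R) -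
     T * (load j + eps / 2) * th a.+1.
    by rewrite /gain /w modnMl eqxx mulnK// cycle_slots_working ?(andP jK).1//; ring.
  rewrite e /lo lerD2l -mulNr.
  apply: (@le_trans _ _ (\sum_((a * K).+1 <= m < a.+1 * K) - (lam + eps / 2))).
    rewrite sumr_const_nat -[leRHS]mulr_natr ler_wnM2l//; first by rewrite oppr_le0 addr_ge0 ?divr_ge0 ?ltW.
    by rewrite ler_nat mulSn; lia.
  apply: ler_sum_nat => m /andP[m1 m2].
  have mK : (m %% K == 0)%N = false.
    apply/negbTE/eqP => m0; move: m1 m2; rewrite {1 2}(divn_eq m K) m0 addn0.
    by rewrite ltn_pmul2r// ltn_pmul2r//; lia.
  rewrite /gain /w mK mulr1.
  by rewrite opprD lerD2r -[leLHS]add0r lerD// lerN2.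
rewrite big_nat_mul; apply: (@le_trans _ _ (\sum_(0 <= a < K) lo a)); last first.
  by apply: ler_sum_nat => a /andP[_ aK]; exact: step.
rewrite /lo !sumrB -!big_distrr/= sumr_const_nat subn0 -[_ *+ K]mulr_natr.
have S (F : nat -> R) : \sum_(0 <= a < K) F a.+1 = \sum_(1 <= a < K.+1) F a.
  by rewrite big_add1.
rewrite (S th) (S (fun a => th a * (two_bucket L a j)%:R)) th1 mulr1.
have tg := th_ge jK; rewrite -/(load j) in tg.
have tT := ler_wpM2l (le_trans ler01 T_ge1) tg.
(* The first summand of [T] pays for all the switching states of the cycle. *)
have Te : (lam + eps / 2) * (K%:R * K%:R) <= T * (eps / 2).
  apply: (@le_trans _ _ (2 * (lam + eps) * (K%:R * K%:R) / eps * (eps / 2))).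
    have -> : 2 * (lam + eps) * (K%:R * K%:R) / eps * (eps / 2) = (lam + eps) * (K%:R * K%:R).
      by field; rewrite gt_eqF.
    by rewrite ler_wpM2r ?mulr_ge0// lerD2l ltW// (andP half).2.
  rewrite ler_wpM2r ?(ltW (andP half).1)//.
  have : 0 <= \sum_(1 <= k < K.+1) (th k)^-1.
    rewrite big_seq_cond sumr_ge0// => k /andP[+ _].
    by rewrite mem_index_iota ltnS invr_ge0 => /th_gt0/ltW.
  by rewrite /T; lra.
by lra.
Qed.

Let c : R := (K%:R + lam + eps) * T.

Let gain_bound j m : (1 <= j <= K)%N -> (m < K * K)%N -> - c <= gain j m <= c.
Proof.
move=> jK mK; rewrite -ler_norml /gain normrM /c.
have w0 : 0 <= w m by rewrite (le_trans ler01)// w_ge1.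
rewrite ler_pM//; last by rewrite ger0_norm// w_le.
have aj := load_le jK; have aj0 := load_ge0 j.
have s0 : 0 <= (cycle_slots L m j)%:R :> R by [].
have s1 : (cycle_slots L m j)%:R <= K%:R :> R by rewrite ler_nat cycle_slots_bound// (andP jK).1.
have /andP[e0 e1] := half; move: (eps / 2) e0 e1 => e2 e0 e1.
by rewrite ler_norml; lra.
Qed.

(** Partial sums of the gains along the cycle satisfy [h_next] with equality, except at the end of
    the cycle, where [gain_sum] gives the inequality. The added constant makes them nonnegative;
    types out of range get 0 so that the bounds hold for every index. *)
Let h j (m : 'I_n.+1) : R :=
  if (1 <= j <= K)%N then K%:R * K%:R * c + \sum_(0 <= l < m) gain j l else 0.

Let c_ge0 : 0 <= c.
Proof.
apply: mulr_ge0; last exact: le_trans ler01 T_ge1.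
by rewrite !addr_ge0// ltW.
Qed.

Let h_itv j m : 0 <= h j m <= 2 * (K%:R * K%:R * c).
Proof.
have c0 := c_ge0.
have KK0 : 0 <= K%:R * K%:R * c by apply: mulr_ge0 => //; exact: mulr_ge0.
rewrite /h; case: ifP => jK; last by apply/andP; split=> //; exact: mulr_ge0.
have mK : (m <= K * K)%N by rewrite -[X in (_ <= X)%N]nE ltnW.
suff : - (K%:R * K%:R * c) <= \sum_(0 <= l < m) gain j l <= K%:R * K%:R * c by lra.
have mc : m%:R * c <= K%:R * K%:R * c by rewrite ler_wpM2r// -natrM ler_nat.
have b l : (0 <= l < m)%N -> - c <= gain j l <= c.
  by move=> /andP[_ lm]; rewrite gain_bound// (leq_trans lm).
have := @ler_sum_nat R 0 m (fun=> - c) (gain j) (fun l lm => (andP (b l lm)).1).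
have := @ler_sum_nat R 0 m (gain j) (fun=> c) (fun l lm => (andP (b l lm)).2).
rewrite !sumr_const_nat subn0 -(mulr_natl c) -(mulr_natl (- c)) mulrN.
by lra.
Qed.

Let h_next j (m : 'I_n.+1) : (1 <= j <= K)%N ->
  (w m)^-1 * (h j (ordS m) - h j m) <= (cycle_slots L m j)%:R - load j - eps / 2.
Proof.
move=> jK; have mK : (m < K * K)%N by rewrite -[X in (_ < X)%N]nE.
have w0 : 0 < w m by rewrite (lt_le_trans ltr01)// w_ge1.
rewrite mulrC ler_pdivrMr// -/(gain j m) /h jK opprD addrACA subrr add0r /=.
have e : \sum_(0 <= l < m.+1) gain j l = \sum_(0 <= l < m) gain j l + gain j m.
  by rewrite big_nat_recr.
have [mn|mn] := ltnP m.+1 n.+1.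
  by rewrite (modn_small mn) e addrAC subrr add0r.
have mE : m.+1 = n.+1 by apply/eqP; rewrite eqn_leq mn ltn_ord.
rewrite mE modnn big_geq// sub0r.
have : 0 <= \sum_(0 <= l < m.+1) gain j l by rewrite mE nE; exact: gain_sum.
by rewrite e; lra.
Qed.

Lemma enmsr_stable_of_mixture : enmsr_stable lam law L.
Proof.
have nm := cycle_policy_is_nmsr w_ge1.
exists n, (cycle_policy L w); split; first exact: cycle_policy_two_bucket.
move=> m0; apply: (@cycle_positive_recurrent _ lam law L lam_gt0 law01 w T
  (2 * (K%:R * K%:R * c)) (eps / 2) h m0 w_ge1 w_le).
- by move=> k m; case/andP: (h_itv k m).
- by move=> k m; case/andP: (h_itv k m).
- by rewrite divr_gt0.
- by [].
- by [].
- exact: nmsr_compl nm.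
- exact: nmsr_compl1 nm.
- by move=> m phi; exact: sum_modulating.
- exact: h_next.
Qed.

End cycle_exists.

Lemma enmsr_stable_of_load (R : realType) (lam : R)
    (law : probability (measurableTypeR R) R) (L : nat) :
  0 < lam -> law `]0, 1]%classic = 1%E ->
  (forall i j, (1 <= i <= j)%N -> (j <= 2 ^ L)%N ->
     type_prob (2 ^ L) law j <= type_prob (2 ^ L) law i) ->
  \sum_(1 <= k < (2 ^ L).+1) k%:R * (lam * type_prob (2 ^ L) law k) < (2 ^ L)%:R ->
  enmsr_stable lam law L.
Proof.
move=> lam_gt0 law01 pmon load.
have [k kK|i j ij jK|th [eps [th_gt0 th1 eps_gt0 th_ge]]] :=
  @two_bucket_decomposition R L (fun k => lam * type_prob (2 ^ L) law k) _ _ load.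
- by rewrite mulr_ge0 ?type_prob_ge0// ltW.
- by rewrite ler_pM2l// pmon.
exact: (enmsr_stable_of_mixture lam_gt0 law01 th_gt0 th1 eps_gt0 th_ge).
Qed.

(** * Necessity of the load condition *)

Section transition_integral.
Context d1 (T1 : measurableType d1) d2 (T2 : measurableType d2) (R : realType).
Local Open Scope ereal_scope.

Lemma integral_mrestr d (T : measurableType d) (mu : {measure set T -> \bar R}) (E : set T)
    (mE : measurable E) (f : T -> \bar R) :
  measurable_fun [set: T] f -> (forall x, 0 <= f x) ->
  \int[mrestr mu mE]_x f x = \int[mu]_(x in E) f x.
Proof.
move=> mf f0.
rewrite [LHS](ge0_negligible_integral (N := ~` E))//; last 2 first.
- exact: measurableC.
- by rewrite /= /mrestr setICl measure0.
rewrite setTD setCK; apply: eq_measure_integral => A mA AE.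
by rewrite /= /mrestr setIidl.
Qed.

Variables (mu : probability T1 R) (E : set T1) (Z : T1 -> T2) (phi : T1 * @coins -> T2).
Hypotheses (mE : measurable E) (mZ : measurable_fun [set: T1] Z).
Hypothesis mphi : measurable_fun [set: T1 * coins] phi.

Let mEC : measurable (E `*` [set: coins]).
Proof. exact: measurableX. Qed.

(** An arbitrary jump process comes without coins. [sampled_law] attaches fresh coins to the
    present; when the two laws agree, integrals over the next step can be computed with the
    sampler. *)
Definition restricted_law : {measure set T2 -> \bar R} := mpush (mrestr mu mE) mZ.

Definition sampled_law : {measure set T2 -> \bar R} :=
  mpush (mrestr (mu \x @coin R) mEC) mphi.

Lemma restricted_lawE B : restricted_law B = mu (E `&` Z @^-1` B).
Proof. by rewrite mpushE/= /mrestr setIC. Qed.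

Lemma sampled_lawE B :
  sampled_law B = \int[mu]_(w in E) @coin R [set u | B (phi (w, u))].
Proof.
rewrite mpushE/= /mrestr/= /product_measure1 [RHS]integral_mkcond.
apply: eq_integral => w _; rewrite /= patchE; case: ifPn => wE.
  congr (coin _); apply/seteqP; split=> u; rewrite /xsection/= inE/=; first by case.
  by move=> Bu; split=> //; split=> //; rewrite inE in wE.
rewrite (_ : xsection _ _ = set0) ?measure0//; apply/seteqP; split=> u //.
rewrite /xsection/= inE/= => -[_ [wE' _]].
by move/negP: wE; rewrite inE.
Qed.

Lemma integral_transition (g : T2 -> \bar R) :
  (forall B, measurable B -> restricted_law B = sampled_law B) ->
  measurable_fun [set: T2] g -> (forall y, 0 <= g y) ->
  \int[mu]_(w in E) g (Z w) = \int[mu]_(w in E) \int[@coin R]_u g (phi (w, u)).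
Proof.
move=> m12 mg g0.
have mgZ : measurable_fun [set: T1] (g \o Z) by exact: measurableT_comp.
have mgp : measurable_fun [set: T1 * coins] (g \o phi) by exact: measurableT_comp.
have h1 := integral_mrestr mu mE mgZ (fun x => g0 _).
have h2 := integral_mrestr (mu \x @coin R) mEC mgp (fun x => g0 _).
transitivity (\int[restricted_law]_y g y).
  by rewrite /restricted_law ge0_integral_mpush// -h1.
transitivity (\int[sampled_law]_y g y).
  by apply: eq_measure_integral => B mB _; exact: m12.
transitivity (\int[mu \x @coin R]_(z in E `*` [set: coins]) (g \o phi) z).
  by rewrite /sampled_law ge0_integral_mpush// -h2.
pose G := (g \o phi) \_ (E `*` [set: coins]).
have mG : measurable_fun [set: T1 * coins] G.
  exact/(measurable_restrictT _ mEC)/measurable_funTS.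
have G0 z : 0 <= G z.
  rewrite /G patchE.
  case: (z \in _).
    exact: g0.
  exact: le_refl.
rewrite [LHS]integral_mkcond -/G.
rewrite (@fubini_tonelli1 _ _ _ _ _ mu (@coin R) G mG G0).
rewrite [RHS]integral_mkcond; apply: eq_integral => w _; rewrite /fubini_F patchE.
have GE u : G (w, u) = if w \in E then g (phi (w, u)) else 0.
  by rewrite /G patchE in_setX in_setT andbT.
case: ifPn => wE.
  by apply: eq_integral => u _; rewrite GE wE.
by apply: integral0_eq => u _; rewrite GE (negbTE wE).
Qed.

End transition_integral.

(** * Excursions away from the initial state *)

Section excursion.
Context {R : realType} {N : nat}.
Local Notation state := (state R N).
Local Open Scope ereal_scope.
Variables (rate : state -> set state -> R) (x0 : state).
Context d (Omega : measurableType d).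
Variables (P : probability Omega R) (Y : nat -> Omega -> state) (H : nat -> Omega -> R).
Hypothesis jump : is_jump_process rate x0 P Y H.
Variables (r : state -> R) (F : state * @coins -> state).
Hypothesis mr : measurable_fun [set: state] r.
Hypothesis r_gt0 : forall x, (0 < r x)%R.
Hypothesis mF : measurable_fun [set: state * coins] F.
Hypothesis rateT : forall x, rate x setT = r x.
Hypothesis rateE : forall x B, measurable B ->
  rate x B = (r x * fine (@coin R [set u | B (F (x, u))]))%R.
Variable G : set state.
Hypothesis mG : measurable G.

Let mY n : measurable_fun [set: Omega] (Y n). Proof. by have [] := jump. Qed.
Let mH n : measurable_fun [set: Omega] (H n). Proof. by have [] := jump. Qed.

Definition excursion n : set Omega := [set w | forall i, (1 <= i <= n)%N -> G (Y i w)].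
Local Notation E := excursion.

Let excursion_past n (B : set state) (t : R) : measurable B -> (0 <= t)%R ->
  P (E n `&` [set w | (t < H n w)%R /\ B (Y n.+1 w)]) =
  \int[P]_(w in E n) (expR (- (r (Y n w) * t)) *
     fine (@coin R [set u | B (F (Y n w, u))]))%:E.
Proof.
move=> mB t0; have [_ _ _ /(_ n (fun i => if i is _.+1 then G else setT) (fun=> setT) B t)] := jump.
rewrite (_ : [set w | _ /\ _] = E n); last first.
  apply/seteqP; split=> [w [h _] [|i]// ni|w h]; first exact: (h i.+1).
  by split=> // -[//|i] ni; exact: h.
move=> -> //; last by case.
apply: eq_integral => w _; rewrite rateT rateE//; congr (_ * _)%:E.
by rewrite mulrC mulKf// gt_eqF.
Qed.

Lemma measurable_excursion n : measurable (E n).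
Proof.
rewrite (_ : E n = \bigcap_(i in [set i | (1 <= i <= n)%N]) (Y i @^-1` G)).
  by apply: bigcap_measurableType => i _; exact: preimage_measurable.
by apply/seteqP; split.
Qed.
Let mE := measurable_excursion.

Let coinT : fine (@coin R [set: coins]) = 1%R.
Proof. by rewrite [X in fine X]probability_setT. Qed.

(** The holding times are constrained only through their law, so they are positive only almost
    surely. *)
Let hold_le0 n : P [set w | ~ (0 < H n w)%R] = 0.
Proof.
have mp : measurable [set w | (0 < H n w)%R] by exact: measurable_gt.
have [_ _ _ /(_ n (fun=> setT) (fun=> setT) setT 0%R)] := jump.
rewrite (_ : [set w | _ /\ _] = setT); last by apply/seteqP; split.
rewrite /= setTI (_ : [set w | _ /\ _] = [set w | (0 < H n w)%R]); last first.
  by apply/seteqP; split=> w //= [].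
move=> /(_ (fun=> measurableT) (fun=> measurableT) measurableT (lexx _)) e.
rewrite (_ : [set w | ~ _] = ~` [set w | (0 < H n w)%R])//.
rewrite [LHS]probability_setC// [X in _ - X]e.
under eq_integral do rewrite mulr0 oppr0 expR0 mul1r rateT divff ?gt_eqF//.
by rewrite integral_cst//= mul1e [X in _ - X]probability_setT subee.
Qed.

Let hold_gt0 n (D : set Omega) : measurable D ->
  P (D `&` [set w | (0 < H n w)%R]) = P D.
Proof.
move=> mD; have mp : measurable [set w | (0 < H n w)%R] by exact: measurable_gt.
rewrite [RHS](measureDI P mD mp) [X in _ = X + _](_ : _ = 0) ?add0e//.
apply/le_anti; rewrite measure_ge0 andbT -(hold_le0 n).
apply: le_measure; rewrite ?inE; [exact: measurableD|exact: measurableC|].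
by move=> w [].
Qed.

Lemma next_integral n (g : state -> \bar R) :
  measurable_fun [set: state] g -> (forall x, 0 <= g x) ->
  \int[P]_(w in E n) g (Y n.+1 w) =
  \int[P]_(w in E n) \int[@coin R]_u g (F (Y n w, u)).
Proof.
move=> mg g0.
have mphi : measurable_fun [set: Omega * coins] (fun z => F (Y n z.1, z.2)).
  apply: (measurableT_comp mF); apply: measurable_fun_pair => //.
  exact: measurableT_comp.
apply: (@integral_transition _ _ _ _ _ P (E n) (Y n.+1) _ (mE n) (mY n.+1) mphi g) => // B mB.
rewrite restricted_lawE sampled_lawE.
have mYB : measurable (Y n.+1 @^-1` B) by exact: preimage_measurable.
rewrite -(@hold_gt0 n); last exact: measurableI.
rewrite -setIA (_ : Y n.+1 @^-1` B `&` _ = [set w | (0 < H n w)%R /\ B (Y n.+1 w)]); last first.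
  by apply/seteqP; split=> w [].
rewrite excursion_past//; apply: eq_integral => w _.
rewrite mulr0 oppr0 expR0 mul1r fineK// fin_num_measure//.
have mf : measurable_fun [set: coins] (fun u => F (Y n w, u)).
  by apply: (measurableT_comp mF); exact: measurable_fun_pair.
exact: (preimage_measurable mf).
Qed.

(** The absolute value makes the integrand nonnegative everywhere and changes it only on a null set.
    The two laws of the holding time are identified by their tails. *)
Lemma hold_integral n :
  \int[P]_(w in E n) `|H n w|%:E = \int[P]_(w in E n) (r (Y n w))^-1%:E.
Proof.
have mphi : measurable_fun [set: Omega * coins]
    (fun z => hold z.2 / r (Y n z.1) : measurableTypeR R)%R.
  apply: measurable_funM; first by apply: (measurableT_comp measurable_hold).
  apply: measurable_inv_ge0; last by move=> z; exact: ltW.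
  by apply: (measurableT_comp mr); apply: (measurableT_comp (mY n)).
have mg : measurable_fun [set: measurableTypeR R] (fun y : R => `|y|%:E).
  by apply/measurable_EFinP; exact: normr_measurable.
have := @integral_transition _ Omega _ (measurableTypeR R) R P (E n) (H n) _ (mE n)
  (mH n) mphi (fun y : R => `|y|%:E) _ mg (fun y => _).
move=> ->; last 2 first; [|by move=> y; rewrite lee_fin|].
- apply: real_law_unique; last first.
    by rewrite restricted_lawE preimage_setT setIT ltey_eq fin_num_measure.
  move=> t; rewrite restricted_lawE sampled_lawE.
  have -> : H n @^-1` `]t, +oo[%classic = [set w | (t < H n w)%R].
    by apply/seteqP; split=> w /=; rewrite in_itv/= andbT.
  have cE w : [set u | `]t, +oo[%classic (hold u / r (Y n w))%R] =
      [set u | (t * r (Y n w) < hold u)%R] :> set coins.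
    by apply/seteqP; split=> u /=; rewrite in_itv/= andbT ltr_pdivlMr.
  have [t0|t0] := leP 0%R t.
    have := @excursion_past n setT t measurableT t0.
    rewrite (_ : [set w | _ /\ _] = [set w | (t < H n w)%R]); last by apply/seteqP; split=> w //= [].
    move=> ->; apply: eq_integral => w _.
    by rewrite coinT mulr1 cE coin_hold ?mulr_ge0 ?(ltW (r_gt0 _))// mulrC.
  (* For negative [t] both tails carry the whole mass of [E n]. *)
  rewrite -(@hold_gt0 n); last by apply: measurableI => //; exact: measurable_gt.
  rewrite -setIA (_ : [set w | (t < H n w)%R] `&` _ = [set w | (0 < H n w)%R]); last first.
    by apply/seteqP; split=> [w []//|w /= h]; split=> //; exact: lt_trans h.
  rewrite hold_gt0//.
  under eq_integral do rewrite cE.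
  rewrite -[LHS]mul1e -(integral_cst P (mE n)); apply: eq_integral => w _.
  rewrite (_ : [set u | _] = setT) ?[RHS]probability_setT//.
  apply/seteqP; split=> u //= _; apply: lt_le_trans (hold_ge0 u).
  by rewrite nmulr_rlt0.
apply: eq_integral => w _.
transitivity (\int[@coin R]_u ((r (Y n w))^-1%:E * (hold u)%:E)).
  apply: eq_integral => u _; rewrite ger0_norm ?divr_ge0 ?hold_ge0 ?(ltW (r_gt0 _))//.
  by rewrite /= mulrC EFinM.
rewrite ge0_integralZl ?integral_hold ?mule1//.
- by apply/measurable_EFinP; exact: measurable_hold.
- by move=> u _; rewrite lee_fin hold_ge0.
- by rewrite lee_fin invr_ge0 ltW.
Qed.

Section integrable_return.
Hypothesis Gx0 : ~ G x0.
Hypothesis finite_return : \int[P]_w return_time x0 Y H w < +oo.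

Let rt := return_time x0 Y H.
Let bad : set Omega := \bigcup_n [set w | ~ (0 < H n w)%R].

Let mbad : measurable bad.
Proof.
apply: bigcupT_measurable => n; rewrite (_ : [set w | _] = ~` [set w | (0 < H n w)%R])//.
by apply: measurableC; exact: measurable_gt.
Qed.

Let bad0 : P bad = 0.
Proof.
apply: measure_negligible => //; apply: negligible_bigcup => n.
apply/negligibleP; last exact: hold_le0.
rewrite (_ : [set w | _] = ~` [set w | (0 < H n w)%R])//.
by apply: measurableC; exact: measurable_gt.
Qed.

Let good_hold w i : ~ bad w -> (0 <= H i w)%R.
Proof. by move=> b; rewrite ltW//; apply: contrapT => h; apply: b; exists i. Qed.

(** [return_time] may be negative where holding times are, so the hypothesis is transferred to its
    positive part: the negative part vanishes off the null set [bad]. *)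
Let finite_return_pos : \int[P]_w rt^\+ w < +oo.
Proof.
suff neg0 : \int[P]_w rt^\- w = 0.
  by move: finite_return; rewrite integralE -/rt neg0 sube0.
apply/le_anti; rewrite integral_ge0// andbT.
apply: (@le_trans _ _ (\int[P]_w (cst +oo \_ bad) w)); last first.
  by rewrite -integral_mkcond integral_cst//= [X in _ * X]bad0 mule0.
apply: integral_le => // w _; rewrite patchE; case: ifPn => wb; first by rewrite leey.
have {}wb : ~ bad w by move=> h; move/negP: wb; apply; rewrite inE.
rewrite funenegE ge_max lexx andbT oppe_le0; apply: le_ereal_inf_tmp => _ [n _ <-].
by rewrite lee_fin sumr_ge0// => i _; exact: good_hold.
Qed.

(** Time spent before the n-th jump while the excursion lasts, the initial stay excluded. As [x0]
    lies outside [G], the excursion is over at the return, whence [time_le]. *)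
Let time (n : nat) (w : Omega) : \bar R :=
  \sum_(1 <= i < n) ((fun w => `|H i w|%:E) \_ (E i)) w.

Let time_le n w : ~ bad w -> time n w <= rt^\+ w.
Proof.
move=> wb; rewrite funeposE le_max; apply/orP; left.
apply: le_ereal_inf_tmp => _ [m [Ym [j jm _]] <-].
have m0 : (0 < m)%N by exact: leq_ltn_trans jm.
have notE i : (m <= i)%N -> ~ E i w.
  by move=> mi /(_ m); rewrite m0 mi => /(_ isT); rewrite Ym.
apply: (@le_trans _ _ (\sum_(i < minn n m) H i w)%:E); last first.
  rewrite lee_fin -!(big_mkord xpredT (fun i => H i w)).
  rewrite (big_cat_nat (n := minn n m) (p := m)) ?geq_minr//= lerDl sumr_ge0// => i _.
  exact: good_hold.
rewrite /time; elim: n => [|n IH]; first by rewrite big_geq// min0n big_ord0.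
case: n IH => [|n] IH.
  by rewrite big_geq// lee_fin sumr_ge0// => i _; exact: good_hold.
rewrite big_nat_recr//=; have [nm|mn] := ltnP n.+1 m; last first.
  rewrite patchE ifF ?adde0; last by apply/negbTE/negP; rewrite inE; exact: notE.
  by move: IH; rewrite (minn_idPr mn) (minn_idPr (leqW mn)).
rewrite (minn_idPl nm) (minn_idPl (ltnW nm)) in IH *.
rewrite big_ord_recr/= EFinD leeD// patchE; have h0 := good_hold n.+1 wb.
by case: ifP => _; rewrite lee_fin ?ger0_norm.
Qed.

Lemma excursion_time : exists I : R, forall n,
  \sum_(1 <= i < n) \int[P]_(w in E i) (r (Y i w))^-1%:E <= I%:E.
Proof.
have r0 : 0 <= \int[P]_w rt^\+ w by exact: integral_ge0.
exists (fine (\int[P]_w rt^\+ w)) => n; rewrite fineK; last first.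
  by rewrite ge0_fin_numE.
have mHi i : measurable_fun [set: Omega] (fun w => `|H i w|%:E).
  by apply/measurable_EFinP; apply: measurableT_comp => //; exact: normr_measurable.
have mp i : measurable_fun [set: Omega] ((fun w => `|H i w|%:E) \_ (E i)).
  exact/(measurable_restrictT _ (mE i))/measurable_funTS.
have p0 i w : 0 <= ((fun w => `|H i w|%:E) \_ (E i)) w.
  by rewrite patchE; case: ifP => // _; rewrite lee_fin.
have -> : \sum_(1 <= i < n) \int[P]_(w in E i) (r (Y i w))^-1%:E = \int[P]_w time n w.
  rewrite ge0_integral_sum//; apply: eq_bigr => i _.
  by rewrite -integral_mkcond hold_integral.
rewrite (@ge0_negligible_integral _ _ _ P _ bad)//.
- rewrite setTD.
  apply: le_trans (_ : \int[P]_(w in ~` bad) rt^\+ w <= _).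
    by apply: integral_le => w wb; [exact: sume_ge0|exact: time_le].
  rewrite integral_mkcond; by apply: integral_le => w _; rewrite patchE; case: ifP => // _; exact: funepos_ge0.
- by apply: emeasurable_sum => i.
- by move=> w _; exact: sume_ge0.
Qed.

(** On an excursion that never ends the return time is infinite, so this event has probability 0. *)
Lemma excursion_vanish : P \o E @ \oo --> 0.
Proof.
have nE : nonincreasing_seq E.
  apply/nonincreasing_seqP => n; apply/subsetPset => w h i /andP[i1 ni].
  by apply: h; rewrite i1 ltnW.
have mcap : measurable (\bigcap_n E n) by exact: bigcapT_measurable.
have := @nonincreasing_cvg_mu _ _ _ P E _ mE mcap nE.
rewrite [X in _ --> X](_ : _ = 0); first by apply; rewrite ltey_eq fin_num_measure.
apply: contrapT => h.
have p0 : 0 < P (\bigcap_n E n) by rewrite lt0e measure_ge0 andbT; apply/eqP.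
have : \int[P]_(w in \bigcap_n E n) +oo <= \int[P]_w rt^\+ w.
  rewrite integral_mkcond; apply: integral_le => w _; rewrite patchE; case: ifPn => // wE;
    try exact: funepos_ge0.
  rewrite funeposE le_max; apply/orP; left.
  apply: le_ereal_inf_tmp => _ [m [Ym [j jm _]] <-].
  move: wE; rewrite inE => /(_ m I m) wE; exfalso; apply: Gx0; rewrite -Ym.
  by apply: wE; rewrite leqnn andbT (leq_ltn_trans _ jm).
rewrite integral_cst//= gt0_mulye// leye_eq => /eqP e.
by move: finite_return_pos; rewrite e.
Qed.

End integrable_return.
End excursion.

(** * A criterion against positive recurrence *)

Section not_recurrent.
Context {R : realType} {N : nat}.
Local Notation state := (state R N).
Local Open Scope ereal_scope.
Variables (rate : state -> set state -> R) (x0 : state).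
Variables (r : state -> R) (F : state * @coins -> state).
Hypothesis mr : measurable_fun [set: state] r.
Hypothesis r_gt0 : forall x, (0 < r x)%R.
Hypothesis mF : measurable_fun [set: state * coins] F.
Hypothesis rateT : forall x, rate x setT = r x.
Hypothesis rateE : forall x B, measurable B ->
  rate x B = (r x * fine (@coin R [set u | B (F (x, u))]))%R.
Variable G : set state.
Hypothesis mG : measurable G.
Hypothesis Gx0 : ~ G x0.

Section step.
Context d (Omega : measurableType d).
Variables (P : probability Omega R) (Y : nat -> Omega -> state) (H : nat -> Omega -> R).
Hypothesis jump : is_jump_process rate x0 P Y H.
Local Notation E := (excursion Y G).

Let mY n : measurable_fun [set: Omega] (Y n). Proof. by have [] := jump. Qed.
Let mE n : measurable (E n). Proof. exact: (measurable_excursion jump mG). Qed.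

Let minv n : measurable_fun [set: Omega] (fun w => (r (Y n w))^-1%:E).
Proof.
apply/measurable_EFinP; apply: measurable_inv_ge0 => [|w]; last exact: ltW.
exact: measurableT_comp.
Qed.

(** The integrand is 0 on paths that leave [G] at the next step, so they may be added or dropped. *)
Let excursionS (g : state -> R) n : (forall x, (0 <= g x)%R) -> (forall x, ~ G x -> g x = 0%R) ->
  \int[P]_(w in E n) (g (Y n.+1 w))%:E = \int[P]_(w in E n.+1) (g (Y n.+1 w))%:E.
Proof.
move=> g0 gG; rewrite integral_mkcond [RHS]integral_mkcond; apply: eq_integral => w _.
rewrite !patchE; have [Gw|Gw] := pselect (G (Y n.+1 w)); last first.
  by rewrite gG//; do 2 case: ifP => // _.
congr (if _ then _ else _); apply/idP/idP; rewrite !inE => h i /andP[i1].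
  by rewrite leq_eqVlt => /predU1P[->//|ni]; apply: h; rewrite i1.
by move=> ni; apply: h; rewrite i1 leqW.
Qed.

Lemma excursion_step (g : state -> R) (c : R) n :
  measurable_fun [set: state] g -> (forall x, (0 <= g x)%R) ->
  (forall x, ~ G x -> g x = 0%R) -> (0 <= c)%R ->
  (forall x, G x -> (g x)%:E <= \int[@coin R]_u (g (F (x, u)))%:E + (c / r x)%:E) ->
  (0 < n)%N ->
  \int[P]_(w in E n) (g (Y n w))%:E <= \int[P]_(w in E n.+1) (g (Y n.+1 w))%:E +
    c%:E * \int[P]_(w in E n) (r (Y n w))^-1%:E.
Proof.
move=> mg g0 gG c0 drift n0.
have mge : measurable_fun [set: state] (EFin \o g) by exact/measurable_EFinP.
have mphi : measurable_fun [set: Omega * coins] (fun z => F (Y n z.1, z.2)).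
  apply: (measurableT_comp mF); apply: measurable_fun_pair => //.
  exact: measurableT_comp.
pose J w := \int[@coin R]_u (g (F (Y n w, u)))%:E.
have mJ : measurable_fun [set: Omega] J.
  apply: (@measurable_fun_fubini_tonelli_F _ _ _ _ _ (@coin R)
    (fun z => (g (F (Y n z.1, z.2)))%:E)) => //.
    exact: (measurableT_comp mge).
  by move=> z; rewrite lee_fin.
have J0 w : 0 <= J w by apply: integral_ge0 => u _; rewrite lee_fin.
apply: (@le_trans _ _ (\int[P]_(w in E n) (J w + c%:E * (r (Y n w))^-1%:E))).
  apply: integral_le => w Ew; first by rewrite lee_fin.
  by rewrite -EFinM; apply: drift; apply: Ew; rewrite n0 leqnn.
have i0 w : 0 <= (r (Y n w))^-1%:E by rewrite lee_fin invr_ge0 ltW.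
rewrite ge0_integralD//; last 3 first.
- exact: measurable_funTS.
- by move=> w _; rewrite mule_ge0// lee_fin.
- by apply: measurable_funTS; exact: measurable_funeM.
rewrite ge0_integralZl//; last exact: measurable_funTS.
rewrite leeD// -excursionS//.
have := @next_integral _ _ _ _ _ _ _ _ _ jump _ _ r_gt0 mF rateT rateE _ mG n (EFin \o g) mge.
by rewrite /= => ->// x; rewrite lee_fin.
Qed.

Lemma excursion_start (g : state -> R) : measurable_fun [set: state] g ->
  (forall x, (0 <= g x)%R) -> (forall x, ~ G x -> g x = 0%R) ->
  \int[P]_(w in E 1%N) (g (Y 1%N w))%:E = \int[@coin R]_u (g (F (x0, u)))%:E.
Proof.
move=> mg g0 gG.
have mge : measurable_fun [set: state] (EFin \o g) by exact/measurable_EFinP.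
have := @next_integral _ _ _ _ _ _ _ _ _ jump _ _ r_gt0 mF rateT rateE _ mG 0 (EFin \o g) mge.
rewrite /= excursionS// => ->; last by move=> x; rewrite lee_fin.
have E0 : E 0%N = setT by apply/seteqP; split=> // w _ i /andP[]; case: i.
have [_ _ Y0 _] := jump.
under eq_integral do rewrite Y0.
by rewrite integral_cst//= E0 [X in _ * X]probability_setT mule1.
Qed.

End step.

Variables (W : state -> R) (e : R).
Hypothesis mW : measurable_fun [set: state] W.
Hypothesis W_ge0 : forall x, (0 <= W x)%R.
Hypothesis W_off : forall x, ~ G x -> W x = 0%R.
Hypothesis W_drift : forall x, G x -> (W x)%:E <= \int[@coin R]_u (W (F (x, u)))%:E.
Hypothesis W_cut : forall (M : nat) x, G x -> (Num.min (W x) M%:R)%:E <=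
  \int[@coin R]_u (Num.min (W (F (x, u))) M%:R)%:E + (1 / r x)%:E.
Hypothesis e_gt0 : (0 < e)%R.
Hypothesis W_start : e%:E <= \int[@coin R]_u (W (F (x0, u)))%:E.

(* By W_drift, the mean of W at the n-th step of an excursion stays above e; by
   W_cut, truncated at any level M it is at most the mean time that the excursion
   still takes, which tends to 0 if the return time is integrable. *)
Lemma not_positive_recurrent : ~ positive_recurrent rate x0.
Proof.
move=> [d [T0 [P [Y [H [jump finite_return]]]]]].
pose E := excursion Y G.
have mE n : measurable (E n) by exact: (measurable_excursion jump mG).
have mY n : measurable_fun [set: T0] (Y n) by have [] := jump.
have lower n : e%:E <= \int[P]_(w in E n.+1) (W (Y n.+1 w))%:E.
  elim: n => [|n IH]; first by rewrite (excursion_start jump).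
  apply: le_trans IH _.
  have := @excursion_step _ _ _ _ _ jump W 0 n.+1 mW W_ge0 W_off (lexx _).
  rewrite mul0e adde0; apply=> // x Gx; rewrite mul0r adde0; exact: W_drift.
have [T hI] := excursion_time jump mr r_gt0 rateT rateE mG Gx0 finite_return.
pose b n := \int[P]_(w in E n) (r (Y n w))^-1%:E.
have b0 n : 0 <= b n.
  by apply: integral_ge0 => w _; rewrite lee_fin invr_ge0 ltW.
have [c bc] : exists c : nat -> R, forall n, (0 < n)%N -> b n = (c n)%:E.
  exists (fun n => fine (b n)) => n n0; rewrite fineK// ge0_fin_numE//.
  apply: le_lt_trans (ltry T); apply: le_trans (hI n.+1).
  rewrite big_nat_recr//=; apply: leeDr; apply: sume_ge0 => i _; exact: b0.
have c0 n : (0 < n)%N -> (0 <= c n)%R by move=> n0; rewrite -lee_fin -bc.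
(* The mean holding times along the excursion have a finite sum, by [excursion_time]; from step [n0]
   on, they amount to at most e / 2. *)
have [n0 [pos_n0 tail]] : exists n0, (0 < n0)%N /\
    forall n, (\sum_(n0 <= i < n) c i <= e / 2)%R.
  pose S := [set (\sum_(1 <= i < n) c i)%R | n in [set: nat]].
  have supS : has_sup S.
    split; first by exists (\sum_(1 <= i < 0) c i)%R, 0%N.
    exists T => _ [n _ <-]; rewrite -lee_fin -sumEFin; apply: le_trans (hI n).
    rewrite le_eqVlt; apply/orP; left; apply/eqP; apply: eq_big_nat => i /andP[i1 _].
    by rewrite -bc.
  have e2 : (0 < e / 2)%R by rewrite divr_gt0.
  have [_ [n _ <-] hn] := sup_adherent e2 supS.
  exists n.+1; split=> // m; have [mn|nm] := leqP m n.+1.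
    by rewrite big_geq// ltW.
  have : (\sum_(1 <= i < m) c i <= sup S)%R by apply: ub_le_sup; [case: supS|exists m].
  have : (\sum_(1 <= i < n) c i <= \sum_(1 <= i < n.+1) c i)%R.
    case: n {hn nm} => [|n]; first by rewrite !big_geq.
    by rewrite [leRHS]big_nat_recr//= lerDl c0.
  rewrite (@big_cat_nat _ _ _ n.+1 1 m)//=; last exact: ltnW.
  by lra.
have cut M : \int[P]_(w in E n0) (Num.min (W (Y n0 w)) M%:R)%:E <= (e / 2)%:E.
  pose g x := Num.min (W x) M%:R.
  have mg : measurable_fun [set: state] g by exact: measurable_minr.
  have g0 x : (0 <= g x)%R by rewrite le_min W_ge0/=.
  have gG x : ~ G x -> g x = 0%R by move=> Gx; rewrite /g W_off// min_l.
  have step k : \int[P]_(w in E n0) (g (Y n0 w))%:E <=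
      \int[P]_(w in E (n0 + k)%N) (g (Y (n0 + k)%N w))%:E +
      (\sum_(n0 <= i < n0 + k) c i)%:E.
    elim: k => [|k IH]; first by rewrite addn0 big_geq// adde0.
    apply: le_trans IH _.
    have nk : (0 < n0 + k)%N by rewrite addn_gt0 pos_n0.
    have := @excursion_step _ _ _ _ _ jump g 1 (n0 + k) mg g0 gG ler01 (W_cut M) nk.
    rewrite mul1e -/(b _) bc// => h; apply: le_trans (leeD h (le_refl _)) _.
    by rewrite -addeA -EFinD addnS big_nat_recr ?leq_addr//= addrC.
  (* Truncation at [M] bounds the remaining term by a multiple of the probability that the excursion
     still lasts, which tends to 0. No such bound holds for [W] itself, whose mean stays above
     [e]. *)
  have bound k : \int[P]_(w in E n0) (g (Y n0 w))%:E <=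
      M%:R%:E * P (E (n0 + k)%N) + (e / 2)%:E.
    apply: le_trans (step k) _; apply: leeD; last by rewrite lee_fin.
    rewrite -integral_cst//; apply: integral_le => w _; first by rewrite lee_fin.
    by rewrite lee_fin ge_min lexx orbT.
  have lim0 : (fun k => M%:R%:E * P (E (n0 + k)%N) + (e / 2)%:E) @ \oo --> (e / 2)%:E.
    rewrite -[X in _ --> X]add0e -[X in _ --> X + _](mule0 M%:R%:E).
    apply: cvgeD => //; last exact: cvg_cst.
    apply: cvgeZl => //.
    have := excursion_vanish jump r_gt0 rateT mG Gx0 finite_return.
    rewrite -(cvg_shiftn n0) => ev.
    rewrite (_ : (fun k => P (E (n0 + k)%N)) = (fun k => (P \o excursion Y G) (k + n0)%N))//.
    by apply/funext => k /=; rewrite addnC.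
  rewrite -(cvg_lim _ lim0)//; apply: lime_ge; first by apply/cvg_ex; exists (e / 2)%:E.
  by apply: nearW => k; exact: bound.
(* The step [n0] does not depend on [M], so the truncation can be removed by monotone
   convergence. *)
have : \int[P]_(w in E n0) (W (Y n0 w))%:E <= (e / 2)%:E.
  have mg M : measurable_fun (E n0) (fun w => (Num.min (W (Y n0 w)) M%:R)%:E).
    apply: measurable_funTS; apply/measurable_EFinP.
    by apply: measurable_minr => //; exact: measurableT_comp.
  have g0 (M : nat) w : E n0 w -> 0 <= (Num.min (W (Y n0 w)) M%:R)%:E.
    by move=> _; rewrite lee_fin le_min W_ge0/=.
  have nd w : E n0 w -> {homo (fun M : nat => (Num.min (W (Y n0 w)) M%:R)%:E) : n m / (n <= m)%N >-> n <= m}.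
    move=> _ n m nm; rewrite lee_fin le_min ge_min lexx/= ge_min; apply/orP; right.
    by rewrite ler_nat.
  have cv := @cvg_monotone_convergence _ _ _ P _ (mE n0) _ mg g0 nd.
  rewrite (_ : \int[P]_(w in E n0) _ = limn (fun M : nat => \int[P]_(w in E n0) (Num.min (W (Y n0 w)) M%:R)%:E)).
    by apply: lime_le; [apply/cvg_ex; eexists; exact: cv|apply: nearW => M; exact: cut].
  rewrite (cvg_lim _ cv)//; apply: eq_integral => w _; apply/esym/cvg_lim => //.
  apply: cvg_near_cst; exists (Num.trunc (W (Y n0 w))).+1 => // M /= hM.
  by rewrite min_l// ltW// (lt_le_trans (truncnS_gt _))// ler_nat//.
have := lower n0.-1; rewrite prednK// => h1 h2.
by have := le_trans h1 h2; rewrite lee_fin; move: e_gt0; lra.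
Qed.

End not_recurrent.

Section not_recurrent_simulable.
Context {R : realType} {N : nat}.
Local Notation state := (state R N).
Local Open Scope ereal_scope.
Variable A : (state -> \bar R) -> state -> \bar R.
Hypothesis sA : simulable A.
Variable rate : state -> set state -> R.
Hypothesis rateE : forall x B, measurable B ->
  rate x B = fine (A (fun y => (\1_B y)%:E) x).
Hypothesis rate_gt0 : forall x, (0 < rate x setT)%R.
Variables (x0 : state) (G : set state) (W : state -> R) (e : R).
Hypothesis mG : measurable G.
Hypothesis Gx0 : ~ G x0.
Hypothesis mW : measurable_fun [set: state] W.
Hypothesis W_ge0 : forall x, (0 <= W x)%R.
Hypothesis W_off : forall x, ~ G x -> W x = 0%R.
Hypothesis W_drift : forall x, G x ->
  (rate x setT * W x)%:E <= A (fun y => (W y)%:E) x.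
Hypothesis W_cut : forall (M : nat) x, G x ->
  (rate x setT * Num.min (W x) M%:R)%:E <= A (fun y => (Num.min (W y) M%:R)%:E) x + 1.
Hypothesis e_gt0 : (0 < e)%R.
Hypothesis W_start : (rate x0 setT * e)%:E <= A (fun y => (W y)%:E) x0.

Lemma simulable_not_positive_recurrent : ~ positive_recurrent rate x0.
Proof.
have [r [F [[mr r0 mF E] rT rE]]] := rate_simulation sA rateE.
have r_gt0 x : (0 < r x)%R by rewrite -rT.
have mWe : measurable_fun [set: state] (fun y => (W y)%:E) by exact/measurable_EFinP.
have EW x : A (fun y => (W y)%:E) x = (r x)%:E * \int[@coin R]_u (W (F (x, u)))%:E.
  by rewrite E// => y; rewrite lee_fin.
have divide x (a : R) (I : \bar R) : (rate x setT * a)%:E <= (r x)%:E * I -> a%:E <= I.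
  by rewrite rT EFinM lee_pmul2l// lte_fin.
apply: (@not_positive_recurrent _ _ rate x0 r F mr r_gt0 mF rT rE G mG Gx0 W e) => //.
- by move=> x Gx; apply: (divide x); rewrite -EW; exact: W_drift.
- move=> M x Gx; apply: (divide x); have := W_cut M Gx.
  rewrite E; last 2 first.
  + by apply/measurable_EFinP; exact: measurable_minr.
  + by move=> y; rewrite lee_fin le_min W_ge0/=.
  have : 0 <= \int[coin]_u (Num.min (W (F (x, u))) M%:R)%:E.
    by apply: integral_ge0 => u _; rewrite lee_fin le_min W_ge0/=.
  move: (\int[coin]_u _) => I I0 h; rewrite ge0_muleDr// ?lee_fin ?divr_ge0//.
  by rewrite -EFinM mulrCA divff ?gt_eqF// mulr1.
- by apply: (divide x0); rewrite -EW.
Qed.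

End not_recurrent_simulable.

Section mean_requirement.
Context {R : realType}.
Variable law : probability (measurableTypeR R) R.
Hypothesis law01 : law `]0, 1]%classic = 1%E.

Definition mean_requirement : R := fine (\int[law]_(v in `]0%R, 1%R]) v%:E)%E.

Let mD : measurable (`]0%R, 1%R]%classic : set (measurableTypeR R)).
Proof. exact: measurable_itv. Qed.

Let mv : measurable_fun [set: measurableTypeR R] (fun v : R => v%:E).
Proof. exact/measurable_EFinP. Qed.

Let v0 (v : R) : `]0%R, 1%R]%classic v -> (0 <= v%:E)%E.
Proof. by rewrite /= in_itv/= lee_fin => /andP[/ltW]. Qed.

Lemma mean_requirement_ge0 : 0 <= mean_requirement.
Proof. by rewrite fine_ge0// integral_ge0. Qed.

Lemma mean_requirementE :
  ((mean_requirement)%:E = \int[law]_(v in `]0%R, 1%R]) v%:E)%E.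
Proof.
rewrite fineK// ge0_fin_numE ?integral_ge0//.
apply: (@le_lt_trans _ _ (\int[law]_(v in `]0%R, 1%R]) (cst 1 v))%E).
  by apply: integral_le => // v; rewrite /= in_itv/= lee_fin => /andP[].
by rewrite integral_cst//= mul1e ltey_eq fin_num_measure.
Qed.

Lemma integral_arrival_ge (f : R -> \bar R) (c b : R) : 0 <= c -> 0 <= b ->
  (forall v : R, 0 <= f v)%E -> (forall v : R, (0 < v <= 1)%R -> (c + b * v)%R%:E <= f v)%E ->
  ((c + b * mean_requirement)%R%:E <= \int[law]_v f v)%E.
Proof.
move=> c0 b0 f0 fv.
apply: (@le_trans _ _ (\int[law]_(v in `]0%R, 1%R]) (c%:E + b%:E * v%:E))%E).
  rewrite ge0_integralD//; last 2 first.
  - by move=> v Dv; apply: mule_ge0; [rewrite lee_fin|exact: v0].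
  - by apply: measurable_funTS; exact: measurable_funeM.
  rewrite ge0_integralZl//.
  by rewrite integral_cst//= law01 mule1 -mean_requirementE EFinD EFinM.
rewrite integral_mkcond; apply: integral_le => v _; rewrite patchE; case: ifPn => // Dv.
  have {}Dv := set_mem Dv; rewrite adde_ge0 ?lee_fin// mulr_ge0//.
  by rewrite -lee_fin v0.
have := set_mem Dv; rewrite /= in_itv/= => v01.
by rewrite -EFinM -EFinD fv.
Qed.

End mean_requirement.

(** * Total work under an arbitrary policy *)

Section stable_load.
Context {R : realType}.
Variables (lam : R) (law : probability (measurableTypeR R) R) (pi : seq R -> pred nat).
Hypothesis lam_gt0 : 0 < lam.
Hypothesis law01 : law `]0, 1]%classic = 1%E.
Hypothesis pi_markovian : markovian_policy pi.
Local Notation state := (state R 0).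
Local Notation A := (policy_generator lam law pi).

Let sA : simulable A. Proof. exact: simulable_policy. Qed.

Let work (s : seq R) : R := \sum_(v <- s) v.
Let W (x : state) : R := if valid_jobs x.1 then work x.1 else 0.

Let work_ge0 s : valid_jobs s -> 0 <= work s.
Proof.
move=> /allP vs; rewrite /work big_seq sumr_ge0// => v /vs/andP[v0 _]; exact: ltW.
Qed.

Let W_ge0 x : 0 <= W x.
Proof. by rewrite /W; case: ifP => // /work_ge0. Qed.

Let mW : measurable_fun [set: state] W.
Proof.
apply: measurable_fun_ifT => //; first exact: measurable_valid.
apply: measurable_from_state => l m.
rewrite (_ : (fun s => _) = fun s : l.-tuple R => \sum_(i < l) tnth s i).
  by apply: measurable_sum => i; exact: measurable_tnth.
by apply/funext => s; rewrite /work big_tuple.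
Qed.

Let work_remove i s : (i < size s)%N -> work (remove_job i s) = work s - s`_i.
Proof.
move=> si; have e : s = take i s ++ s`_i :: drop i.+1 s.
  by rewrite -drop_nth// cat_take_drop.
rewrite /work /remove_job.
have -> : \sum_(v <- s) v = \sum_(v <- take i s ++ s`_i :: drop i.+1 s) v by rewrite -e.
by rewrite !big_cat/= big_cons; ring.
Qed.

Let served (s : seq R) : R := \sum_(i < size s | pi s i) 1.

Let rateT x : policy_rate lam law pi x setT = lam + served x.1.
Proof.
rewrite /policy_rate; congr (_ + _).
  rewrite (_ : [set v | _] = setT); last by apply/seteqP; split.
  by rewrite [X in fine X]probability_setT mulr1.
by apply: eq_bigr => i _; rewrite indicE in_setT.
Qed.

(** The slope [b] is the credit given to arrivals: [b = 1] for the work, and [b = 0] for its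
    truncation, which an arrival may leave unchanged. *)
Let generator_ge (g : state -> R) (x : state) (c b : R) : 0 <= c -> 0 <= b ->
  (forall y, 0 <= g y) ->
  (forall v, 0 < v <= 1 -> c + b * v <= g (rcons x.1 v, ord0)) ->
  (forall i, (i < size x.1)%N -> c - x.1`_i <= g (remove_job i x.1, ord0)) ->
  ((policy_rate lam law pi x setT * c + lam * b * mean_requirement law -
    \sum_(i < size x.1 | pi x.1 i) x.1`_i)%R%:E <= A (fun y => (g y)%:E) x)%E.
Proof.
move=> c0 b0 g0 arr dep; rewrite rateT /policy_generator sumEFin.
apply: (@le_trans _ _ (lam%:E * (c + b * mean_requirement law)%R%:E +
    (served x.1 * c - \sum_(i < size x.1 | pi x.1 i) x.1`_i)%R%:E)%E).
  rewrite -EFinM -EFinD lee_fin le_eqVlt; apply/orP; left; apply/eqP; ring.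
apply: leeD.
  rewrite lee_wpmul2l ?lee_fin ?(ltW lam_gt0)//.
  by apply: integral_arrival_ge => // v; rewrite lee_fin.
rewrite lee_fin /served mulr_suml -sumrB; apply: ler_sum => i _.
by rewrite mul1r; exact: dep.
Qed.

Let G := [set x : state | valid_jobs x.1 && (x.1 != [::])].

(** The jobs in service have total requirement at most 1 and leave at rate 1, so work is removed at
    mean rate at most 1. The truncated work drops at a departure by at most the requirement of the
    job, which gives a unit loss in [W_cut] whatever the truncation level. *)
Lemma stable_load : stable lam law pi -> lam * mean_requirement law < 1.
Proof.
move=> st; rewrite ltNge; apply/negP => heavy.
have mean0 : 0 < mean_requirement law.
  rewrite lt_neqAle mean_requirement_ge0 andbT; apply/eqP => m0.
  by move: heavy; rewrite -m0 mulr0; lra.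
have fit (x : state) : valid_jobs x.1 -> \sum_(i < size x.1 | pi x.1 i) x.1`_i <= 1.
  by have [_] := pi_markovian; exact.
have mG : measurable G.
  rewrite (_ : G = [set x | [set q | all (fun b => head false b) q.1 && (q.1 != [::])] (pattern 0 x)]).
    exact: measurable_pattern_set.
  apply/funext => -[s m]; rewrite /G/= (valid_jobs_pattern 0).
  by case: s.
apply: (@simulable_not_positive_recurrent R 0 A sA (policy_rate lam law pi) _ _
  ([::], ord0) G W (mean_requirement law)) => //.
- by move=> x B mB; rewrite policy_rateE.
- by move=> x; rewrite rateT ltr_pwDl// sumr_ge0.
- move=> x; rewrite /G/= /W; case: ifP => //= _ /negP; rewrite negbK => /eqP ->.
  by rewrite /work big_nil.
- move=> x /andP[vx _].
  apply: le_trans (@generator_ge W x (W x) 1 _ _ _ _ _) => //.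
  + rewrite lee_fin; have := fit x vx; rewrite mulr1.
    by move: (\sum_(_ < _ | _) _) (_ * W x) => a b; lra.
  + by move=> v v01; rewrite /W/= valid_rcons v01 vx/= /work big_rcons/= mul1r addrC.
  + by move=> i si; rewrite /W/= valid_remove// vx work_remove.
- move=> M x /andP[vx _].
  have := @generator_ge (fun y => Num.min (W y) M%:R) x (Num.min (W x) M%:R) 0.
  rewrite mulr0 mul0r addr0 => h.
  have {}h := h _ (lexx _) _ _ _.
  apply: (@le_trans _ _ ((policy_rate lam law pi x setT * Num.min (W x) M%:R -
    \sum_(i < size x.1 | pi x.1 i) x.1`_i)%R%:E + 1)%E).
    rewrite -EFinD lee_fin; have := fit x vx.
    by move: (\sum_(_ < _ | _) _) (_ * Num.min _ _) => a b; lra.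
  rewrite leeD2r//; apply: h.
  + by rewrite le_min W_ge0/=.
  + by move=> y; rewrite le_min W_ge0/=.
  + move=> v v01; rewrite mul0r addr0 le_min !ge_min lexx orbT andbT.
    by rewrite /W/= valid_rcons v01 vx/= /work big_rcons/= lerDl (ltW (andP v01).1).
  + move=> i si; have /andP[vi _] := valid_nth vx si.
    rewrite /W/= valid_remove// vx work_remove// le_min.
    rewrite lerD2r ge_min lexx/= lerBlDr ge_min; apply/orP; right.
    by rewrite lerDl ltW.
(* From the empty state the only transition is an arrival, so the mean requirement serves as [e]. *)
- apply: le_trans (@generator_ge W ([::], ord0) 0 1 _ _ _ _ _) => //.
  + by rewrite lee_fin rateT /served !big_ord0 addr0 mulr0 add0r subr0 mulr1.
  + by move=> v v01; rewrite /W/= v01/= /work big_seq1 add0r mul1r.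
Qed.

End stable_load.

(** * Discretization of a decreasing density *)

Section decreasing_density.
Context {R : realType}.
Variables (law : probability (measurableTypeR R) R) (f : R -> R).
Hypothesis f_ge0 : forall x, 0 < x <= 1 -> 0 <= f x.
Hypothesis f_decr : forall x y, 0 < x -> x <= y -> y <= 1 -> f y <= f x.
Hypothesis f_density : forall A : set (measurableTypeR R), measurable A ->
  law A = (\int[@lebesgue_measure R]_(x in A `&` `]0%R, 1%R]) (f x)%:E)%E.

Lemma density_law01 : law `]0, 1]%classic = 1%E.
Proof.
have mD : measurable (`]0%R, 1%R]%classic : set (measurableTypeR R)) by exact: measurable_itv.
by rewrite -[RHS](probability_setT law) [LHS]f_density// [RHS]f_density// setIid setTI.
Qed.

Variable K : nat.
Hypothesis K_gt0 : (0 < K)%N.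

Let K0 : 0 < K%:R :> R. Proof. by rewrite ltr0n. Qed.

Let cell k : set R := `]k.-1%:R / K%:R, k%:R / K%:R]%classic.

Let type_probI k : (1 <= k <= K)%N ->
  ((type_prob K law k)%:E = \int[@lebesgue_measure R]_(x in cell k) (f x)%:E)%E.
Proof.
move=> /andP[k1 kK].
have e : [set v | is_type K k v] = cell k by apply/seteqP; split=> v; rewrite /cell/= in_itv.
rewrite type_probE e [LHS]f_density; last exact: measurable_itv.
rewrite setIidl// => v; rewrite /cell/= !in_itv/= => /andP[h1 h2].
rewrite (le_lt_trans _ h1) ?divr_ge0//= (le_trans h2)//.
by rewrite ler_pdivrMr// mul1r ler_nat.
Qed.

Let integral_cell (c : R) k : (1 <= k)%N ->
  (\int[@lebesgue_measure R]_(x in cell k) c%:E = (c / K%:R)%:E)%E.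
Proof.
move=> k1; rewrite integral_cst; last exact: measurable_itv.
rewrite [X in (_ * X)%E]lebesgue_measure_itv/=.
rewrite lte_fin ltr_pM2r ?invr_gt0// ltr_nat prednK// leqnn -EFinB -mulrBl.
by rewrite -{1}(prednK k1) -natr1 addrAC subrr add0r mul1r EFinM.
Qed.

Lemma type_prob_nonincreasing i j : (1 <= i <= j)%N -> (j <= K)%N ->
  type_prob K law j <= type_prob K law i.
Proof.
move=> /andP[i1]; rewrite leq_eqVlt => /predU1P[->//|ij] jK.
have iK : (i <= K)%N by apply: leq_trans jK; exact: ltnW.
have i0 : 0 < i%:R / K%:R :> R by rewrite divr_gt0// ltr0n.
have iK1 : i%:R / K%:R <= 1 :> R by rewrite ler_pdivrMr// mul1r ler_nat.
have jK1 : j%:R / K%:R <= 1 :> R by rewrite ler_pdivrMr// mul1r ler_nat.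
have fi0 : 0 <= f (i%:R / K%:R) by rewrite f_ge0// i0.
rewrite -lee_fin !type_probI ?i1 ?(leq_trans i1 (ltnW ij))//.
(* Both probabilities are compared with the value of the density at the right end of cell i, which
   lies to the left of cell j. *)
apply: (@le_trans _ _ (f (i%:R / K%:R) / K%:R)%:E).
  rewrite -(@integral_cell _ j) ?(leq_trans i1 (ltnW ij))//.
  have above x : cell j x -> i%:R / K%:R < x <= 1.
    rewrite /cell/= in_itv/= => /andP[h1 h2]; rewrite (le_trans h2 jK1) andbT.
    by apply: le_lt_trans h1; rewrite ler_pM2r ?invr_gt0// ler_nat -ltnS prednK// (leq_trans _ ij).
  apply: integral_le => x /above/andP[h1 h2]; rewrite lee_fin.
    by rewrite f_ge0// h2 (lt_trans i0 h1).
  by rewrite f_decr// ltW.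
rewrite -(@integral_cell _ i)//; apply: integral_le => x; rewrite lee_fin => //.
rewrite /cell/= in_itv/= => /andP[h1 h2]; rewrite f_decr//.
by apply: le_lt_trans h1; rewrite divr_ge0.
Qed.

End decreasing_density.

Section discretized_load.
Context {R : realType}.
Variables (law : probability (measurableTypeR R) R) (K : nat).
Hypothesis law01 : law `]0, 1]%classic = 1%E.
Hypothesis K_gt0 : (0 < K)%N.

Lemma discretized_mean_le :
  \sum_(1 <= k < K.+1) type_prob K law k * (k%:R / K%:R) <= mean_requirement law + K%:R^-1.
Proof.
have K0 : 0 < K%:R :> R by rewrite ltr0n.
pose D := `]0%R, 1%R]%classic : set (measurableTypeR R).
have mD : measurable D by exact: measurable_itv.
pose g (v : R) : R := \sum_(1 <= k < K.+1) (is_type K k v)%:R * (k%:R / K%:R).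
have g0 v : 0 <= g v.
  by rewrite /g sumr_ge0// => k _; rewrite mulr_ge0// divr_ge0.
have mg : measurable_fun [set: measurableTypeR R] (fun v : R => (g v)%:E).
  apply/measurable_EFinP; apply: measurable_sum => k.
  by apply: measurable_funM => //; exact: measurable_type_indicator.
rewrite -lee_fin -integral_type_sum; last by move=> k; rewrite divr_ge0.
have null : law (~` D) = 0%E by rewrite [LHS]probability_setC// law01 subee.
rewrite [leLHS](@ge0_negligible_integral _ _ _ law setT (~` D))//; last 2 first.
- exact: measurableC.
- by move=> v _; rewrite lee_fin g0.
rewrite setTD setCK.
apply: (@le_trans _ _ (\int[law]_(v in D) (v%:E + (K%:R^-1)%:E))%E).
  apply: integral_le => v; first by rewrite lee_fin g0.
  rewrite /D/= in_itv/= => v01; rewrite -EFinD lee_fin.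
  have [k kK tk] := is_type_exists K_gt0 v01.
  rewrite (sum_nat_single (k0 := k)) ?tk ?mul1r//; last first.
    move=> j jK jk; case tj : (is_type K j v); last by rewrite mul0r.
    by move: jk; rewrite (is_type_unique K_gt0 tj tk) eqxx.
  have k1 : (0 < k)%N by case/andP: kK.
  move: tk => /andP[/ltW h _]; rewrite -lerBlDr; apply: le_trans h.
  by rewrite -{1}(prednK k1) -natr1 mulrDl mul1r addrK.
rewrite ge0_integralD//; last first.
- by move=> v; rewrite /D/= in_itv/= lee_fin => /andP[/ltW].
rewrite integral_cst//= -mean_requirementE// EFinD leeD2l//.
by rewrite [X in (_ * X <= _)%E]law01 mule1.
Qed.

End discretized_load.

(** [V] takes its values in ]0, 1] only almost surely; the part of the expectation outside that
    interval is discarded as negligible. *)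
Lemma expectation_requirement (R : realType) (d : measure_display) (Omega : measurableType d)
    (P : probability Omega R) (V : {RV P >-> measurableTypeR R}) :
  distribution P V `]0, 1]%classic = 1%E ->
  fine 'E_P[V] = mean_requirement (distribution P V).
Proof.
move=> law01; rewrite /mean_requirement; congr fine.
pose D := `]0%R, 1%R]%classic : set (measurableTypeR R).
have mD : measurable D by exact: measurable_itv.
have mp : measurable_fun [set: measurableTypeR R] ((fun v : R => v%:E) \_ D).
  by apply/(measurable_restrictT _ mD)/measurable_funTS/measurable_EFinP.
rewrite integral_mkcond ge0_integral_distribution//; last first.
  move=> v; rewrite patchE; case: ifPn => // /set_mem.
  by rewrite /D/= in_itv/= lee_fin => /andP[/ltW].
rewrite unlock; apply: ae_eq_integral => //.
- have mE : measurable_fun [set: measurableTypeR R] (fun v : R => v%:E) by exact/measurable_EFinP.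
  by apply: (measurableT_comp mE); exact: measurable_funPT.
- by apply: measurableT_comp => //; exact: measurable_funP.
exists (V @^-1` (~` D)); split.
- by apply: preimage_measurable; [exact: measurable_funP|exact: measurableC].
- have : distribution P V (~` D) = 0%E by rewrite [LHS]probability_setC// [X in (_ - X)%E]law01 subee.
  by [].
move=> w /= nw Dw; apply: nw => _; rewrite patchE ifT//; exact: mem_set.
Qed.

Lemma stable_of_slack (R : realType) (lam : R) (law : probability (measurableTypeR R) R)
    (f : R -> R) (L : nat) :
  0 < lam ->
  (forall x, 0 < x <= 1 -> 0 <= f x) ->
  (forall x y, 0 < x -> x <= y -> y <= 1 -> f y <= f x) ->
  (forall A : set (measurableTypeR R), measurable A ->
     law A = (\int[@lebesgue_measure R]_(x in A `&` `]0%R, 1%R]) (f x)%:E)%E) ->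
  (2 ^ L)%:R^-1 < lam^-1 - mean_requirement law ->
  emw_stable lam law L /\ enmsr_stable lam law L.
Proof.
move=> lam_gt0 f_ge0 f_decr f_density slack.
have law01 := density_law01 f_density.
have K_gt0 : (0 < 2 ^ L)%N by rewrite expn_gt0.
have pmon i j : (1 <= i <= j)%N -> (j <= 2 ^ L)%N ->
    type_prob (2 ^ L) law j <= type_prob (2 ^ L) law i.
  by move=> ij jK; exact: (type_prob_nonincreasing f_ge0 f_decr f_density K_gt0).
suff load : \sum_(1 <= k < (2 ^ L).+1) k%:R * (lam * type_prob (2 ^ L) law k) < (2 ^ L)%:R.
  by split; [exact: emw_stable_of_load|exact: enmsr_stable_of_load].
have K0 : 0 < (2 ^ L)%:R :> R by rewrite ltr0n.
have le := discretized_mean_le law01 K_gt0.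
have -> : \sum_(1 <= k < (2 ^ L).+1) k%:R * (lam * type_prob (2 ^ L) law k) =
    lam * (2 ^ L)%:R * \sum_(1 <= k < (2 ^ L).+1) type_prob (2 ^ L) law k * (k%:R / (2 ^ L)%:R).
  rewrite mulr_sumr; apply: eq_bigr => k _; field; exact: lt0r_neq0.
rewrite -[ltRHS]mul1r mulrAC ltr_pM2r// -ltr_pdivlMl// mulr1.
by apply: le_lt_trans le _; rewrite addrC -ltrBrDr.
Qed.

Theorem theorem4 (R : realType) (d : measure_display) (Omega : measurableType d)
    (P : probability Omega R) (V : {RV P >-> measurableTypeR R})
    (f : R -> R) (lam : R)
    (hlam : 0 < lam)
    (f_ge0 : forall x, 0 < x <= 1 -> 0 <= f x)
    (f_decr : forall x y, 0 < x -> x <= y -> y <= 1 -> f y <= f x)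
    (f_density : forall A : set (measurableTypeR R), measurable A ->
       distribution P V A =
       (\int[@lebesgue_measure R]_(x in A `&` `]0%R, 1%R]) (f x)%:E)%E) :
  let law := distribution P V : probability (measurableTypeR R) R in
  let EV := fine ('E_P[V])%E in
  let stabilizable := exists pi : seq R -> pred nat,
    markovian_policy pi /\ stable lam law pi in
  [/\ stabilizable ->
        (exists L, emw_stable lam law L) /\ (exists L, enmsr_stable lam law L),
      lam < EV^-1 ->
        exists L, emw_stable lam law L /\ enmsr_stable lam law L &
      stabilizable \/ lam < EV^-1 ->
        forall L : nat,
          L%:Z = Num.floor (- (ln (lam^-1 - EV) / ln 2)) + 1 ->
          emw_stable lam law L /\ enmsr_stable lam law L].
Proof.
move=> law EV stabilizable.
have law01 : law `]0, 1]%classic = 1%E := density_law01 f_density.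
have EVE : EV = mean_requirement law by exact: expectation_requirement.
have EV0 : 0 <= EV by rewrite EVE mean_requirement_ge0.
have slackE : lam * EV < 1 -> 0 < lam^-1 - EV.
  by move=> h; rewrite subr_gt0 -(ltr_pM2l hlam) mulfV// lt0r_neq0.
have necessary : stabilizable -> 0 < lam^-1 - EV.
  by move=> [pi [mpi st]]; apply: slackE; rewrite EVE; exact: (stable_load hlam law01 mpi st).
have sufficient : lam < EV^-1 -> 0 < lam^-1 - EV.
  move=> h; apply: slackE; have [EV1|EV1] := ltP 0 EV; first by rewrite -ltr_pdivlMr// mul1r.
  by rewrite (_ : EV = 0) ?mulr0//; apply/le_anti; rewrite EV1.
have enough L : (2 ^ L)%:R^-1 < lam^-1 - EV -> emw_stable lam law L /\ enmsr_stable lam law L.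
  by rewrite EVE; exact: (stable_of_slack hlam f_ge0 f_decr f_density).
have large : 0 < lam^-1 - EV -> exists L, emw_stable lam law L /\ enmsr_stable lam law L.
  (* Any L with 2^L above the inverse of the slack is suitable, and 2^L exceeds L. *)
  move=> s0; exists (Num.trunc (lam^-1 - EV)^-1).+1; apply: enough.
  rewrite invf_plt ?posrE ?ltr0n ?expn_gt0//.
  by apply: lt_le_trans (truncnS_gt _) _; rewrite ler_nat ltnW// ltn_expl.
split.
- by move=> /necessary/large[L [h1 h2]]; split; exists L.
- by move=> /sufficient/large.
move=> h L hL; have {h}s0 : 0 < lam^-1 - EV by case: h => [/necessary|/sufficient].
apply: enough; move: s0 hL; move: (lam^-1 - EV) => s s0 hL.
have ln20 : 0 < ln (2 : R) by rewrite ln_gt0// ltr1n.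
(* Since a number is less than its floor plus 1, this [L] exceeds minus the binary logarithm of [s],
   which means 2^-L < s. *)
have := floorD1_gt (- (ln s / ln 2)); rewrite -hL ltrNl.
rewrite ltr_pdivlMr// => lt.
rewrite -ltr_ln ?posrE ?invr_gt0 ?ltr0n ?expn_gt0//.
apply: le_lt_trans lt.
by rewrite lnV ?posrE ?ltr0n ?expn_gt0// natrX lnXn// mulNr mulr_natl.
Qed.
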